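(* Consider a 5-manifold with coordinates $(\psi,\theta,\phi,x,q)$, $\sin\theta\ne0$, and $\sigma_i,E^i$ the left-invariant 1-forms and dual vector fields of $SU(2)$ in Euler angles $(\psi,\theta,\phi)$ (see context). For either choice of sign (upper signs throughout or lower signs throughout), let $D^{\mp}$ be the complex rank 2 distribution spanned by $$X^1=\partial_x+E^2,\qquad X^{2\mp}=\partial_q+ e^{\mp 3ix} E^1\mp 3i e^{\mp 3ix} E^3 .$$ Let $$o_1=\sigma_1-e^{\mp3ix}dq,\quad o_2=\sigma_2-dx,\quad o_3=\sigma_3\pm 3i e^{\mp 3ix}dq,\quad o_4=-dx,\quad o_5=e^{\mp3ix}dq$$ (so $o_1,o_2,o_3$ span the annihilator of $D^{\mp}$) and $$\tilde{o}_1=\sigma_1+e^{\mp3ix}dq, \quad \tilde{o}_2=\sigma_2+dx,\quad \tilde{o}_3=o_3$$ (which span the annihilator of the sign-reversed distribution $\tilde D^{\mp}$). Then $D^{\mp}$ is maximally symmetric and a representative metric of Nurowski's conformal class associated to $D^{\mp}$ is $$g_{\mp}=-2(o_4 o_4+o_5o_5)+\tfrac{1}{2}\tilde{o}_1\tilde{o}_1+\tfrac{1}{2}\tilde{o}_2\tilde{o}_2-\tfrac{1}{6}\tilde{o}_3 \tilde{o}_3$$ $$=\sigma_1\sigma_1+\sigma_2\sigma_2-o_4o_4-o_5o_5-\tfrac{1}{2}(o_1o_1+o_2o_2)-\tfrac{1}{6}o_3o_3 .$$ The metric $g_{\mp}$ is conformally flat.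
   Context: Products of 1-forms are symmetric products. All vector fields, 1-forms and metrics are complex-valued, and all notions (brackets, annihilators, metrics, Weyl tensor) are extended complex-linearly. Left-invariant forms and vector fields on $SU(2)\cong S^3$ in Euler angles $(\psi,\theta,\phi)$: $$\sigma_1=\sin\psi\,d\theta-\cos\psi\sin\theta\,d\phi,\quad \sigma_2=\cos\psi\,d\theta+\sin\psi\sin\theta\,d\phi,\quad \sigma_3=-d\psi-\cos\theta\,d\phi,$$ with dual vector fields $$E^1=\sin\psi\,\partial_\theta+\cos\psi\left(\cot\theta\,\partial_\psi-\tfrac{1}{\sin\theta}\partial_\phi\right),\quad E^2=\cos\psi\,\partial_\theta-\sin\psi\left(\cot\theta\,\partial_\psi-\tfrac{1}{\sin\theta}\partial_\phi\right),\quad E^3=-\partial_\psi .$$ The sign-reversed distribution $\tilde D^\mp$ is the kernel of $\tilde o_1,\tilde o_2,\tilde o_3$. A $(2,3,5)$-distribution on a 5-manifold is a rank 2 distribution $D$ with $[D,D]$ of rank 3 and $[[D,D],D]$ the full tangent bundle. Nurowski's conformal class of $D$: locally there exist a coframe $(\theta_1,\dots,\theta_5)$ with $D=\ker(\theta_1,\theta_2,\theta_3)$ and 1-forms $\Omega_1,\dots,\Omega_7$ satisfying Cartan's structure equations $$d\theta_1=\theta_1\wedge(2\Omega_1+\Omega_4)+\theta_2\wedge\Omega_2+\theta_3\wedge\theta_4,$$ $$d\theta_2=\theta_1\wedge\Omega_3+\theta_2\wedge(\Omega_1+2\Omega_4)+\theta_3\wedge\theta_5,$$ $$d\theta_3=\theta_1\wedge\Omega_5+\theta_2\wedge\Omega_6+\theta_3\wedge(\Omega_1+\Omega_4)+\theta_4\wedge\theta_5,$$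 $$d\theta_4=\theta_1\wedge\Omega_7+\tfrac43\theta_3\wedge\Omega_6+\theta_4\wedge\Omega_1+\theta_5\wedge\Omega_2,$$ $$d\theta_5=\theta_2\wedge\Omega_7-\tfrac43\theta_3\wedge\Omega_5+\theta_4\wedge\Omega_3+\theta_5\wedge\Omega_4,$$ and the class is that of $g=2\theta_1\theta_5-2\theta_2\theta_4+\frac43\theta_3\theta_3$, up to multiplication by nowhere-zero functions. $D$ is called maximally symmetric when $g$ has vanishing Weyl tensor. *)

(* Defs.v *)
From HB Require Import structures.
From mathcomp Require Import all_boot all_order all_algebra.
From mathcomp Require Import complex.
From mathcomp Require Import all_classical all_reals all_analysis.
Set Implicit Arguments.
Unset Strict Implicit.
Unset Printing Implicit Defensive.
Import Order.TTheory GRing.Theory Num.Theory.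
Import numFieldNormedType.Exports.
Local Open Scope classical_set_scope.
Local Open Scope ring_scope.
Local Open Scope complex_scope.

(* Everything lives on open subsets of R^5.  Both tangent vectors and covectors
   are given by their complex components, in the coordinate frame and in the
   dual coordinate coframe respectively. *)
Notation coords R := 'rV[R]_5.
Notation cvec R := 'rV[R[i]]_5.
Notation vfield R := (coords R -> cvec R).
Notation oneform R := (coords R -> cvec R).
Notation twoform R := (coords R -> 'M[R[i]]_5).
Notation bilform R := (coords R -> 'M[R[i]]_5).
Notation distrib R := (coords R -> {vspace cvec R}).

Section Calculus.
Context {R : realType}.
Implicit Types (U V : set (coords R)) (p q : coords R) (i j k l : 'I_5).

Definition partialR i (f : coords R -> R) : coords R -> R :=
  fun p => 'D_(delta_mx 0 i) f p.

(* C^oo: all iterated partial derivatives exist and are differentiable *)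
Definition smoothR U (f : coords R -> R) : Prop :=
  forall (s : seq 'I_5) p, U p -> differentiable (foldr partialR f s) p.

Definition partial i (f : coords R -> R[i]) : coords R -> R[i] :=
  fun p => partialR i (fun q => complex.Re (f q)) p +i* partialR i (fun q => complex.Im (f q)) p.

Definition smooth U (f : coords R -> R[i]) : Prop :=
  smoothR U (fun q => complex.Re (f q)) /\ smoothR U (fun q => complex.Im (f q)).

(* smoothness of vector fields and of 1-forms *)
Definition smooth_rV U (X : coords R -> cvec R) : Prop :=
  forall i, smooth U (fun q => X q 0 i).

Definition nbhd_in U p V : Prop := [/\ open V, V p & V `<=` U].

(* Conventions: (a /\ b)(X, Y) = a(X) b(Y) - b(X) a(Y), the matrix of a 2-form w
   is w(@_i, @_j), and a b = (a (x) b + b (x) a) / 2. *)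
Definition wedge (a b : oneform R) : twoform R :=
  fun p => (a p)^T *m b p - (b p)^T *m a p.

Definition ext_d (a : oneform R) : twoform R := fun p =>
  \matrix_(i, j) (partial i (fun q => a q 0 j) p
                  - partial j (fun q => a q 0 i) p).

Definition sprod (a b : oneform R) : bilform R :=
  fun p => 2^-1 *: ((a p)^T *m b p + (b p)^T *m a p).

Definition lie (X Y : vfield R) : vfield R := fun p =>
  \row_k \sum_i (X p 0 i * partial i (fun q => Y q 0 k) p
                 - Y p 0 i * partial i (fun q => X q 0 k) p).

End Calculus.

Section Distributions.
Context {R : realType}.
Implicit Types (U V : set (coords R)) (p q : coords R) (D E F : distrib R).

(* The pairing of a covector a with a vector v is a *m v^T = v *m a^T. *)
Definition ker_forms (s : seq (cvec R)) : {vspace cvec R} :=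
  (\bigcap_(a <- s) lker (linfun (mulmxr a^T)))%VS.

Definition annihilator (W : {vspace cvec R}) : {vspace cvec R} :=
  ker_forms (vbasis W).

Lemma mem_ker_forms (s : seq (cvec R)) (v : cvec R) :
  (v \in ker_forms s) = all (fun a => v *m a^T == 0) s.
Proof.
rewrite /ker_forms; elim: s => [|a s IH] /=; first by rewrite big_nil memvf.
by rewrite big_cons memv_cap memv_ker lfunE /= IH.
Qed.

Lemma mem_annihilator (W : {vspace cvec R}) (a : cvec R) :
  a \in annihilator W <-> forall v, v \in W -> a *m v^T = 0.
Proof.
rewrite /annihilator mem_ker_forms; split=> [/allP aW v vW|aW].
  rewrite (coord_vbasis vW) linear_sum mulmx_sumr big1 // => k _.
  rewrite linearZ -scalemxAr (eqP (aW _ _)) ?scaler0 //.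
  by rewrite mem_nth ?size_tuple.
by apply/allP => v /vbasis_mem vW; apply/eqP/aW.
Qed.

Definition is_distribution U (r : nat) D : Prop :=
  forall p, U p -> exists V (X : 'I_r -> vfield R),
    [/\ nbhd_in U p V, forall k, smooth_rV V (X k)
      & forall q, V q -> basis_of (D q) [tuple X k q | k < r]].

Definition is_section V D (X : vfield R) : Prop :=
  smooth_rV V X /\ forall q, V q -> X q \in D q.

(* F = [D, E]: F p is the smallest subspace containing the value at p of every
   bracket of local sections of D and E. *)
Definition is_bracket U D E F : Prop :=
  let contains_brackets p (W : {vspace cvec R}) :=
    forall V X Y, nbhd_in U p V -> is_section V D X -> is_section V E Y ->
      lie X Y p \in W in
  forall p, U p ->
    contains_brackets p (F p) /\
    forall W, contains_brackets p W -> (F p <= W)%VS.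

Definition is_235 U D : Prop :=
  exists D1 D2 : distrib R,
    [/\ is_distribution U 2 D,
        is_bracket U D D D1 /\ is_distribution U 3 D1
      & is_bracket U D1 D D2 /\ forall p, U p -> D2 p = fullv].

End Distributions.

Section Curvature.
Context {R : realType}.
Implicit Types (U V : set (coords R)) (p q : coords R) (i j k l m : 'I_5).
Variable g : bilform R.

Definition is_metric U : Prop :=
  (forall i j, smooth U (fun q => g q i j)) /\
  forall p, U p -> (g p)^T = g p /\ g p \in unitmx.

(* Gamma^k_ij *)
Definition christoffel k i j : coords R -> R[i] := fun p =>
  2^-1 * \sum_l invmx (g p) k l *
    (partial i (fun q => g q j l) p + partial j (fun q => g q i l) p
     - partial l (fun q => g q i j) p).

(* R^l_kij, with R(@_i, @_j) @_k = R^l_kij @_l *)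
Definition riemann l k i j : coords R -> R[i] := fun p =>
  partial i (christoffel l j k) p - partial j (christoffel l i k) p
  + \sum_m (christoffel l i m p * christoffel m j k p
            - christoffel l j m p * christoffel m i k p).

Definition ricci k j : coords R -> R[i] := fun p => \sum_i riemann i k i j p.

Definition scalar_curv : coords R -> R[i] :=
  fun p => \sum_k \sum_j invmx (g p) k j * ricci k j p.

(* W_lkij in dimension n = 5: the denominators are n - 2 = 3 and
   (n - 1) (n - 2) = 12. *)
Definition weyl l k i j : coords R -> R[i] := fun p =>
  \sum_m g p l m * riemann m k i j p
  - 3^-1 * (g p l i * ricci k j p - g p l j * ricci k i p
            + g p k j * ricci l i p - g p k i * ricci l j p)
  + 12^-1 * scalar_curv p * (g p l i * g p k j - g p l j * g p k i).

Definition weyl_vanishes U : Prop :=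
  forall l k i j p, U p -> weyl l k i j p = 0.

Definition is_flat U : Prop :=
  forall l k i j p, U p -> riemann l k i j p = 0.

End Curvature.

Section Nurowski.
Context {R : realType}.
Implicit Types (U V : set (coords R)) (p q : coords R) (D : distrib R).
Implicit Types (g : bilform R).

Definition conformal_factor U (f : coords R -> R[i]) : Prop :=
  smooth U f /\ forall p, U p -> f p != 0.

Definition conformally_flat U g : Prop :=
  forall p, U p -> exists V f,
    [/\ nbhd_in U p V, conformal_factor V f & is_flat (fun q => f q *: g q) V].

Record cartan_data := CartanData {
  th1 : oneform R; th2 : oneform R; th3 : oneform R;
  th4 : oneform R; th5 : oneform R;
  Om1 : oneform R; Om2 : oneform R; Om3 : oneform R; Om4 : oneform R;
  Om5 : oneform R; Om6 : oneform R; Om7 : oneform R }.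

Definition smooth_data V (c : cartan_data) : Prop :=
  forall a, a \in [:: th1 c; th2 c; th3 c; th4 c; th5 c;
                      Om1 c; Om2 c; Om3 c; Om4 c; Om5 c; Om6 c; Om7 c] ->
    smooth_rV V a.

Definition structure_equations V (c : cartan_data) : Prop :=
  let: CartanData t1 t2 t3 t4 t5 O1 O2 O3 O4 O5 O6 O7 := c in
  forall p, V p ->
  [/\ ext_d t1 p = (wedge t1 (2 *: O1 + O4) + wedge t2 O2 + wedge t3 t4) p,
      ext_d t2 p = (wedge t1 O3 + wedge t2 (O1 + 2 *: O4) + wedge t3 t5) p,
      ext_d t3 p = (wedge t1 O5 + wedge t2 O6 + wedge t3 (O1 + O4)
                    + wedge t4 t5) p,
      ext_d t4 p = (wedge t1 O7 + (4 / 3) *: wedge t3 O6 + wedge t4 O1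
                    + wedge t5 O2) p
    & ext_d t5 p = (wedge t2 O7 - (4 / 3) *: wedge t3 O5 + wedge t4 O3
                    + wedge t5 O4) p].

Definition cartan_coframe V D (c : cartan_data) : Prop :=
  [/\ smooth_data V c,
      forall q, V q ->
        basis_of fullv [:: th1 c q; th2 c q; th3 c q; th4 c q; th5 c q],
      forall q, V q -> D q = ker_forms [:: th1 c q; th2 c q; th3 c q]
    & structure_equations V c].

Definition cartan_metric (c : cartan_data) : bilform R :=
  2 *: sprod (th1 c) (th5 c) - 2 *: sprod (th2 c) (th4 c)
  + (4 / 3) *: sprod (th3 c) (th3 c).

(* g represents Nurowski's conformal class of D on U *)
Definition nurowski_representative U D g : Prop :=
  [/\ is_235 U D, is_metric g U &
      forall p, U p -> exists V c f,
        [/\ nbhd_in U p V, cartan_coframe V D c, conformal_factor V f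
          & forall q, V q -> g q = f q *: cartan_metric c q]].

Definition maximally_symmetric U D : Prop :=
  is_235 U D /\
  forall p, U p -> exists V c,
    [/\ nbhd_in U p V, cartan_coframe V D c
      & weyl_vanishes (cartan_metric c) V].

End Nurowski.

Section Example.
Context {R : realType}.
Implicit Types (p : coords R).

Definition ipsi : 'I_5 := @Ordinal 5 0 isT.
Definition itheta : 'I_5 := @Ordinal 5 1 isT.
Definition iphi : 'I_5 := @Ordinal 5 2 isT.
Definition ix : 'I_5 := @Ordinal 5 3 isT.
Definition iq : 'I_5 := @Ordinal 5 4 isT.

(* The coordinate vector field @_i and the coordinate 1-form dx_i have the
   same components. *)
Definition ddc (i : 'I_5) : vfield R := fun=> delta_mx 0 i.
Definition dc (i : 'I_5) : oneform R := fun=> delta_mx 0 i.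

Definition sinc (i : 'I_5) p : R[i] := (sin (p 0 i))%:C.
Definition cosc (i : 'I_5) p : R[i] := (cos (p 0 i))%:C.

Definition sigma1 : oneform R := fun p =>
  sinc ipsi p *: dc itheta p - (cosc ipsi p * sinc itheta p) *: dc iphi p.
Definition sigma2 : oneform R := fun p =>
  cosc ipsi p *: dc itheta p + (sinc ipsi p * sinc itheta p) *: dc iphi p.
Definition sigma3 : oneform R := fun p =>
  - dc ipsi p - cosc itheta p *: dc iphi p.

Definition E1 : vfield R := fun p =>
  sinc ipsi p *: ddc itheta p
  + cosc ipsi p *: ((cosc itheta p / sinc itheta p) *: ddc ipsi p
                    - (sinc itheta p)^-1 *: ddc iphi p).
Definition E2 : vfield R := fun p =>
  cosc ipsi p *: ddc itheta p
  - sinc ipsi p *: ((cosc itheta p / sinc itheta p) *: ddc ipsi p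
                    - (sinc itheta p)^-1 *: ddc iphi p).
Definition E3 : vfield R := fun p => - ddc ipsi p.

(* The choice of sign: lower = false selects the upper signs throughout and
   lower = true the lower ones, so that +- is pm and -+ is - pm. *)
Definition pm (lower : bool) : R[i] := (-1) ^+ lower.

Definition iC : R[i] := 0 +i* 1.

(* e^(-+ 3 i x) = cos (3 x) -+ i sin (3 x) *)
Definition e3x (lower : bool) p : R[i] :=
  (cos (3 * p 0 ix))%:C - pm lower * iC * (sin (3 * p 0 ix))%:C.

Definition X1 : vfield R := fun p => ddc ix p + E2 p.
Definition X2 (lower : bool) : vfield R := fun p =>
  ddc iq p + e3x lower p *: E1 p - (pm lower * 3 * iC * e3x lower p) *: E3 p.

Definition Dist (lower : bool) : distrib R :=
  fun p => <<[:: X1 p; X2 lower p]>>%VS.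

Definition o1 (lower : bool) : oneform R :=
  fun p => sigma1 p - e3x lower p *: dc iq p.
Definition o2 : oneform R := fun p => sigma2 p - dc ix p.
Definition o3 (lower : bool) : oneform R :=
  fun p => sigma3 p + (pm lower * 3 * iC * e3x lower p) *: dc iq p.
Definition o4 : oneform R := fun p => - dc ix p.
Definition o5 (lower : bool) : oneform R := fun p => e3x lower p *: dc iq p.

Definition ot1 (lower : bool) : oneform R :=
  fun p => sigma1 p + e3x lower p *: dc iq p.
Definition ot2 : oneform R := fun p => sigma2 p + dc ix p.
Definition ot3 (lower : bool) : oneform R := o3 lower.

(* the sign-reversed distribution *)
Definition Dist_rev (lower : bool) : distrib R :=
  fun p => ker_forms [:: ot1 lower p; ot2 p; ot3 lower p].

Definition g_metric (lower : bool) : bilform R :=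
  - (2 *: (sprod o4 o4 + sprod (o5 lower) (o5 lower)))
  + 2^-1 *: sprod (ot1 lower) (ot1 lower) + 2^-1 *: sprod ot2 ot2
  - 6^-1 *: sprod (ot3 lower) (ot3 lower).

Definition g_metric_alt (lower : bool) : bilform R :=
  sprod sigma1 sigma1 + sprod sigma2 sigma2 - sprod o4 o4
  - sprod (o5 lower) (o5 lower)
  - 2^-1 *: (sprod (o1 lower) (o1 lower) + sprod o2 o2)
  - 6^-1 *: sprod (o3 lower) (o3 lower).

End Example.

(* Main.v *)
Require Import Defs.
From HB Require Import structures.
From mathcomp Require Import all_boot all_order all_algebra.
From mathcomp Require Import complex.
From mathcomp Require Import all_classical all_reals all_analysis.
From mathcomp Require Import ring.
Set Implicit Arguments.
Unset Strict Implicit.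
Unset Printing Implicit Defensive.
Import Order.TTheory GRing.Theory Num.Theory.
Import numFieldNormedType.Exports.
Local Open Scope classical_set_scope.
Local Open Scope ring_scope.

(* Set iota = +-i.  The constant-coefficient combinations o1, iota o2,
   iota/2 o3, iota/2 (o2 - 4 o4), (o1 + 4 o5)/2 of the given 1-forms satisfy
   Cartan's structure equations with constant coefficients, because d sigma_i
   is quadratic in the sigma_j and d(e^(-3 iota x) dq) = -3 iota dx /\ e^(-3 iota x) dq.
   The resulting metric 2 t1 t5 - 2 t2 t4 + 4/3 t3 t3 equals 2 g.  Its
   Levi-Civita connection has constant coefficients in this coframe, so its
   curvature is a finite computation: it is the Kulkarni-Nomizu product of g
   with a diagonal tensor, whence the Weyl tensor vanishes.  Rescaling g by
   (sin theta e^(i phi))^-2 changes the connection by the logarithmic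
   derivative of the factor, and the new connection is flat.  The brackets of
   the dual frame, read off from the structure equations, give the (2,3,5)
   condition. *)

(** * Partial derivatives of elementary functions *)

(** The Christoffel symbols contain the inverse of the coordinate metric, so expanding the curvature
    in Euler angles is hopeless. The connection is guessed instead: being torsion-free and
    compatible with the metric identifies it, and a gauge transformation moves its curvature between
    coordinates and coframe. What remains is arithmetic on 5 x 5 tables. The factors iota in the
    coframe make every structure constant rational and independent of the sign, so the same tables
    serve both choices. The function s = sin theta e^(i phi) comes from the rotation group: (E1 s,
    E2 s, s) is a complex vector rotated by SU(2), with ds = (E1 s) sigma1 + (E2 s) sigma2, d(E1 s)
    = - s sigma1 - (E2 s) sigma3, d(E2 s) = - s sigma2 + (E1 s) sigma3, and it is null: (E1 s)^2 +
    (E2 s)^2 + s^2 = 0. These relations are all that the flatness of s^-2 g needs. That flatness is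
    computed directly rather than deduced from the vanishing of the Weyl tensor. *)

Lemma near_eq_differentiable (R : numFieldType) (V W : normedModType R)
    (f g : V -> W) (a : V) :
  (\near a, f a = g a) -> differentiable f a -> differentiable g a.
Proof.
move=> fg df.
have fga : f a = g a := nbhs_singleton fg.
(* The differential of [f] leaves a little-o remainder for [g] as well, since little-o at 0 sees
   only nearby points; uniqueness of the differential then concludes. *)
have gE : g \o shift a = cst (g a) + 'd f a +o_ (0 : V) id.
  apply/eqaddoP => _/posnumP[e].
  have /eqaddoP/(_ _ (gt0 e)) := diff_locally df.
  have fg0 : \forall v \near (0 : V), f (v + a) = g (v + a).
    by move: fg; rewrite (near_shift 0 a) subr0.
  apply: filterS2 fg0 => v /= fgv; rewrite -fga.
  by rewrite !fctE /= fgv.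
have dfc : continuous ('d f a) by apply: diff_continuous.
by apply/diff_locallyP; rewrite (diff_unique dfc gE).
Qed.

Section ScalarCalculus.
Context {R : realType}.
Implicit Types (U : set (coords R)) (p : coords R) (f g : coords R -> R).
Implicit Types (i j : 'I_5).

Lemma partialR_near U i f g p : open U -> U p ->
  (forall q, U q -> f q = g q) -> partialR i f p = partialR i g p.
Proof.
move=> oU Up fg; apply: near_eq_derive.
by apply: filterS (open_nbhs_nbhs (conj oU Up)) => q; exact: fg.
Qed.

Lemma partialR_cst i (c : R) p : partialR i (fun=> c) p = 0.
Proof. exact: derive_cst. Qed.

Lemma differentiable_coord_rV (k : 'I_5) p :
  differentiable (fun q : coords R => q 0 k : R) p.
Proof. exact: differentiable_coord. Qed.

Lemma partialR_coord i k p : partialR i (fun q => q 0 k) p = (i == k)%:R.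
Proof.
rewrite /partialR deriveE; last exact: differentiable_coord_rV.
have @f : {linear coords R -> R}.
  by exists (fun N : coords R => N 0 k); do 2![eexists]; do ?[constructor];
     rewrite ?mxE// => ? *; rewrite ?mxE//; move=> ?; rewrite !mxE.
rewrite -[fun _ => _]/(f : coords R -> R) diff_lin; last exact: coord_continuous.
by rewrite /= mxE eqxx eq_sym.
Qed.

Lemma partialRD i f g p : differentiable f p -> differentiable g p ->
  partialR i (fun q => f q + g q) p = partialR i f p + partialR i g p.
Proof. by move=> df dg; apply: deriveD; apply: diff_derivable. Qed.

Lemma partialRN i f p : differentiable f p ->
  partialR i (fun q => - f q) p = - partialR i f p.
Proof. by move=> df; apply: deriveN; apply: diff_derivable. Qed.

Lemma partialRM i f g p : differentiable f p -> differentiable g p ->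
  partialR i (fun q => f q * g q) p
  = partialR i f p * g p + f p * partialR i g p.
Proof.
move=> df dg; rewrite addrC [partialR i f p * _]mulrC.
by apply: deriveM; apply: diff_derivable.
Qed.

Lemma partialRV i f p : f p != 0 -> differentiable f p ->
  partialR i (fun q => (f q)^-1) p = - (f p)^-1 * (f p)^-1 * partialR i f p.
Proof.
move=> f0 df; rewrite /partialR deriveV //; last exact: diff_derivable.
by rewrite /GRing.scale /= -exprVn expr2 !mulNr.
Qed.

Lemma differentiable_sin (x : R) : differentiable (@sin R) x.
Proof. exact/derivable1_diffP/derivable_sin. Qed.

Lemma differentiable_cos (x : R) : differentiable (@cos R) x.
Proof. by apply/derivable1_diffP; apply: ex_derive. Qed.

Lemma partialR_sin i f p : differentiable f p ->
  partialR i (fun q => sin (f q)) p = cos (f p) * partialR i f p.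
Proof.
move=> df; rewrite /partialR -[fun q => _]/(sin \o f).
have ds := differentiable_sin (f p).
rewrite !deriveE //; last exact: differentiable_comp.
rewrite diff_comp //= diff1E // derive1E.
by rewrite (@derive_val _ _ _ _ _ _ _ (is_derive_sin (f p))) mulrC.
Qed.

Lemma partialR_cos i f p : differentiable f p ->
  partialR i (fun q => cos (f q)) p = - sin (f p) * partialR i f p.
Proof.
move=> df; rewrite /partialR -[fun q => _]/(cos \o f).
have dc := differentiable_cos (f p).
rewrite !deriveE //; last exact: differentiable_comp.
rewrite diff_comp //= diff1E // derive1E.
by rewrite (@derive_val _ _ _ _ _ _ _ (is_derive_cos (f p))) mulrC.
Qed.

(* Closed under partial derivatives, whence smoothness, and with commuting
   partial derivatives, which the curvature computation needs. *)
Inductive elementary U : (coords R -> R) -> Prop :=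
| elementary_cst c : elementary U (fun=> c)
| elementary_coord k : elementary U (fun q => q 0 k)
| elementaryD f g : elementary U f -> elementary U g ->
    elementary U (fun q => f q + g q)
| elementaryM f g : elementary U f -> elementary U g ->
    elementary U (fun q => f q * g q)
| elementaryV f : elementary U f -> (forall q, U q -> f q != 0) ->
    elementary U (fun q => (f q)^-1)
| elementary_sin f : elementary U f -> elementary U (fun q => sin (f q))
| elementary_cos f : elementary U f -> elementary U (fun q => cos (f q)).

Lemma elementaryN U f : elementary U f -> elementary U (fun q => - f q).
Proof.
move=> ef; rewrite (_ : (fun q => _) = fun q => -1 * f q).
  by apply: elementaryM => //; apply: elementary_cst.
by apply: funext => q; rewrite mulN1r.
Qed.

Lemma elementary_differentiable U f p :
  elementary U f -> U p -> differentiable f p.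
Proof.
move=> ef Up; elim: ef => {f} [c|k|f g _ df _ dg|f g _ df _ dg|f _ df f0|f _ df|f _ df].
- exact: differentiable_cst.
- exact: differentiable_coord_rV.
- exact: differentiableD.
- exact: differentiableM.
- by apply: differentiableV => //; apply: f0.
- by apply: (@differentiable_comp _ _ _ _ f sin) => //; exact: differentiable_sin.
- by apply: (@differentiable_comp _ _ _ _ f cos) => //; exact: differentiable_cos.
Qed.

(** Agreement is claimed on [U] only, because the formula for the derivative of an inverse needs its
    argument to be nonzero. *)
Lemma elementary_partialR U i f : elementary U f ->
  exists2 g, elementary U g & forall p, U p -> partialR i f p = g p.
Proof.
elim=> {f} [c|k|f g ef [f' ef' fE] eg [g' eg' gE]|f g ef [f' ef' fE] eg [g' eg' gE]
  |f ef [f' ef' fE] f0|f ef [f' ef' fE]|f ef [f' ef' fE]].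
- by exists (fun=> 0) => [|p _]; [exact: elementary_cst|rewrite partialR_cst].
- exists (fun=> (i == k)%:R) => [|p _]; first exact: elementary_cst.
  by rewrite partialR_coord.
- exists (fun p => f' p + g' p) => [|p Up]; first exact: elementaryD.
  by rewrite partialRD ?fE ?gE //; apply: elementary_differentiable Up.
- exists (fun p => f' p * g p + f p * g' p) => [|p Up].
    by apply: elementaryD; apply: elementaryM.
  by rewrite partialRM ?fE ?gE //; apply: elementary_differentiable Up.
- exists (fun p => - (f p)^-1 * (f p)^-1 * f' p) => [|p Up].
    apply: elementaryM => //; apply: elementaryM; last exact: elementaryV.
    by apply: elementaryN; apply: elementaryV.
  by rewrite partialRV ?fE ?f0 //; apply: elementary_differentiable Up.
- exists (fun p => cos (f p) * f' p) => [|p Up].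
    by apply: elementaryM => //; apply: elementary_cos.
  by rewrite partialR_sin ?fE //; apply: elementary_differentiable Up.
- exists (fun p => - sin (f p) * f' p) => [|p Up].
    by apply: elementaryM => //; apply: elementaryN; apply: elementary_sin.
  by rewrite partialR_cos ?fE //; apply: elementary_differentiable Up.
Qed.

Lemma elementary_differentiable_partialR U i f p : open U ->
  elementary U f -> U p -> differentiable (partialR i f) p.
Proof.
move=> oU ef Up; have [g eg fg] := elementary_partialR i ef.
apply: near_eq_differentiable (elementary_differentiable eg Up).
by apply: filterS (open_nbhs_nbhs (conj oU Up)) => q Uq; rewrite fg.
Qed.

Lemma smoothR_elementary U f : open U -> elementary U f -> smoothR U f.
Proof.
move=> oU ef s.
suff [g eg fg] : exists2 g, elementary U g
    & forall p, U p -> foldr partialR f s p = g p.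
  move=> p Up; apply: near_eq_differentiable (elementary_differentiable eg Up).
  by apply: filterS (open_nbhs_nbhs (conj oU Up)) => q Uq; rewrite fg.
elim: s => [|i s [g eg fg]] /=; first by exists f.
have [h eh gh] := elementary_partialR i eg.
by exists h => // p Up; rewrite (partialR_near i oU Up fg) gh.
Qed.

(** Induction on the construction of [f]: for each constructor, the sum, product or chain rule
    expands the second derivative into an expression symmetric in [i] and [j], once the second
    derivatives of the constituents are symmetric. The first-order formulas hold near [p] because
    [U] is open, so they may be differentiated again. *)
Lemma elementary_partialRC U i j f p : open U -> elementary U f -> U p ->
  partialR i (partialR j f) p = partialR j (partialR i f) p.
Proof.
move=> oU ef; elim: ef p => {f} [c|k|f g ef fC eg gC|f g ef fC eg gC
  |f ef fC f0|f ef fC|f ef fC] p Up.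
- have cE l : partialR l (fun=> c : R) = fun=> 0.
    by apply: funext => q; rewrite partialR_cst.
  by rewrite !cE !partialR_cst.
- have cE l : partialR l (fun q => q 0 k) = fun=> (l == k)%:R :> R.
    by apply: funext => q; rewrite partialR_coord.
  by rewrite !cE !partialR_cst.
all: have df q : U q -> differentiable f q := elementary_differentiable ef.
all: have ddf l q : U q -> differentiable (partialR l f) q
       := elementary_differentiable_partialR l oU ef.
1,2: have dg q : U q -> differentiable g q := elementary_differentiable eg.
1,2: have ddg l q : U q -> differentiable (partialR l g) q
       := elementary_differentiable_partialR l oU eg.
- have E l q : U q -> partialR l (fun q => f q + g q) q
      = partialR l f q + partialR l g q.
    by move=> Uq; apply: partialRD; auto.
  have E2 k l : partialR k (fun q => partialR l f q + partialR l g q) p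
      = partialR k (partialR l f) p + partialR k (partialR l g) p.
    exact: (partialRD k (ddf l p Up) (ddg l p Up)).
  rewrite (partialR_near i oU Up (E j)) (partialR_near j oU Up (E i)).
  by rewrite (E2 i j) (E2 j i) (fC p Up) (gC p Up).
- have E l q : U q -> partialR l (fun q => f q * g q) q
      = partialR l f q * g q + f q * partialR l g q.
    by move=> Uq; apply: partialRM; auto.
  have E2 k l : partialR k (fun q => partialR l f q * g q + f q * partialR l g q) p
      = partialR k (partialR l f) p * g p + partialR l f p * partialR k g p
        + (partialR k f p * partialR l g p + f p * partialR k (partialR l g) p).
    rewrite (partialRD _ (differentiableM (ddf _ _ Up) (dg _ Up))
                         (differentiableM (df _ Up) (ddg _ _ Up))).
    by rewrite (partialRM _ (ddf _ _ Up) (dg _ Up)) (partialRM _ (df _ Up) (ddg _ _ Up)).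
  rewrite (partialR_near i oU Up (E j)) (partialR_near j oU Up (E i)) (E2 i j) (E2 j i).
  by rewrite (fC p Up) (gC p Up) -!addrA [X in _ + X = _]addrCA.
- have E l q : U q -> partialR l (fun q => (f q)^-1) q
      = - (f q)^-1 * (f q)^-1 * partialR l f q.
    by move=> Uq; apply: partialRV; auto.
  have dV q : U q -> differentiable (fun q => (f q)^-1) q.
    by move=> Uq; apply: differentiableV; auto.
  have dVV := differentiableM (differentiableN (dV _ Up)) (dV _ Up).
  rewrite (partialR_near i oU Up (E j)) (partialR_near j oU Up (E i)).
  have E2 k : partialR k (fun q => - (f q)^-1 * (f q)^-1) p
      = 2 * (f p)^-1 ^+ 3 * partialR k f p.
    rewrite (partialRM k (differentiableN (dV _ Up)) (dV _ Up)).
    rewrite (partialRN k (dV _ Up)) E // !fctE; ring.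
  have E3 k l : partialR k (fun q => - (f q)^-1 * (f q)^-1 * partialR l f q) p
      = 2 * (f p)^-1 ^+ 3 * partialR k f p * partialR l f p
        - (f p)^-1 * (f p)^-1 * partialR k (partialR l f) p.
    by rewrite (partialRM k dVV (ddf l _ Up)) E2 !fctE; ring.
  by rewrite (E3 i j) (E3 j i) (fC p Up) [_ * partialR i f p * _]mulrAC.
- have E l q : U q -> partialR l (fun q => sin (f q)) q
      = cos (f q) * partialR l f q.
    by move=> Uq; apply: partialR_sin; auto.
  have dc := elementary_differentiable (elementary_cos ef) Up.
  have E2 k l : partialR k (fun q => cos (f q) * partialR l f q) p
      = - sin (f p) * partialR k f p * partialR l f p
        + cos (f p) * partialR k (partialR l f) p.
    by rewrite (partialRM k dc (ddf l _ Up)) (partialR_cos k (df _ Up)).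
  rewrite (partialR_near i oU Up (E j)) (partialR_near j oU Up (E i)) (E2 i j) (E2 j i).
  by rewrite (fC p Up) [_ * partialR i f p * _]mulrAC.
- have E l q : U q -> partialR l (fun q => cos (f q)) q
      = - sin (f q) * partialR l f q.
    by move=> Uq; apply: partialR_cos; auto.
  have ds := elementary_differentiable (elementary_sin ef) Up.
  have E2 k l : partialR k (fun q => - sin (f q) * partialR l f q) p
      = - cos (f p) * partialR k f p * partialR l f p
        - sin (f p) * partialR k (partialR l f) p.
    rewrite (partialRM k (differentiableN ds) (ddf l _ Up)) (partialRN k ds).
    by rewrite (partialR_sin k (df _ Up)) !fctE; ring.
  rewrite (partialR_near i oU Up (E j)) (partialR_near j oU Up (E i)) (E2 i j) (E2 j i).
  by rewrite (fC p Up) [_ * partialR i f p * _]mulrAC.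
Qed.

End ScalarCalculus.

(** * Calculus of complex-valued functions of real coordinates *)

Section ComplexCalculus.
Context {R : realType}.
Implicit Types (U : set (coords R)) (p : coords R) (f g : coords R -> R[i]).
Implicit Types (i j : 'I_5).

Definition cdifferentiable f p :=
  differentiable (fun q => complex.Re (f q)) p /\
  differentiable (fun q => complex.Im (f q)) p.

Lemma smooth_cdifferentiable U f p : smooth U f -> U p -> cdifferentiable f p.
Proof. by move=> [fR fI] Up; split; [exact: (fR [::])|exact: (fI [::])]. Qed.

Lemma partial_near U i f g p : open U -> U p ->
  (forall q, U q -> f q = g q) -> partial i f p = partial i g p.
Proof.
by move=> oU Up fg; congr (_ +i* _)%C; apply: (partialR_near i oU Up) => q /fg ->.
Qed.

Lemma cdifferentiable_cst (c : R[i]) p : cdifferentiable (fun=> c) p.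
Proof. by split; exact: differentiable_cst. Qed.

Lemma partial_cst i (c : R[i]) p : partial i (fun=> c) p = 0.
Proof. by rewrite /partial !partialR_cst. Qed.

Lemma ReD (x y : R[i]) : complex.Re (x + y) = complex.Re x + complex.Re y.
Proof. by case: x y => [a b] [c d]. Qed.
Lemma ImD (x y : R[i]) : complex.Im (x + y) = complex.Im x + complex.Im y.
Proof. by case: x y => [a b] [c d]. Qed.
Lemma ReN (x : R[i]) : complex.Re (- x) = - complex.Re x.
Proof. by case: x. Qed.
Lemma ImN (x : R[i]) : complex.Im (- x) = - complex.Im x.
Proof. by case: x. Qed.
Lemma ReM (x y : R[i]) : complex.Re (x * y)
  = complex.Re x * complex.Re y - complex.Im x * complex.Im y.
Proof. by case: x y => [a b] [c d]. Qed.
Lemma ImM (x y : R[i]) : complex.Im (x * y)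
  = complex.Re x * complex.Im y + complex.Im x * complex.Re y.
Proof. by case: x y => [a b] [c d]. Qed.

(** Equalities between functions, because [partialR] and [differentiable] take the whole function as
    argument. *)
Lemma ReD_fun f g : (fun q => complex.Re (f q + g q))
  = (fun q => complex.Re (f q)) + (fun q => complex.Re (g q)).
Proof. by apply: funext => q; rewrite ReD. Qed.
Lemma ImD_fun f g : (fun q => complex.Im (f q + g q))
  = (fun q => complex.Im (f q)) + (fun q => complex.Im (g q)).
Proof. by apply: funext => q; rewrite ImD. Qed.
Lemma ReN_fun f : (fun q => complex.Re (- f q)) = - (fun q => complex.Re (f q)).
Proof. by apply: funext => q; rewrite ReN. Qed.
Lemma ImN_fun f : (fun q => complex.Im (- f q)) = - (fun q => complex.Im (f q)).
Proof. by apply: funext => q; rewrite ImN. Qed.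
Lemma ReM_fun f g : (fun q => complex.Re (f q * g q))
  = (fun q => complex.Re (f q)) * (fun q => complex.Re (g q))
    - (fun q => complex.Im (f q)) * (fun q => complex.Im (g q)).
Proof. by apply: funext => q; rewrite ReM. Qed.
Lemma ImM_fun f g : (fun q => complex.Im (f q * g q))
  = (fun q => complex.Re (f q)) * (fun q => complex.Im (g q))
    + (fun q => complex.Im (f q)) * (fun q => complex.Re (g q)).
Proof. by apply: funext => q; rewrite ImM. Qed.

Lemma cdifferentiableD f g p : cdifferentiable f p -> cdifferentiable g p ->
  cdifferentiable (fun q => f q + g q) p.
Proof.
move=> [fR fI] [gR gI]; rewrite /cdifferentiable ReD_fun ImD_fun.
by split; apply: differentiableD.
Qed.

Lemma partialD i f g p : cdifferentiable f p -> cdifferentiable g p ->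
  partial i (fun q => f q + g q) p = partial i f p + partial i g p.
Proof.
move=> [fR fI] [gR gI]; rewrite {1}/partial ReD_fun ImD_fun.
by rewrite (partialRD i fR gR) (partialRD i fI gI).
Qed.

Lemma cdifferentiableN f p : cdifferentiable f p ->
  cdifferentiable (fun q => - f q) p.
Proof.
move=> [fR fI]; rewrite /cdifferentiable ReN_fun ImN_fun.
by split; apply: differentiableN.
Qed.

Lemma partialN i f p : cdifferentiable f p ->
  partial i (fun q => - f q) p = - partial i f p.
Proof.
move=> [fR fI]; rewrite {1}/partial ReN_fun ImN_fun.
by rewrite (partialRN i fR) (partialRN i fI).
Qed.

Lemma cdifferentiableM f g p : cdifferentiable f p -> cdifferentiable g p ->
  cdifferentiable (fun q => f q * g q) p.
Proof.
move=> [fR fI] [gR gI]; rewrite /cdifferentiable ReM_fun ImM_fun.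
split; first by apply: differentiableB; apply: differentiableM.
by apply: differentiableD; apply: differentiableM.
Qed.

Lemma partialM i f g p : cdifferentiable f p -> cdifferentiable g p ->
  partial i (fun q => f q * g q) p = partial i f p * g p + f p * partial i g p.
Proof.
move=> [fR fI] [gR gI]; rewrite {1}/partial ReM_fun ImM_fun.
rewrite (partialRD i (differentiableM fR gR)
                     (differentiableN (differentiableM fI gI))).
rewrite (partialRD i (differentiableM fR gI) (differentiableM fI gR)).
rewrite (partialRN i (differentiableM fI gI)).
rewrite (partialRM i fR gR) (partialRM i fI gI) (partialRM i fR gI).
rewrite (partialRM i fI gR) /partial.
move: (partialR _ _ _) (partialR _ _ _) (partialR _ _ _) (partialR _ _ _).
move=> a b c d; move: (f p) (g p) => [x y] [z w] /=.
by apply/eqP; rewrite eq_complex /=; apply/andP; split; apply/eqP; ring.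
Qed.

Lemma cdifferentiable_sum (I : Type) (r : seq I) (F : I -> coords R -> R[i]) p :
  (forall k, cdifferentiable (F k) p) ->
  cdifferentiable (fun q => \sum_(k <- r) F k q) p.
Proof.
move=> dF; elim: r => [|k r IH].
  rewrite (_ : (fun _ => _) = fun=> 0); first exact: cdifferentiable_cst.
  by apply: funext => q; rewrite big_nil.
rewrite (_ : (fun _ => _) = fun q => F k q + \sum_(l <- r) F l q).
  exact: cdifferentiableD.
by apply: funext => q; rewrite big_cons.
Qed.

Lemma partial_sum i (I : Type) (r : seq I) (F : I -> coords R -> R[i]) p :
  (forall k, cdifferentiable (F k) p) ->
  partial i (fun q => \sum_(k <- r) F k q) p = \sum_(k <- r) partial i (F k) p.
Proof.
move=> dF; elim: r => [|k r IH].
  rewrite big_nil (_ : (fun _ => _) = fun=> 0) ?partial_cst //.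
  by apply: funext => q; rewrite big_nil.
rewrite big_cons -IH -partialD //; last exact: cdifferentiable_sum.
by congr (partial i _ p); apply: funext => q; rewrite big_cons.
Qed.

Definition celementary U f :=
  elementary U (fun q => complex.Re (f q)) /\
  elementary U (fun q => complex.Im (f q)).

Lemma smooth_celementary U f : open U -> celementary U f -> smooth U f.
Proof. by move=> oU [fR fI]; split; apply: smoothR_elementary. Qed.

Lemma celementary_cdifferentiable U f p :
  celementary U f -> U p -> cdifferentiable f p.
Proof.
by move=> [fR fI] Up; split; [exact: elementary_differentiable fR Up
                             |exact: elementary_differentiable fI Up].
Qed.

Lemma celementary_partialC U i j f p : open U -> celementary U f -> U p ->
  partial i (partial j f) p = partial j (partial i f) p.
Proof.
move=> oU [fR fI] Up.
rewrite /partial /=; have R_C := elementary_partialRC i j oU fR Up.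
have I_C := elementary_partialRC i j oU fI Up.
exact (f_equal2 (@Complex R) R_C I_C).
Qed.

Lemma celementary_cdifferentiable_partial U i f p : open U ->
  celementary U f -> U p -> cdifferentiable (partial i f) p.
Proof.
move=> oU [fR fI] Up.
exact: (conj (elementary_differentiable_partialR i oU fR Up)
             (elementary_differentiable_partialR i oU fI Up)).
Qed.

Lemma celementary_cst U (c : R[i]) : celementary U (fun=> c).
Proof. by split; exact: elementary_cst. Qed.

Lemma celementary_real U (f : coords R -> R) :
  elementary U f -> celementary U (fun q => (f q)%:C%C).
Proof. by move=> ef; split => //=; exact: elementary_cst. Qed.

Lemma celementaryD U f g : celementary U f -> celementary U g ->
  celementary U (fun q => f q + g q).
Proof.
move=> [fR fI] [gR gI]; rewrite /celementary ReD_fun ImD_fun.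
by split; apply: elementaryD.
Qed.

Lemma celementaryN U f : celementary U f -> celementary U (fun q => - f q).
Proof.
move=> [fR fI]; rewrite /celementary ReN_fun ImN_fun.
by split; apply: elementaryN.
Qed.

Lemma celementaryM U f g : celementary U f -> celementary U g ->
  celementary U (fun q => f q * g q).
Proof.
move=> [fR fI] [gR gI]; rewrite /celementary ReM_fun ImM_fun; split.
  by apply: elementaryD; [|apply: elementaryN]; apply: elementaryM.
by apply: elementaryD; apply: elementaryM.
Qed.

Lemma celementary_sum U (I : Type) (r : seq I) (F : I -> coords R -> R[i]) :
  (forall k, celementary U (F k)) -> celementary U (fun q => \sum_(k <- r) F k q).
Proof.
move=> eF; elim: r => [|k r IH].
  rewrite (_ : (fun _ => _) = fun=> 0); first exact: celementary_cst.
  by apply: funext => q; rewrite big_nil.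
rewrite (_ : (fun _ => _) = fun q => F k q + \sum_(l <- r) F l q).
  exact: celementaryD.
by apply: funext => q; rewrite big_cons.
Qed.

End ComplexCalculus.

(** * Curvature in a moving frame *)

Section MatrixCalculus.
Context {R : realType}.
Implicit Types (U : set (coords R)) (p : coords R) (i j : 'I_5).

Definition dmx m n i (A : coords R -> 'M[R[i]]_(m, n)) : coords R -> 'M[R[i]]_(m, n) :=
  fun p => \matrix_(a, b) partial i (fun q => A q a b) p.

Definition mdifferentiable m n (A : coords R -> 'M[R[i]]_(m, n)) p :=
  forall a b, cdifferentiable (fun q => A q a b) p.

Lemma dmx_near m n U i (A B : coords R -> 'M[R[i]]_(m, n)) p : open U -> U p ->
  (forall q, U q -> A q = B q) -> dmx i A p = dmx i B p.
Proof.
by move=> oU Up AB; apply/matrixP => a b; rewrite !mxE;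
   apply: (partial_near i oU Up) => q /AB ->.
Qed.

Lemma dmx_cst m n i (A : 'M[R[i]]_(m, n)) p : dmx i (fun=> A) p = 0.
Proof. by apply/matrixP => a b; rewrite !mxE partial_cst. Qed.

Lemma dmxD m n i (A B : coords R -> 'M[R[i]]_(m, n)) p :
  mdifferentiable A p -> mdifferentiable B p ->
  dmx i (fun q => A q + B q) p = dmx i A p + dmx i B p.
Proof.
move=> dA dB; apply/matrixP => a b; rewrite !mxE -partialD //.
by congr (partial i _ p); apply: funext => q; rewrite mxE.
Qed.

Lemma mdifferentiableD m n (A B : coords R -> 'M[R[i]]_(m, n)) p :
  mdifferentiable A p -> mdifferentiable B p ->
  mdifferentiable (fun q => A q + B q) p.
Proof.
move=> dA dB a b; rewrite (_ : (fun _ => _) = fun q => A q a b + B q a b).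
  exact: cdifferentiableD.
by apply: funext => q; rewrite mxE.
Qed.

Lemma dmxM m n r i (A : coords R -> 'M[R[i]]_(m, n))
    (B : coords R -> 'M[R[i]]_(n, r)) p :
  mdifferentiable A p -> mdifferentiable B p ->
  dmx i (fun q => A q *m B q) p = dmx i A p *m B p + A p *m dmx i B p.
Proof.
move=> dA dB; apply/matrixP => a b; rewrite !mxE -big_split /=.
rewrite (_ : (fun _ => _) = fun q => \sum_j A q a j * B q j b); last first.
  by apply: funext => q; rewrite mxE.
rewrite partial_sum => [|k]; last exact: cdifferentiableM.
by apply: eq_bigr => k _; rewrite partialM // !mxE.
Qed.

Lemma mdifferentiableM m n r (A : coords R -> 'M[R[i]]_(m, n))
    (B : coords R -> 'M[R[i]]_(n, r)) p :
  mdifferentiable A p -> mdifferentiable B p ->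
  mdifferentiable (fun q => A q *m B q) p.
Proof.
move=> dA dB a b; rewrite (_ : (fun _ => _) = fun q => \sum_j A q a j * B q j b).
  by apply: cdifferentiable_sum => k; exact: cdifferentiableM.
by apply: funext => q; rewrite mxE.
Qed.

Lemma dmxZ m n i (f : coords R -> R[i]) (A : coords R -> 'M[R[i]]_(m, n)) p :
  cdifferentiable f p -> mdifferentiable A p ->
  dmx i (fun q => f q *: A q) p = partial i f p *: A p + f p *: dmx i A p.
Proof.
move=> df dA; apply/matrixP => a b; rewrite !mxE -partialM //.
by congr (partial i _ p); apply: funext => q; rewrite mxE.
Qed.

Lemma mdifferentiableZ m n (f : coords R -> R[i]) (A : coords R -> 'M[R[i]]_(m, n)) p :
  cdifferentiable f p -> mdifferentiable A p ->
  mdifferentiable (fun q => f q *: A q) p.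
Proof.
move=> df dA a b; rewrite (_ : (fun _ => _) = fun q => f q * A q a b).
  exact: cdifferentiableM.
by apply: funext => q; rewrite mxE.
Qed.

Lemma mdifferentiable_cst m n (A : 'M[R[i]]_(m, n)) p : mdifferentiable (fun=> A) p.
Proof. by move=> a b; exact: cdifferentiable_cst. Qed.

Lemma dmxT m n i (A : coords R -> 'M[R[i]]_(m, n)) p :
  dmx i (fun q => (A q)^T) p = (dmx i A p)^T.
Proof.
apply/matrixP => a b; rewrite !mxE.
by congr (partial i _ p); apply: funext => q; rewrite mxE.
Qed.

Lemma mdifferentiableT m n (A : coords R -> 'M[R[i]]_(m, n)) p :
  mdifferentiable A p -> mdifferentiable (fun q => (A q)^T) p.
Proof.
move=> dA a b; rewrite (_ : (fun _ => _) = fun q => A q b a) //.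
by apply: funext => q; rewrite mxE.
Qed.

Lemma dmx_sum m n i (I : Type) (r : seq I)
    (F : I -> coords R -> 'M[R[i]]_(m, n)) p :
  (forall k, mdifferentiable (F k) p) ->
  dmx i (fun q => \sum_(k <- r) F k q) p = \sum_(k <- r) dmx i (F k) p.
Proof.
move=> dF; apply/matrixP => a b; rewrite mxE summxE.
rewrite (_ : (fun _ => _) = fun q => \sum_(k <- r) F k q a b); last first.
  by apply: funext => q; rewrite summxE.
rewrite partial_sum => [|k]; last exact: dF.
by apply: eq_bigr => k _; rewrite mxE.
Qed.

Lemma mdifferentiable_sum m n (I : Type) (r : seq I)
    (F : I -> coords R -> 'M[R[i]]_(m, n)) p :
  (forall k, mdifferentiable (F k) p) ->
  mdifferentiable (fun q => \sum_(k <- r) F k q) p.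
Proof.
move=> dF a b; rewrite (_ : (fun _ => _) = fun q => \sum_(k <- r) F k q a b).
  by apply: cdifferentiable_sum => k; exact: dF.
by apply: funext => q; rewrite summxE.
Qed.

End MatrixCalculus.

(** * The Levi-Civita connection and its curvature under change of frame *)

Section LeviCivita.
Context {R : realType}.
Implicit Types (g : bilform R) (p : coords R) (i j k l : 'I_5).

(** Uniqueness of the Levi-Civita connection: the third hypothesis says that [Gam] has no torsion,
    the fourth that it preserves [g]. A candidate connection can thus be verified without ever
    computing [invmx (g p)]. *)
Lemma christoffel_unique g p (Gam : 'I_5 -> 'M[R[i]]_5) k i j :
  (g p)^T = g p -> g p \in unitmx ->
  (forall k' i' j', Gam i' k' j' = Gam j' k' i') ->
  (forall i', dmx i' g p = (Gam i')^T *m g p + g p *m Gam i') ->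
  christoffel g k i j p = Gam i k j.
Proof.
move=> gT gU GamC dg.
have SC a b c : (g p *m Gam a) c b = (g p *m Gam b) c a.
  by rewrite !mxE; apply: eq_bigr => m _; rewrite GamC.
have dgE a b c : partial a (fun q => g q b c) p
    = (g p *m Gam a) c b + (g p *m Gam a) b c.
  have := congr1 (fun M : 'M[R[i]]_5 => M b c) (dg a); rewrite mxE => ->.
  by rewrite mxE -{1}gT -trmx_mul mxE.
rewrite /christoffel.
(* Koszul formula: compatibility turns the three derivatives of [g] into six lowered symbols, and by
   the symmetry [SC] four of them cancel. *)
under eq_bigr => l _.
  rewrite !dgE (SC i l) (SC j l) (SC i j) (SC l i).
  rewrite (_ : _ - _ = 2 * (g p *m Gam j) l i); last by ring.
  rewrite mulrCA.
  over.
rewrite -mulr_sumr mulrA mulVf ?mul1r ?pnatr_eq0 //.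
have -> : \sum_l invmx (g p) k l * (g p *m Gam j) l i
    = (invmx (g p) *m (g p *m Gam j)) k i by rewrite mxE.
by rewrite mulmxA mulVmx // mul1mx GamC.
Qed.

Lemma riemann_connection g (V : set (coords R))
    (Gam : 'I_5 -> coords R -> 'M[R[i]]_5) p l k i j :
  open V -> V p ->
  (forall q, V q -> forall k' i' j', christoffel g k' i' j' q = Gam i' q k' j') ->
  riemann g l k i j p = (dmx i (Gam j) p - dmx j (Gam i) p
    + Gam i p *m Gam j p - Gam j p *m Gam i p) l k.
Proof.
move=> oV Vp gG; rewrite /riemann.
have E a b c : partial a (christoffel g l b c) p = dmx a (Gam b) p l c.
  by rewrite mxE; apply: (partial_near a oV Vp) => q Vq; exact: gG.
rewrite !E big_split /= sumrN.
set M := dmx i _ _; set N := dmx j _ _.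
rewrite !mxE -!addrA; congr (_ + (_ + (_ - _))).
  by apply: eq_bigr => m _; rewrite !gG.
by apply: eq_bigr => m _; rewrite !gG.
Qed.

(** Here [X], [Y] stand for the derivatives of [A] in directions i, j, [Z] for its second
    derivative, [W], [V] for the connection matrices in directions i, j, and [dV], [dW] for their
    derivatives in directions i, j. With [A *m B = 1] all terms containing derivatives of [A]
    cancel, so curvature transforms by conjugation. *)
Lemma gauge_algebra (F : fieldType) n (A B X Y Z V W dV dW : 'M[F]_n) :
  A *m B = 1%:M ->
  - (B *m X *m B) *m (Y + V *m A) + B *m (Z + (dV *m A + V *m X))
  - (- (B *m Y *m B) *m (X + W *m A) + B *m (Z + (dW *m A + W *m Y)))
  + (B *m (X + W *m A)) *m (B *m (Y + V *m A))
  - (B *m (Y + V *m A)) *m (B *m (X + W *m A))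
  = B *m (dV - dW + W *m V - V *m W) *m A.
Proof.
move=> AB; have ABK (M : 'M[F]_n) : A *m (B *m M) = M by rewrite mulmxA AB mul1mx.
rewrite !(mulmxDl, mulmxDr, mulNmx, mulmxN) -!mulmxA !ABK.
do !move: (B *m (_ *m _)) => ?.
by apply/matrixP => a b; rewrite !mxE; ring.
Qed.

(* The curvature of the connection with components [B (dA + W A)] in the
   coordinate frame, where [W] is its connection form in the coframe [A]. *)
Lemma curvature_gauge (V : set (coords R)) (A B : coords R -> 'M[R[i]]_5)
    (W : 'I_5 -> coords R -> 'M[R[i]]_5) p i j :
  open V -> V p ->
  (forall q, V q -> A q *m B q = 1%:M) ->
  (forall a b, celementary V (fun q => A q a b)) ->
  mdifferentiable B p -> (forall k, mdifferentiable (W k) p) ->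
  let Gam k q := B q *m (dmx k A q + W k q *m A q) in
  dmx i (Gam j) p - dmx j (Gam i) p + Gam i p *m Gam j p - Gam j p *m Gam i p
  = B p *m (dmx i (W j) p - dmx j (W i) p + W i p *m W j p - W j p *m W i p)
      *m A p.
Proof.
move=> oV Vp AB eA dB dW Gam.
have dA : mdifferentiable A p.
  by move=> a b; exact: celementary_cdifferentiable (eA a b) Vp.
have ddA k : mdifferentiable (dmx k A) p.
  move=> a b; rewrite (_ : (fun _ => _) = partial k (fun q => A q a b)).
    exact (celementary_cdifferentiable_partial k oV (eA a b) Vp).
  by apply: funext => q; rewrite mxE.
(* The one use of commuting second derivatives: the term [Z] of the gauge identity has to be the
   same for both orders. *)
have dAC k l : dmx k (dmx l A) p = dmx l (dmx k A) p.
  have E k' l' a b : dmx k' (dmx l' A) p a b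
      = partial k' (partial l' (fun q => A q a b)) p.
    by rewrite mxE; congr (partial k' _ p); apply: funext => q; rewrite mxE.
  apply/matrixP => a b.
  exact (etrans (E k l a b) (etrans (celementary_partialC k l oV (eA a b) Vp)
    (esym (E l k a b)))).
have dBE k : dmx k B p = - (B p *m dmx k A p *m B p).
  have := dmx_near k oV Vp AB; rewrite dmx_cst dmxM // => /eqP.
  rewrite addrC addr_eq0 => /eqP E.
  by rewrite -[LHS]mul1mx -(mulmx1C (AB p Vp)) -[LHS]mulmxA E mulmxN mulmxA.
have dGam k l : dmx k (Gam l) p = - (B p *m dmx k A p *m B p)
      *m (dmx l A p + W l p *m A p)
    + B p *m (dmx k (dmx l A) p
      + (dmx k (W l) p *m A p + W l p *m dmx k A p)).
  rewrite /Gam dmxM ?dBE //; last first.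
    by apply: mdifferentiableD => //; apply: mdifferentiableM.
  by rewrite dmxD ?dmxM //; apply: mdifferentiableM.
by rewrite !dGam (dAC j i); apply: gauge_algebra; exact: AB.
Qed.

End LeviCivita.

(** * Christoffel symbols and curvature from a connection table in a coframe *)

Section MovingFrame.
Context {R : realType}.
Variables (V : set (coords R)) (A B : coords R -> 'M[R[i]]_5).
Variables (w : 'I_5 -> coords R -> 'M[R[i]]_5).
Hypothesis openV : open V.
Hypothesis AB1 : forall q, V q -> A q *m B q = 1%:M.
Hypothesis eA : forall a b, celementary V (fun q => A q a b).
Hypothesis dB : forall q, V q -> mdifferentiable B q.
Hypothesis dw : forall a q, V q -> mdifferentiable (w a) q.
(* First structure equation of the torsion-free connection with form
   [w b a d] along the [b]-th frame vector. *)
Hypothesis dAE : forall q, V q -> forall i j a,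
  dmx i A q a j - dmx j A q a i
  = \sum_b \sum_d A q b i * A q d j * (w d q a b - w b q a d).

(** [A q a i] is the value of the [a]-th form of the coframe on the [i]-th coordinate field. So
    [W i] is the connection form evaluated on that field, and [Gam i] its gauge transform to the
    coordinate frame. *)
Let W i q := \sum_a A q a i *: w a q.
Let Gam i q := B q *m (dmx i A q + W i q *m A q).

Let dA q : V q -> mdifferentiable A q.
Proof. by move=> Vq a b; exact: celementary_cdifferentiable (eA a b) Vq. Qed.

Let WA_E i q a j : (W i q *m A q) a j
  = \sum_b \sum_d A q b i * A q d j * w b q a d.
Proof.
rewrite mxE; under eq_bigr => d _ do rewrite summxE mulr_suml.
rewrite exchange_big; apply: eq_bigr => b _; apply: eq_bigr => d _.
by rewrite mxE mulrAC.
Qed.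

(** The antisymmetric part of [dA + W A] is the torsion, which [dAE] makes vanish. *)
Let GamC q k i j : V q -> Gam i q k j = Gam j q k i.
Proof.
move=> Vq; rewrite /Gam [LHS]mxE [RHS]mxE; apply: eq_bigr => a _; congr (_ * _).
apply/eqP; rewrite -subr_eq0 ![(dmx _ _ _ + _) _ _]mxE !WA_E.
rewrite opprD addrACA dAE // [X in _ - X]exchange_big /=.
rewrite -!sumrN -!big_split /= big1 // => b _.
rewrite -!sumrN -!big_split /= big1 // => d _; ring.
Qed.

(** In the coframe the metric is [f] times a constant matrix [G], so compatibility only asks that
    [G w + w^T G] be [G] times the logarithmic derivative [mu] of [f]. With [f = 1] and [mu = 0]
    this covers the metric itself; a general [f] covers its conformal rescalings. *)
Lemma frame_christoffel (f : coords R -> R[i]) (mu : 'I_5 -> coords R -> R[i])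
    (G : 'M[R[i]]_5) q k i j :
  V q -> (forall q, V q -> cdifferentiable f q /\ f q != 0) ->
  G^T = G -> G \in unitmx ->
  (forall b, G *m w b q + (w b q)^T *m G = mu b q *: G) ->
  (forall i, partial i f q = f q * \sum_b A q b i * mu b q) ->
  christoffel (fun q => f q *: ((A q)^T *m G *m A q)) k i j q = Gam i q k j.
Proof.
move=> Vq fV GT GU Gw df; have [dfq f0] := fV q Vq.
have Aunit : A q \in unitmx.
  by have [] := mulmx1_unit (AB1 Vq).
apply: (@christoffel_unique _ _ q (fun i => Gam i q)).
- by rewrite linearZ /= !trmx_mul trmxK GT mulmxA.
- by rewrite unitmxZ ?unitfE // !unitmx_mul unitmx_tr Aunit GU.
- by move=> k' i' j'; exact: GamC.
move=> i'; rewrite dmxZ //; last first.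
  apply: mdifferentiableM (dA Vq); apply: mdifferentiableM.
    exact: mdifferentiableT (dA Vq).
  exact: mdifferentiable_cst.
rewrite (@dmxM _ _ _ _ i' (fun q => (A q)^T *m G) A); last 2 first.
- apply: mdifferentiableM; first exact: mdifferentiableT (dA Vq).
  exact: mdifferentiable_cst.
- exact: dA.
rewrite (@dmxM _ _ _ _ i' (fun q => (A q)^T) (fun=> G)); last 2 first.
- exact: mdifferentiableT (dA Vq).
- exact: mdifferentiable_cst.
rewrite dmx_cst mulmx0 addr0 dmxT.
have WG : G *m W i' q + (W i' q)^T *m G = (\sum_b A q b i' * mu b q) *: G.
  rewrite mulmx_sumr linear_sum /= mulmx_suml -big_split scaler_suml /=.
  apply: eq_bigr => b _.
  by rewrite [(_ *: _)^T]linearZ /= -scalemxAl -scalemxAr -scalerDr Gw scalerA.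
rewrite df -scalerA -scalerDr /Gam -scalemxAr -scalemxAl -scalerDr.
congr (_ *: _).
have -> : (B q *m (dmx i' A q + W i' q *m A q))^T *m ((A q)^T *m G *m A q)
    = ((dmx i' A q)^T + (A q)^T *m (W i' q)^T) *m G *m A q.
  rewrite trmx_mul [(_ + _)^T]linearD /= [(W i' q *m _)^T]trmx_mul.
  rewrite -[LHS]mulmxA -[(A q)^T *m G *m A q]mulmxA [(B q)^T *m _]mulmxA.
  by rewrite -[(B q)^T *m _]trmx_mul AB1 // trmx1 mul1mx !mulmxA.
rewrite -[X in _ = _ + X]mulmxA [A q *m (B q *m _)]mulmxA AB1 // mul1mx.
rewrite mulmxDr !mulmxDl.
rewrite -[(A q)^T *m G *m (W _ _ *m _)]mulmxA.
have -> : (\sum_b A q b i' * mu b q) *: ((A q)^T *m G *m A q)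
    = (A q)^T *m (G *m W i' q + (W i' q)^T *m G) *m A q.
  by rewrite WG -scalemxAr -scalemxAl.
rewrite mulmxDr mulmxDl !mulmxA.
do !move: (_ *m A q) => ?; do !move: (_ *m dmx _ _ _) => ?.
by apply/matrixP => a b; rewrite !mxE; ring.
Qed.

(** [dwE b a] is the derivative of [w a] along the [b]-th frame vector. The last sum is the term -
    w([e_b, e_d]) of the curvature, the bracket being expressed through the torsion-free
    connection. *)
Lemma frame_riemann (g : bilform R) (dwE : 'I_5 -> 'I_5 -> 'M[R[i]]_5) p l k i j :
  V p ->
  (forall q, V q -> forall k i j, christoffel g k i j q = Gam i q k j) ->
  (forall i a, dmx i (w a) p = \sum_b A p b i *: dwE b a) ->
  riemann g l k i j p = (B p *m (\sum_b \sum_d (A p b i * A p d j) *: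
    (dwE b d - dwE d b + w b p *m w d p - w d p *m w b p
     + \sum_a (w d p a b - w b p a d) *: w a p)) *m A p) l k.
Proof.
move=> Vp gG dwP.
have dAa k' a : cdifferentiable (fun q => A q a k') p := dA Vp a k'.
have dW k' : mdifferentiable (W k') p.
  by apply: mdifferentiable_sum => a; apply: mdifferentiableZ => //; exact: dw.
rewrite (riemann_connection l k i j openV Vp gG).
rewrite (curvature_gauge i j openV Vp AB1 eA (dB Vp) dW).
congr ((_ *m _ *m _) l k).
pose S i' j' (F : 'I_5 -> 'I_5 -> 'M[R[i]]_5) :=
  \sum_b \sum_d (A p b i' * A p d j') *: F b d.
have SC F : S j i F = S i j (fun b d => F d b).
  rewrite /S exchange_big; apply: eq_bigr => b _; apply: eq_bigr => d _.
  by rewrite mulrC.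
have SB F F' : S i j F - S i j F' = S i j (fun b d => F b d - F' b d).
  rewrite /S -sumrB; apply: eq_bigr => b _.
  by rewrite -sumrB; apply: eq_bigr => d _; rewrite scalerBr.
have SD F F' : S i j F + S i j F' = S i j (fun b d => F b d + F' b d).
  rewrite /S -big_split; apply: eq_bigr => b _.
  by rewrite -big_split; apply: eq_bigr => d _; rewrite scalerDr.
have dWE i' j' : dmx i' (W j') p
    = \sum_a (dmx i' A p a j' *: w a p) + S i' j' dwE.
  rewrite /S exchange_big dmx_sum => [|a]; last first.
    by apply: mdifferentiableZ => //; exact: dw.
  rewrite -big_split /=; apply: eq_bigr => a _.
  rewrite dmxZ //; last exact: dw.
  rewrite dwP scaler_sumr; congr (_ *: _ + _); first by rewrite mxE.
  by apply: eq_bigr => b _; rewrite scalerA mulrC.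
have WW i' j' : W i' p *m W j' p = S i' j' (fun b d => w b p *m w d p).
  rewrite mulmx_suml; apply: eq_bigr => b _.
  rewrite mulmx_sumr; apply: eq_bigr => d _.
  by rewrite -scalemxAl -scalemxAr scalerA.
(* The derivatives that fall on the coframe occur only antisymmetrised, so the first structure
   equation removes them; this produces the bracket term. *)
have dAS : \sum_a dmx i A p a j *: w a p - \sum_a dmx j A p a i *: w a p
    = S i j (fun b d => \sum_a (w d p a b - w b p a d) *: w a p).
  rewrite -sumrB; under eq_bigr => a _ do rewrite -scalerBl dAE // scaler_suml.
  rewrite exchange_big; apply: eq_bigr => b _ /=.
  under eq_bigr => a _ do rewrite scaler_suml.
  rewrite exchange_big; apply: eq_bigr => d _ /=.
  by rewrite scaler_sumr; apply: eq_bigr => a _; rewrite scalerA.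
rewrite !dWE !WW opprD addrACA dAS !SC !SB !SD !SB.
congr (S i j _); apply: funext => b; apply: funext => d.
by rewrite -!addrA addrC !addrA.
Qed.

End MovingFrame.

(** * A criterion for the vanishing of the Weyl tensor *)

Section WeylTensor.
Context {R : realType}.
Implicit Types (g : bilform R) (p : coords R) (i j k l : 'I_5).

(* [P] is then the Schouten tensor of [g]. *)
Lemma weyl_eq0 g (P : 'M[R[i]]_5) p :
  (g p)^T = g p -> g p \in unitmx -> P^T = P ->
  (forall l k i j, \sum_m g p l m * riemann g m k i j p
     = g p l i * P k j - g p l j * P k i + g p k j * P l i - g p k i * P l j) ->
  forall l k i j, weyl g l k i j p = 0.
Proof.
move=> gT gU PT gR.
have gC k l : g p k l = g p l k by rewrite -{1}gT mxE.
have PC k l : P k l = P l k by rewrite -{1}PT mxE.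
set h := invmx (g p).
have hg k l : \sum_m h k m * g p m l = (k == l)%:R.
  by have := congr1 (fun M : 'M[R[i]]_5 => M k l) (mulVmx gU); rewrite !mxE.
have hgr k l : \sum_m h m k * g p m l = (k == l)%:R.
  have hT : h^T = h by rewrite /h trmx_inv gT.
  by rewrite -hg; apply: eq_bigr => m _; rewrite -{1}hT mxE.
pose tau := \sum_i \sum_l h i l * P l i.
(* Trace of the Kulkarni-Nomizu form in dimension n = 5: the coefficient 3 is n - 2, and the second
   trace below gives 2 (n - 1) = 8. With the denominators of [weyl] everything then cancels. *)
have ricE k j : ricci g k j p = 3 * P k j + tau * g p k j.
  rewrite /ricci.
  have E i : riemann g i k i j p = \sum_l h i l * (g p l i * P k j
      - g p l j * P k i + g p k j * P l i - g p k i * P l j).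
    under eq_bigr => l _ do rewrite -gR mulr_sumr.
    rewrite exchange_big /=.
    under eq_bigr => m _ do (under eq_bigr => l _ do rewrite mulrA; rewrite -mulr_suml hg).
    rewrite (bigD1 i) //= eqxx mul1r big1 ?addr0 // => m /negPf mi.
    by rewrite eq_sym mi mul0r.
  under eq_bigr => i _.
    rewrite E.
    rewrite (_ : \sum_l _ = \sum_l h i l * g p l i * P k j
      - \sum_l h i l * g p l j * P k i + \sum_l h i l * P l i * g p k j
      - \sum_l h i l * g p k i * P l j); last first.
      rewrite -!(sumrN, big_split) /=; apply: eq_bigr => l _; ring.
    rewrite -!mulr_suml !hg eqxx mul1r.
    over.
  rewrite !big_split /= !sumrN -/tau.
  have -> : \sum_i \sum_l h i l * g p k i * P l j = P k j.
    rewrite exchange_big /=.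
    under eq_bigr => l _ do
      (under eq_bigr => i _ do rewrite (gC k i); rewrite -mulr_suml hgr).
    rewrite (bigD1 k) //= eqxx mul1r big1 ?addr0 // => l /negPf lk.
    by rewrite lk mul0r.
  have -> : \sum_i (i == j)%:R * P k i = P k j.
    rewrite (bigD1 j) //= eqxx mul1r big1 ?addr0 // => l /negPf lj.
    by rewrite lj mul0r.
  rewrite sumr_const card_ord -mulr_suml -/tau -mulr_natl; ring.
have scE : scalar_curv g p = 8 * tau.
  rewrite /scalar_curv -/h.
  rewrite (_ : \sum_k _ = 3 * tau + tau * \sum_k \sum_j h k j * g p j k).
    have -> : \sum_k \sum_j h k j * g p j k = 5.
      under eq_bigr => k _ do rewrite hg eqxx.
      by rewrite sumr_const card_ord.
    by ring.
  rewrite /tau !mulr_sumr -big_split; apply: eq_bigr => k _ /=.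
  rewrite !mulr_sumr -big_split; apply: eq_bigr => j _ /=.
  by rewrite ricE gC PC -/tau; ring.
move=> l k i j; rewrite /weyl gR !ricE scE; by field.
Qed.

(** The rank-one matrix encodes the tensor X_ab Y_cd, with a and c as its row and column. Its
    passage from frame to coordinate indices splits into that of the two factors. *)
Lemma sum_rank1 (A X Y : 'M[R[i]]_5) l k i j :
  \sum_b \sum_d A b i * A d j * (A^T *m (col b X *m (col d Y)^T) *m A) l k
  = (A^T *m X *m A) l i * (A^T *m Y *m A) k j.
Proof.
have E b d : (A^T *m (col b X *m (col d Y)^T) *m A) l k
    = (A^T *m X) l b * (A^T *m Y) k d.
  have colM (Z : 'M[R[i]]_5) c m : (A^T *m col c Z) m 0 = (A^T *m Z) m c.
    by rewrite !mxE; apply: eq_bigr => r _; rewrite !mxE.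
  have -> : A^T *m (col b X *m (col d Y)^T) *m A
      = (A^T *m col b X) *m (A^T *m col d Y)^T.
    by rewrite trmx_mul trmxK !mulmxA.
  by rewrite mxE big_ord1 [_^T _ _]mxE !colM.
rewrite [(A^T *m X *m A) l i]mxE [(A^T *m Y *m A) k j]mxE big_distrlr /=.
by apply: eq_bigr => b _; apply: eq_bigr => d _; rewrite E; ring.
Qed.

(** The hypothesis on [G *m Phi b d] is the Kulkarni-Nomizu form of the lowered curvature in frame
    indices, written with rank-one matrices. Being tensorial, it passes to coordinates, where
    [A^T *m P *m A] takes the role of the Schouten tensor. *)
Lemma frame_weyl (A B : 'M[R[i]]_5) (G P : 'M[R[i]]_5) (g : bilform R)
    (Phi : 'I_5 -> 'I_5 -> 'M[R[i]]_5) p :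
  A *m B = 1%:M -> G^T = G -> G \in unitmx -> P^T = P ->
  g p = A^T *m G *m A ->
  (forall b d, G *m Phi b d
    = col b G *m (col d P)^T - col d G *m (col b P)^T
      + col b P *m (col d G)^T - col d P *m (col b G)^T) ->
  (forall l k i j, riemann g l k i j p
    = (B *m (\sum_b \sum_d (A b i * A d j) *: Phi b d) *m A) l k) ->
  forall l k i j, weyl g l k i j p = 0.
Proof.
move=> AB GT GU PT gE GPhi gR.
have [AU _] := mulmx1_unit AB.
apply: (@weyl_eq0 _ (A^T *m P *m A)).
- by rewrite gE !trmx_mul trmxK GT mulmxA.
- by rewrite gE !unitmx_mul unitmx_tr AU GU.
- by rewrite !trmx_mul trmxK PT mulmxA.
move=> l k i j; rewrite gE; under eq_bigr => m _ do rewrite gR.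
transitivity ((A^T *m G *m A
    *m (B *m (\sum_b \sum_d (A b i * A d j) *: Phi b d) *m A)) l k).
  by rewrite [RHS]mxE.
rewrite -[B *m _ *m A]mulmxA !mulmxA -[_ *m A *m B]mulmxA AB mulmx1.
rewrite -[A^T *m G *m _]mulmxA.
rewrite [(A^T *m G *m A) k j * _]mulrC [(A^T *m G *m A) k i * _]mulrC -!sum_rank1.
rewrite [X in _ = _ - X + _ - _]exchange_big [X in _ = _ - X]exchange_big /=.
have sum4 (F1 F2 F3 F4 : 'I_5 -> R[i]) : \sum_b F1 b - \sum_b F2 b + \sum_b F3 b
    - \sum_b F4 b = \sum_b (F1 b - F2 b + F3 b - F4 b).
  by rewrite -sumrB -big_split -sumrB.
have mx4 (X Y Z T : 'M[R[i]]_5) : (A^T *m (X - Y + Z - T) *m A) l k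
    = (A^T *m X *m A) l k - (A^T *m Y *m A) l k
      + (A^T *m Z *m A) l k - (A^T *m T *m A) l k.
  rewrite !(mulmxDr, mulmxDl, mulmxN, mulNmx).
  move: (A^T *m X *m A) (A^T *m Y *m A) (A^T *m Z *m A) (A^T *m T *m A) => *.
  by rewrite !mxE.
rewrite [RHS]sum4 [G *m _]mulmx_sumr mulmx_sumr mulmx_suml summxE.
apply: eq_bigr => b _.
rewrite [RHS]sum4 [G *m _]mulmx_sumr mulmx_sumr mulmx_suml summxE.
apply: eq_bigr => d _.
rewrite -!scalemxAr -scalemxAl mxE GPhi mx4.
by rewrite [A d j * _]mulrC mulrBr mulrDr mulrBr.
Qed.

End WeylTensor.

(** * Connection coefficients in the Cartan coframe *)

Section FrameTables.
Context {F : numFieldType}.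
Implicit Types (a b d : 'I_5).

Definition i0 : 'I_5 := @Ordinal 5 0 isT.
Definition i1 : 'I_5 := @Ordinal 5 1 isT.
Definition i2 : 'I_5 := @Ordinal 5 2 isT.
Definition i3 : 'I_5 := @Ordinal 5 3 isT.
Definition i4 : 'I_5 := @Ordinal 5 4 isT.

Lemma sum5 (V : nmodType) (f : 'I_5 -> V) :
  \sum_a f a = f i0 + f i1 + f i2 + f i3 + f i4.
Proof.
rewrite !big_ord_recl big_ord0 addr0 !addrA.
by congr (f _ + f _ + f _ + f _ + f _); apply: val_inj.
Qed.

Lemma ord5P (P : 'I_5 -> Prop) :
  P i0 -> P i1 -> P i2 -> P i3 -> P i4 -> forall a, P a.
Proof.
move=> P0 P1 P2 P3 P4 [[|[|[|[|[|//]]]]] lt_a];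
  by [rewrite (_ : Ordinal _ = i0) //; apply: val_inj
     |rewrite (_ : Ordinal _ = i1) //; apply: val_inj
     |rewrite (_ : Ordinal _ = i2) //; apply: val_inj
     |rewrite (_ : Ordinal _ = i3) //; apply: val_inj
     |rewrite (_ : Ordinal _ = i4) //; apply: val_inj].
Qed.

Definition table (s : seq (seq F)) (a d : 'I_5) : F := nth 0 (nth [::] s a) d.

Definition vec (s : seq F) (a : 'I_5) : F := nth 0 s a.

(* The metric [2 t1 t5 - 2 t2 t4 + 4/3 t3 t3] of the Cartan coframe. *)
Definition Gtab := table
  [:: [:: 0; 0; 0; 0; 1];
      [:: 0; 0; 0; -1; 0];
      [:: 0; 0; 4/3; 0; 0];
      [:: 0; -1; 0; 0; 0];
      [:: 1; 0; 0; 0; 0]].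

(** Index raising: the inverse of [Gtab] applied to a covector. *)
Definition Gsharp (u : 'I_5 -> F) : 'I_5 -> F :=
  vec [:: u i4; - u i3; 3/4 * u i2; - u i1; u i0].

(* [wtab b a d] is the coefficient [w^a_d(e_b)] of the Levi-Civita connection of
   [Gtab] in the Cartan frame; missing rows are zero. *)
Definition wtab (b : 'I_5) : 'I_5 -> 'I_5 -> F := table (nth [::]
  [:: [:: [:: 0; 3/4; 0; 0; 0];
          [:: 3/4; 0; 0; 0; 0];
          [:: 0; 0; 0; 0; 0];
          [:: 0; 0; 0; 0; 3/4];
          [:: 0; 0; 0; 3/4; 0]];
      [::];
      [:: [:: 0; -3/2; 0; -1/3; 0];
          [:: -3/2; 0; 0; 0; -1/3];
          [:: 0; 0; 0; 0; 0];
          [:: -3/4; 0; 0; 0; -3/2];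
          [:: 0; -3/4; 0; -3/2; 0]];
      [:: [:: 0; 0; 2/3; 0; 0];
          [:: 0; 0; 0; 0; 0];
          [:: 3/4; 0; 0; 0; -1/2];
          [:: 0; 0; 0; 0; 0];
          [:: 0; 0; -1; 0; 0]];
      [:: [:: 0; -3/2; 0; 0; 0];
          [:: -3/2; 0; 2/3; 0; 0];
          [:: 0; -3/4; 0; 1/2; 0];
          [:: 0; 0; -1; 0; -3/2];
          [:: 0; 0; 0; -3/2; 0]]] b).

(* The Schouten tensor. *)
Definition Ptab := table
  [:: [:: 9/16; 0; 0; 0; 0];
      [:: 0; -9/16; 0; 0; 0];
      [:: 0; 0; -1/2; 0; 0];
      [:: 0; 0; 0; -1/4; 0];
      [:: 0; 0; 0; 0; 1/4]].

(** Written with [eqn] on the underlying naturals so that it evaluates under [cbv] in the table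
    checks. *)
Definition kdelta (a b : 'I_5) : F := if eqn a b then 1 else 0.

(* The torsion-free connection determines the structure functions
   [c^m_bd = w_d^m_b - w_b^m_d], so they are not a separate argument. *)
Definition frame_curv (w : 'I_5 -> 'I_5 -> 'I_5 -> F)
    (dw : 'I_5 -> 'I_5 -> 'I_5 -> 'I_5 -> F) b d a c :=
  dw b d a c - dw d b a c + \sum_m w b a m * w d m c - \sum_m w d a m * w b m c
  + \sum_m (w d m b - w b m d) * w m a c.

Lemma frame_curvN w dw b d a c :
  frame_curv w dw b d a c = - frame_curv w dw d b a c.
Proof.
rewrite /frame_curv [X in _ = - (_ + X)](_ : _ = - \sum_m (w d m b - w b m d) * w m a c).
  by ring.
by rewrite -sumrN; apply: eq_bigr => m _; ring.
Qed.

(** Cuts the 25 pairs of form indices to ten; each pair still leaves 25 matrix entries to check. *)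
Lemma antisym5P (P : 'I_5 -> 'I_5 -> F) :
  (forall b d, P b d = - P d b) ->
  P i0 i1 = 0 -> P i0 i2 = 0 -> P i0 i3 = 0 -> P i0 i4 = 0 -> P i1 i2 = 0 ->
  P i1 i3 = 0 -> P i1 i4 = 0 -> P i2 i3 = 0 -> P i2 i4 = 0 -> P i3 i4 = 0 ->
  forall b d, P b d = 0.
Proof.
move=> PN P01 P02 P03 P04 P12 P13 P14 P23 P24 P34.
have P0 b : P b b = 0.
  by apply/eqP; rewrite -eqNr -PN.
do 2!apply: ord5P => //; by rewrite PN ?P01 ?P02 ?P03 ?P04 ?P12 ?P13 ?P14 ?P23 ?P24 ?P34 oppr0.
Qed.

(** The Kulkarni-Nomizu form with its first index raised. The derivative table is zero because the
    connection coefficients are constant, so every entry is an identity between rational numbers. *)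
Lemma frame_curv_wtab b d a c : frame_curv wtab (fun _ _ _ _ => 0) b d a c
   = kdelta a b * Ptab c d - kdelta a d * Ptab c b
     + Gsharp (Ptab^~ b) a * Gtab c d - Gsharp (Ptab^~ d) a * Gtab c b.
Proof.
apply/eqP; rewrite -subr_eq0; apply/eqP.
move: b d; apply: antisym5P.
  by move=> b d; rewrite frame_curvN; ring.
all: move: a c; do 2!apply: ord5P; rewrite /frame_curv !sum5.
all: cbv beta iota delta [table wtab Gtab Gsharp vec Ptab nth nat_of_ord
  i0 i1 i2 i3 i4 kdelta eqn]; by field.
Qed.

Lemma Gsharp_sum (u : 'I_5 -> F) a : \sum_m Gtab a m * Gsharp u m = u a.
Proof.
rewrite sum5; move: a; apply: ord5P.
all: cbv beta iota delta [Gtab table Gsharp vec nth nat_of_ord i0 i1 i2 i3 i4].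
all: move: (u _) (u _) (u _) (u _) (u _) => *; by field.
Qed.

Lemma GtabC a b : Gtab a b = Gtab b a.
Proof. by move: a b; do 2!apply: ord5P. Qed.

Lemma kdeltaC a b : kdelta a b = kdelta b a.
Proof. by rewrite /kdelta; move: a b; do 2!apply: ord5P. Qed.

(* Change of the connection coefficients under [g -> f g], where [df = 2 f u]. *)
Definition wconf (u : 'I_5 -> F) b a d :=
  u b * kdelta a d + kdelta a b * u d - Gsharp u a * Gtab b d.

Lemma wconf_torsion u b a d : wconf u d a b = wconf u b a d.
Proof. by rewrite /wconf (GtabC d b) (kdeltaC a d) (kdeltaC a b); ring. Qed.

Lemma wtab_metric b a d :
  \sum_m Gtab a m * wtab b m d + \sum_m wtab b m a * Gtab m d = 0.
Proof.
rewrite !sum5; move: b a d; do 3!apply: ord5P.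
all: cbv beta iota delta [table wtab Gtab Gsharp vec Ptab nth nat_of_ord
  i0 i1 i2 i3 i4 kdelta eqn]; by field.
Qed.

Lemma wconf_metric u b a d :
  \sum_m Gtab a m * wconf u b m d + \sum_m wconf u b m a * Gtab m d
  = 2 * u b * Gtab a d.
Proof.
rewrite !sum5; move: b a d; do 3!apply: ord5P.
all: cbv beta iota delta [table wconf Gtab Gsharp vec Ptab nth nat_of_ord
  i0 i1 i2 i3 i4 kdelta eqn]; by field.
Qed.

(* With [s = sin theta e^(i phi)] and [ds / s = alpha e1 + beta e2], the metric
   [s^-2 g] is flat; [fdal], [fdbe] and [fdu] are the frame derivatives of
   [alpha], [beta] and [u = - ds / s]. *)
Section Flat.
Variables alpha beta : F.
Hypothesis alpha_beta : beta ^+ 2 = alpha ^+ 2 + 1.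

(** [fe1], [fe2], [fe3] are the components of sigma1, iota sigma2 and iota sigma3 in the Cartan
    coframe; the factors iota make them rational. *)
Definition fe1 := vec [:: 3/4; 0; 0; 0; 1/2].
Definition fe2 := vec [:: 0; 3/4; 0; 1/2; 0].
Definition fe3 := vec [:: -3/4; 0; 2; 0; 3/2].
Definition fdal b := (-1 - alpha ^+ 2) * fe1 b - alpha * beta * fe2 b - beta * fe3 b.
Definition fdbe b := - (alpha * beta) * fe1 b + (1 - beta ^+ 2) * fe2 b - alpha * fe3 b.
Definition fu b := - (alpha * fe1 b + beta * fe2 b).
Definition fdu b c := - (fdal b * fe1 c + fdbe b * fe2 c).
Definition wflat b a d := wtab b a d + wconf fu b a d.
Definition dwflat b c a d := wconf (fdu b) c a d.

(** Each entry is a polynomial in [alpha] and [beta] that vanishes modulo [alpha_beta]. That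
    relation is the nullness of (E1 s, E2 s, s), divided by s^2, since E1 s = alpha s and E2 s =
    iota beta s. *)
Lemma frame_curv_flat b d a c : frame_curv wflat dwflat b d a c = 0.
Proof.
move: b d; apply: antisym5P; first by move=> b d; exact: frame_curvN.
all: move: a c; do 2!apply: ord5P; rewrite /frame_curv !sum5.


all: cbv beta iota delta [wflat dwflat wconf fdu fu fdal fdbe fe1 fe2 fe3 Gsharp
  table wtab Gtab vec nth nat_of_ord i0 i1 i2 i3 i4 kdelta eqn]; by field: alpha_beta.
Qed.

End Flat.

End FrameTables.

(** * The Euler-angle coframe and the Cartan coframe *)

Section EulerFrame.
Context {R : realType}.
Variable lower : bool.
Implicit Types (U : set (coords R)) (p q : coords R) (i j k : 'I_5).

Definition iota : R[i] := pm lower * iC.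

Lemma iC2 : iC * iC = -1 :> R[i].
Proof. exact: sqr_i. Qed.

Lemma iota2 : iota ^+ 2 = -1.
Proof.
have pm2 : pm lower ^+ 2 = 1 :> R[i] by rewrite /pm -exprM mulnC exprM sqrrN !expr1n.
by rewrite /iota exprMn pm2 mul1r expr2 iC2.
Qed.

Lemma sinc2 k p : sinc k p ^+ 2 = 1 - cosc k p ^+ 2.
Proof. by rewrite /sinc /cosc -!rmorphXn sin2cos2 rmorphB rmorph1. Qed.

Lemma celementary_sinc U k : celementary U (sinc k).
Proof. by apply: celementary_real; apply: elementary_sin; apply: elementary_coord. Qed.

Lemma celementary_cosc U k : celementary U (cosc k).
Proof. by apply: celementary_real; apply: elementary_cos; apply: elementary_coord. Qed.

Lemma partial_real i (f : coords R -> R) p :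
  partial i (fun q => (f q)%:C%C) p = (partialR i f p)%:C%C.
Proof. by rewrite /partial /= partialR_cst. Qed.

Lemma partial_sinc i k p : partial i (sinc k) p = (i == k)%:R * cosc k p.
Proof.
rewrite /sinc partial_real partialR_sin; last exact: differentiable_coord_rV.
by rewrite partialR_coord rmorphM rmorph_nat mulrC.
Qed.

Lemma partial_cosc i k p : partial i (cosc k) p = - ((i == k)%:R * sinc k p).
Proof.
rewrite /cosc partial_real partialR_cos; last exact: differentiable_coord_rV.
by rewrite partialR_coord rmorphM rmorphN rmorph_nat mulNr mulrC.
Qed.

Lemma celementary_sin3x U : celementary U (fun p => (sin (3 * p 0 ix))%:C%C).
Proof.
apply: celementary_real; apply: elementary_sin; apply: elementaryM.
  exact: elementary_cst.
exact: elementary_coord.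
Qed.

Lemma celementary_cos3x U : celementary U (fun p => (cos (3 * p 0 ix))%:C%C).
Proof.
apply: celementary_real; apply: elementary_cos; apply: elementaryM.
  exact: elementary_cst.
exact: elementary_coord.
Qed.

Lemma celementary_e3x U : celementary U (e3x lower).
Proof.
apply: celementaryD; first exact: celementary_cos3x.
apply: celementaryN; apply: celementaryM; first exact: celementary_cst.
exact: celementary_sin3x.
Qed.

Definition e3xV p : R[i] :=
  (cos (3 * p 0 ix))%:C%C + iota * (sin (3 * p 0 ix))%:C%C.

Lemma celementary_e3xV U : celementary U e3xV.
Proof.
apply: celementaryD; first exact: celementary_cos3x.
apply: celementaryM; first exact: celementary_cst.
exact: celementary_sin3x.
Qed.

Lemma e3xVK p : e3x lower p * e3xV p = 1.
Proof.
rewrite /e3x /e3xV -/iota.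
have : (sin (3 * p 0 ix))%:C%C ^+ 2 = 1 - (cos (3 * p 0 ix))%:C%C ^+ 2 :> R[i].
  by rewrite -!rmorphXn sin2cos2 rmorphB rmorph1.
move: (cos _)%:C%C (sin _)%:C%C => c s cs; ring: cs iota2.
Qed.

Lemma partial_e3x i p :
  partial i (e3x lower) p = - (3 * iota * (i == ix)%:R * e3x lower p).
Proof.
have d3 : differentiable (fun q : coords R => 3 * q 0 ix : R) p.
  apply: (@differentiableM _ _ (fun=> 3) (fun q : coords R => q 0 ix)).
    exact: differentiable_cst.
  exact: differentiable_coord_rV.
have p3 : partialR i (fun q => 3 * q 0 ix) p = 3 * (i == ix)%:R.
  rewrite partialRM; [|exact: differentiable_cst|exact: differentiable_coord_rV].
  by rewrite partialR_cst partialR_coord mul0r add0r.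
have pc : partial i (fun q => (cos (3 * q 0 ix))%:C%C) p
    = - (sin (3 * p 0 ix))%:C%C * (3 * (i == ix)%:R).
  by rewrite partial_real partialR_cos // p3 !rmorphM rmorphN !rmorph_nat.
have ps : partial i (fun q => (sin (3 * q 0 ix))%:C%C) p
    = (cos (3 * p 0 ix))%:C%C * (3 * (i == ix)%:R).
  by rewrite partial_real partialR_sin // p3 !rmorphM !rmorph_nat.
have dc := celementary_cdifferentiable (celementary_cos3x setT) (I : setT p).
have ds := celementary_cdifferentiable (celementary_sin3x setT) (I : setT p).
have dk := cdifferentiable_cst iota p.
rewrite (partialD i dc (cdifferentiableN (cdifferentiableM dk ds))).
rewrite (partialN i (cdifferentiableM dk ds)) (partialM i dk ds) partial_cst pc ps.
rewrite /e3x -/iota; ring: iota2.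
Qed.

(** An intermediate coframe, chosen because the exterior derivatives of its members are
    constant-coefficient combinations of their wedge products, which fails for [dc iq] multiplied by
    other functions of x and for the coordinate expressions of the [sigma] forms. *)
Definition eta k : oneform R :=
  nth 0 [:: sigma1; sigma2; sigma3; dc ix; o5 lower] k.

Definition eta_mx q : 'M[R[i]]_5 := \matrix_(k, j) eta k q 0 j.

Lemma dcE i p j : (dc i : oneform R) p 0 j = (j == i)%:R.
Proof. by rewrite /dc mxE /=. Qed.

Lemma sigma1E p j : sigma1 p 0 j
  = sinc ipsi p * (j == itheta)%:R - cosc ipsi p * sinc itheta p * (j == iphi)%:R.
Proof. by rewrite /sigma1 /dc !mxE /=. Qed.
Lemma sigma2E p j : sigma2 p 0 j
  = cosc ipsi p * (j == itheta)%:R + sinc ipsi p * sinc itheta p * (j == iphi)%:R.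
Proof. by rewrite /sigma2 /dc !mxE /=. Qed.
Lemma sigma3E p j : sigma3 p 0 j
  = - (j == ipsi)%:R - cosc itheta p * (j == iphi)%:R.
Proof. by rewrite /sigma3 /dc !mxE /=. Qed.
Lemma o5E p j : o5 lower p 0 j = e3x lower p * (j == iq)%:R.
Proof. by rewrite /o5 /dc !mxE /=. Qed.

Lemma celementary_eta U k j : celementary U (fun q => eta k q 0 j).
Proof.
have sE := celementary_sinc U; have cE := celementary_cosc U.
have kE := @celementary_cst R U.
move: k; apply: ord5P; rewrite /eta /=.
- rewrite (funext (fun q => sigma1E q j)).
  apply: celementaryD; first exact: celementaryM.
  apply: celementaryN; apply: celementaryM => //; exact: celementaryM.
- rewrite (funext (fun q => sigma2E q j)).
  apply: celementaryD; first exact: celementaryM.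
  apply: celementaryM => //; exact: celementaryM.
- rewrite (funext (fun q => sigma3E q j)).
  apply: celementaryD => //; apply: celementaryN; exact: celementaryM.
- by rewrite (funext (fun q => dcE ix q j)).
- rewrite (funext (fun q => o5E q j)).
  by apply: celementaryM => //; exact: celementary_e3x.
Qed.

Let d_s k p : cdifferentiable (sinc k) p.
Proof. exact: celementary_cdifferentiable (celementary_sinc setT k) (I : setT p). Qed.
Let d_c k p : cdifferentiable (cosc k) p.
Proof. exact: celementary_cdifferentiable (celementary_cosc setT k) (I : setT p). Qed.
Let d_k (c : R[i]) p : cdifferentiable (fun=> c) p.
Proof. exact: cdifferentiable_cst. Qed.

Lemma partial_sigma1 i j p : partial i (fun q => sigma1 q 0 j) p
  = cosc ipsi p * (i == ipsi)%:R * (j == itheta)%:R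
    - (cosc ipsi p * cosc itheta p * (i == itheta)%:R
       - sinc ipsi p * sinc itheta p * (i == ipsi)%:R) * (j == iphi)%:R.
Proof.
rewrite (funext (fun q => sigma1E q j)).
have dm := cdifferentiableM (d_c ipsi p) (d_s itheta p).
rewrite (partialD i (cdifferentiableM (d_s ipsi p) (d_k _ p))
           (cdifferentiableN (cdifferentiableM dm (d_k _ p)))).
rewrite (partialN i (cdifferentiableM dm (d_k _ p))).
rewrite (partialM i dm (d_k _ p)) (partialM i (d_s ipsi p) (d_k _ p)).
rewrite (partialM i (d_c ipsi p) (d_s itheta p)).
by rewrite !partial_cst !partial_sinc !partial_cosc; ring.
Qed.

Lemma partial_sigma2 i j p : partial i (fun q => sigma2 q 0 j) p
  = - (sinc ipsi p * (i == ipsi)%:R * (j == itheta)%:R)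
    + (sinc ipsi p * cosc itheta p * (i == itheta)%:R
       + cosc ipsi p * sinc itheta p * (i == ipsi)%:R) * (j == iphi)%:R.
Proof.
rewrite (funext (fun q => sigma2E q j)).
have dm := cdifferentiableM (d_s ipsi p) (d_s itheta p).
rewrite (partialD i (cdifferentiableM (d_c ipsi p) (d_k _ p))
           (cdifferentiableM dm (d_k _ p))).
rewrite (partialM i dm (d_k _ p)) (partialM i (d_c ipsi p) (d_k _ p)).
rewrite (partialM i (d_s ipsi p) (d_s itheta p)).
by rewrite !partial_cst !partial_sinc !partial_cosc; ring.
Qed.

Lemma partial_sigma3 i j p : partial i (fun q => sigma3 q 0 j) p
  = sinc itheta p * (i == itheta)%:R * (j == iphi)%:R.
Proof.
rewrite (funext (fun q => sigma3E q j)).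
have dm := cdifferentiableM (d_c itheta p) (d_k (j == iphi)%:R p).
rewrite (partialD i (d_k _ p) (cdifferentiableN dm)) (partialN i dm).
rewrite (partialM i (d_c itheta p) (d_k _ p)).
by rewrite !partial_cst !partial_cosc; ring.
Qed.

Lemma partial_o5 i j p : partial i (fun q => o5 lower q 0 j) p
  = - (3 * iota * (i == ix)%:R * e3x lower p * (j == iq)%:R).
Proof.
rewrite (funext (fun q => o5E q j)).
have de := celementary_cdifferentiable (celementary_e3x setT) (I : setT p).
by rewrite (partialM i de (d_k _ p)) partial_cst partial_e3x; ring.
Qed.

Definition dH_tab (h h' : 'I_5 -> R[i]) : 'I_5 -> R[i] := vec
  [:: h i1 * h' i2 - h i2 * h' i1; h i2 * h' i0 - h i0 * h' i2;
      h i0 * h' i1 - h i1 * h' i0; 0; - (3 * iota * (h i3 * h' i4 - h i4 * h' i3))].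

(* Maurer-Cartan equations of [SU(2)], and [do5 = -3 iota dx /\ o5]. *)
Lemma d_eta_mx q i j k : dmx i eta_mx q k j - dmx j eta_mx q k i
  = dH_tab (eta_mx q ^~ i) (eta_mx q ^~ j) k.
Proof.
have E a b : dmx a eta_mx q k b = partial a (fun q => eta k q 0 b) q.
  by rewrite mxE; congr (partial a _ q); apply: funext => r; rewrite mxE.
have HE a b : eta_mx q a b = eta a q 0 b by rewrite mxE.
rewrite !E {E} /dH_tab !HE; move: k; apply: ord5P.
all: cbv beta iota delta [vec eta nth nat_of_ord i0 i1 i2 i3 i4].
- by rewrite !partial_sigma1 !sigma2E !sigma3E; ring.
- apply: etrans (f_equal2 (fun x y => x - y) (partial_sigma2 i j q)
    (partial_sigma2 j i q)) _.
  apply: etrans _ (esym (f_equal4 (fun x y z t => x * y - z * t)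
    (sigma3E q i) (sigma1E q j) (sigma1E q i) (sigma3E q j))).
  by ring.
- rewrite !partial_sigma3 !sigma1E !sigma2E.
  have := sinc2 ipsi q.
  by move: (sinc _ _) (cosc _ _) (sinc _ _) => s c t sc; ring: sc.
- have cE l : (fun q => (dc ix : oneform R) q 0 l) = fun=> (l == ix)%:R.
    by apply: funext => r; rewrite dcE.
  by rewrite !cE !partial_cst subrr.
- by rewrite !partial_o5 !dcE !o5E; ring.
Qed.

End EulerFrame.

(** * The dual frame, and the Cartan coframe as a constant change of basis *)

Section CartanFrame.
Context {R : realType}.
Variable lower : bool.
Implicit Types (U : set (coords R)) (p q : coords R) (i j k : 'I_5).

Let io : R[i] := iota lower.
Let io2 : io ^+ 2 = -1 := iota2 lower.

Definition euler_frame k : vfield R :=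
  nth (fun=> 0) [:: E1; E2; E3; ddc ix; fun q => e3xV lower q *: ddc iq q] k.

Definition euler_mx q : 'M[R[i]]_5 := \matrix_(j, k) euler_frame k q 0 j.

Lemma ddcE i p j : (ddc i : vfield R) p 0 j = (j == i)%:R.
Proof. by rewrite /ddc mxE /=. Qed.
Lemma E1E p j : E1 p 0 j = sinc ipsi p * (j == itheta)%:R
  + cosc ipsi p * (cosc itheta p / sinc itheta p * (j == ipsi)%:R
                   - (sinc itheta p)^-1 * (j == iphi)%:R).
Proof. by rewrite /E1 /ddc !mxE /=. Qed.
Lemma E2E p j : E2 p 0 j = cosc ipsi p * (j == itheta)%:R
  - sinc ipsi p * (cosc itheta p / sinc itheta p * (j == ipsi)%:R
                   - (sinc itheta p)^-1 * (j == iphi)%:R).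
Proof. by rewrite /E2 /ddc !mxE /=. Qed.
Lemma E3E p j : E3 p 0 j = - (j == ipsi)%:R :> R[i].
Proof. by rewrite /E3 /ddc !mxE /=. Qed.
Lemma edqE p j : (e3xV lower p *: ddc iq p) 0 j = e3xV lower p * (j == iq)%:R.
Proof. by rewrite /ddc !mxE /=. Qed.

Lemma sinc_neq0 k p : (sinc k p != 0) = (sin (p 0 k) != 0).
Proof. by rewrite /sinc (inj_eq (@complexI R) _ 0). Qed.

Lemma etaE k q j : eta lower k q 0 j = vec
  [:: sinc ipsi q * (j == itheta)%:R - cosc ipsi q * sinc itheta q * (j == iphi)%:R;
      cosc ipsi q * (j == itheta)%:R + sinc ipsi q * sinc itheta q * (j == iphi)%:R;
      - (j == ipsi)%:R - cosc itheta q * (j == iphi)%:R;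
      (j == ix)%:R;
      e3x lower q * (j == iq)%:R] k.
Proof.
move: k; apply: ord5P;
[exact: sigma1E|exact: sigma2E|exact: sigma3E|exact: dcE|exact: o5E].
Qed.

Lemma euler_frameE k q j : euler_frame k q 0 j = vec
  [:: sinc ipsi q * (j == itheta)%:R + cosc ipsi q
        * (cosc itheta q / sinc itheta q * (j == ipsi)%:R
           - (sinc itheta q)^-1 * (j == iphi)%:R);
      cosc ipsi q * (j == itheta)%:R - sinc ipsi q
        * (cosc itheta q / sinc itheta q * (j == ipsi)%:R
           - (sinc itheta q)^-1 * (j == iphi)%:R);
      - (j == ipsi)%:R;
      (j == ix)%:R;
      e3xV lower q * (j == iq)%:R] k.
Proof.
move: k; apply: ord5P;
[exact: E1E|exact: E2E|exact: E3E|exact: ddcE|exact: edqE].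
Qed.

Lemma eta_euler q : sin (q 0 itheta) != 0 -> eta_mx lower q *m euler_mx q = 1%:M.
Proof.
rewrite -sinc_neq0 => s0; apply/matrixP => k l; rewrite !mxE.
under eq_bigr => j _ do rewrite [eta_mx _ _ _ _]mxE [euler_mx _ _ _]mxE etaE euler_frameE.
rewrite sum5.
have := e3xVK lower q; have := sinc2 ipsi q; move: s0.
move: (sinc ipsi q) (cosc ipsi q) (sinc itheta q) (cosc itheta q).
move: (e3x lower q) (e3xV lower q) => ee ev sp cp st ct st0 s2 eev.
rewrite !eqE /=; move: k l; do 2!apply: ord5P.
all: cbv beta iota delta [vec nth nat_of_ord i0 i1 i2 i3 i4].
all: rewrite ?eqE /=.
all: by field: s2 eev.
Qed.

(* The Cartan coframe is [t1 = o1], [t2 = iota o2], [t3 = iota / 2 o3],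
   [t4 = iota / 2 (o2 - 4 o4)], [t5 = (o1 + 4 o5) / 2]. *)
Definition Tm : 'M[R[i]]_5 := \matrix_(a, k) table
  [:: [:: 1; 0; 0; 0; -1];
      [:: 0; io; 0; - io; 0];
      [:: 0; 0; io / 2; 0; -3 / 2];
      [:: 0; io / 2; 0; 3 / 2 * io; 0];
      [:: 1 / 2; 0; 0; 0; 3 / 2]] a k.

Definition Sm : 'M[R[i]]_5 := \matrix_(k, a) table
  [:: [:: 3 / 4; 0; 0; 0; 1 / 2];
      [:: 0; -3 / 4 * io; 0; - io / 2; 0];
      [:: 3 / 4 * io; 0; -2 * io; 0; -3 / 2 * io];
      [:: 0; io / 4; 0; - io / 2; 0];
      [:: -1 / 4; 0; 0; 0; 1 / 2]] k a.

Lemma TS : Tm *m Sm = 1%:M.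
Proof.
apply/matrixP => a b; rewrite !mxE; under eq_bigr => j _ do rewrite !mxE.
rewrite sum5; move: a b; do 2!apply: ord5P.
all: cbv beta iota delta [table nth nat_of_ord i0 i1 i2 i3 i4]; rewrite !eqE /=.
all: by field: io2.
Qed.

Definition coframe q := Tm *m eta_mx lower q.
Definition frame q := euler_mx q *m Sm.

Lemma coframe_frame q : sin (q 0 itheta) != 0 -> coframe q *m frame q = 1%:M.
Proof.
by move=> s0; rewrite /coframe /frame mulmxA -[Tm *m _ *m _]mulmxA eta_euler // mulmx1 TS.
Qed.

Lemma celementary_coframe U a j : celementary U (fun q => coframe q a j).
Proof.
rewrite (_ : (fun _ => _) = fun q => \sum_k Tm a k * eta lower k q 0 j).
  apply: celementary_sum => k; apply: celementaryM (celementary_eta lower U k j).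
  exact: celementary_cst.
by apply: funext => q; rewrite mxE; apply: eq_bigr => k _; rewrite [eta_mx _ _ _ _]mxE.
Qed.

Lemma mdiff_eta_mx q : mdifferentiable (eta_mx lower) q.
Proof.
move=> k j; rewrite (_ : (fun _ => _) = fun q => eta lower k q 0 j).
  exact: celementary_cdifferentiable (celementary_eta lower setT k j) (I : setT q).
by apply: funext => r; rewrite mxE.
Qed.

Lemma Tm_sum a (u : 'I_5 -> R[i]) : \sum_k Tm a k * u k = vec
  [:: u i0 - u i4; io * (u i1 - u i3); io / 2 * u i2 - 3 / 2 * u i4;
      io / 2 * (u i1 + 3 * u i3); 1 / 2 * (u i0 + 3 * u i4)] a.
Proof.
rewrite sum5 !mxE; move: (u i0) (u i1) (u i2) (u i3) (u i4) => u0 u1 u2 u3 u4.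
move: a; apply: ord5P.
all: cbv beta iota delta [table vec nth nat_of_ord i0 i1 i2 i3 i4]; by field.
Qed.

(** With [h] and [h'] the values of the intermediate coframe on two vectors, both sides are the
    exterior derivative of the [a]-th Cartan form on these vectors: on the left through the
    Maurer-Cartan equations, on the right through the torsion-free table [wtab]. The square of iota
    is the only property of iota that enters. *)
Lemma structure_tab (h h' : 'I_5 -> R[i]) a :
  \sum_k Tm a k * dH_tab lower h h' k
  = \sum_b \sum_d (\sum_k Tm b k * h k) * (\sum_k Tm d k * h' k)
      * (wtab d a b - wtab b a d).
Proof.
under [RHS]eq_bigr => b _ do
  (under eq_bigr => d _ do rewrite (Tm_sum b h) (Tm_sum d h'); rewrite sum5).
rewrite (Tm_sum a (dH_tab lower h h')).
rewrite sum5.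
rewrite /dH_tab -[iota lower]/io.
move: (h i0) (h i1) (h i2) (h i3) (h i4).
move: (h' i0) (h' i1) (h' i2) (h' i3) (h' i4) => v0 v1 v2 v3 v4 u0 u1 u2 u3 u4.
move: a; apply: ord5P.
all: cbv beta iota delta [wtab table vec nth nat_of_ord i0 i1 i2 i3 i4].
all: by field: io2.
Qed.

Lemma d_coframe q i j a : dmx i coframe q a j - dmx j coframe q a i
  = \sum_b \sum_d coframe q b i * coframe q d j * (wtab d a b - wtab b a d).
Proof.
have dTH l c : dmx l coframe q a c = \sum_k Tm a k * dmx l (eta_mx lower) q k c.
  rewrite (@dmxM _ _ _ _ l (fun=> Tm) (eta_mx lower)).
  - by rewrite dmx_cst mul0mx add0r [LHS]mxE.
  - exact: mdifferentiable_cst.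
  - exact: mdiff_eta_mx.
apply: etrans (f_equal2 (fun x y => x - y) (dTH i j) (dTH j i)) _.
rewrite -sumrB.
transitivity (\sum_k Tm a k * dH_tab lower (eta_mx lower q ^~ i) (eta_mx lower q ^~ j) k).
  apply: eq_bigr => k _; rewrite -mulrBr; exact (f_equal ( *%R (Tm a k)) (d_eta_mx lower q i j k)).
rewrite structure_tab; apply: eq_bigr => b _; apply: eq_bigr => d _.
by rewrite [coframe q b i]mxE [coframe q d j]mxE.
Qed.

End CartanFrame.

(** * Cartan's structure equations and the Cartan metric *)

Section CartanForms.
Context {R : realType}.
Variable U : set (coords R).
Variable t : 'I_5 -> oneform R.
Implicit Types (p q : coords R) (i j k : 'I_5).

Lemma wedgeE (a b : oneform R) q i j :
  wedge a b q i j = a q 0 i * b q 0 j - b q 0 i * a q 0 j.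
Proof. by rewrite /wedge !mxE !big_ord1 !mxE. Qed.

Lemma sprodE (a b : oneform R) q i j :
  sprod a b q i j = 2^-1 * (a q 0 i * b q 0 j + b q 0 i * a q 0 j).
Proof. by rewrite /sprod !mxE !big_ord1 !mxE. Qed.

Lemma addformE m (w w' : coords R -> 'M[R[i]]_(m, 5)) q (i : 'I_m) j :
  (w + w') q i j = w q i j + w' q i j.
Proof. exact: mxE. Qed.
Lemma oppformE m (w : coords R -> 'M[R[i]]_(m, 5)) q (i : 'I_m) j : (- w) q i j = - w q i j.
Proof. exact: mxE. Qed.
Lemma scaleformE m c (w : coords R -> 'M[R[i]]_(m, 5)) q (i : 'I_m) j :
  (c *: w) q i j = c * w q i j.
Proof. exact: mxE. Qed.
Definition comb (s : seq R[i]) : oneform R :=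
  fun q => \sum_a vec s a *: t a q.

(** The forms Omega are found by matching the right-hand sides of [wtab_structure] with Cartan's
    equations: Omega1 and Omega4 vanish, and Omega2 equals Omega3. The default value 0 of [vec]
    makes [comb [::]] the zero form. *)
Definition cartan_frame : cartan_data :=
  CartanData (t i0) (t i1) (t i2) (t i3) (t i4)
    (comb [::]) (comb [:: 3 / 4; 0; -3 / 2; 0; -3 / 2])
    (comb [:: 3 / 4; 0; -3 / 2; 0; -3 / 2]) (comb [::])
    (comb [:: 0; 0; 0; 3 / 4; 0]) (comb [:: 0; 0; 0; 0; -3 / 4])
    (comb [:: 0; 0; -3 / 4; 0; 0]).

Lemma combE s q j : comb s q 0 j = \sum_a vec s a * t a q 0 j.
Proof. by rewrite summxE; apply: eq_bigr => a _; rewrite mxE. Qed.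

Lemma cartan_metricE (c : @cartan_data R) q i j : cartan_metric c q i j
  = 2 * sprod (th1 c) (th5 c) q i j - 2 * sprod (th2 c) (th4 c) q i j
    + 4 / 3 * sprod (th3 c) (th3 c) q i j.
Proof.
apply: etrans (addformE _ _ _ _ _) _; rewrite scaleformE; congr (_ + _).
apply: etrans (addformE _ _ _ _ _) _; rewrite scaleformE; congr (_ + _).
by apply: etrans (oppformE _ _ _ _) _; rewrite scaleformE.
Qed.

Lemma frame_metricE q i j : cartan_metric cartan_frame q i j
  = \sum_a \sum_b Gtab a b * t a q 0 i * t b q 0 j.
Proof.
apply: etrans (cartan_metricE _ _ _ _) _.
apply: etrans (f_equal3 (fun x y z => 2 * x - 2 * y + 4 / 3 * z)
  (sprodE _ _ _ _ _) (sprodE _ _ _ _ _) (sprodE _ _ _ _ _)) _.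
rewrite /cartan_frame /=.
under [RHS]eq_bigr => a _ do rewrite sum5.
rewrite sum5.
cbv beta iota delta [Gtab table nth nat_of_ord i0 i1 i2 i3 i4]; by field.
Qed.

(** With [h b] and [h' b] the values of the [b]-th form on two vectors, [m b d] is the value of
    their wedge product, so the list shows the exterior derivatives of the five Cartan forms. It
    serves both the structure equations and the brackets of sections. *)
Lemma wtab_structure (h h' : 'I_5 -> R[i]) a :
  let m b d := h b * h' d - h d * h' b in
  \sum_b \sum_d h b * h' d * (wtab d a b - wtab b a d) = vec
  [:: - 3 / 4 * m i0 i1 - 3 / 2 * m i1 i2 - 3 / 2 * m i1 i4 + m i2 i3;
      - 3 / 2 * m i0 i2 - 3 / 2 * m i0 i4 + m i2 i4;
      3 / 4 * m i0 i3 - 3 / 4 * m i1 i4 + m i3 i4;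
      - 3 / 4 * m i0 i2 - 3 / 4 * m i0 i4 + 1 / 2 * m i2 i4;
      - 3 / 4 * m i0 i3 - 3 / 4 * m i1 i2 + 1 / 2 * m i2 i3 - 3 / 2 * m i3 i4] a.
Proof.
move=> m; under eq_bigr => b _ do rewrite sum5.
rewrite sum5 /m; move: (h i0) (h i1) (h i2) (h i3) (h i4).
move: (h' i0) (h' i1) (h' i2) (h' i3) (h' i4) => v0 v1 v2 v3 v4 u0 u1 u2 u3 u4.
move: a; apply: ord5P.
all: cbv beta iota delta [wtab table vec nth nat_of_ord i0 i1 i2 i3 i4].
all: by field.
Qed.

Lemma cartan_structure :
  (forall q a i j, ext_d (t a) q i j
    = \sum_b \sum_d t b q 0 i * t d q 0 j * (wtab d a b - wtab b a d)) ->
  structure_equations U cartan_frame.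
Proof.
move=> dt q _.
have cE s l : comb s q 0 l = vec s i0 * t i0 q 0 l + vec s i1 * t i1 q 0 l
    + vec s i2 * t i2 q 0 l + vec s i3 * t i3 q 0 l + vec s i4 * t i4 q 0 l.
  by rewrite combE sum5.
have dE a i j := etrans (dt q a i j)
  (wtab_structure (fun b => t b q 0 i) (fun b => t b q 0 j) a).
have w0 (a b : oneform R) i j (ai aj bi bj : R[i]) : a q 0 i = ai -> a q 0 j = aj ->
    b q 0 i = bi -> b q 0 j = bj -> wedge a b q i j = ai * bj - bi * aj.
  by move=> <- <- <- <-; exact: wedgeE.
have wc a s i j := w0 (t a) (comb s) i j _ _ _ _ erefl erefl (cE s i) (cE s j).
have O0 l : comb [::] q 0 l = 0 by rewrite combE sum5 /vec /= !mul0r !addr0.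
have D2 (w1 w2 : twoform R) i j : (w1 + w2) q i j = w1 q i j + w2 q i j := addformE _ _ _ _ _.
have D3 (w1 w2 w3 : twoform R) i j : (w1 + w2 + w3) q i j
    = w1 q i j + w2 q i j + w3 q i j.
  exact: etrans (D2 _ _ _ _) (f_equal (fun x => x + _) (D2 _ _ _ _)).
have D4 (w1 w2 w3 w4 : twoform R) i j : (w1 + w2 + w3 + w4) q i j
    = w1 q i j + w2 q i j + w3 q i j + w4 q i j.
  exact: etrans (D2 _ _ _ _) (f_equal (fun x => x + _) (D3 _ _ _ _ _)).
have Z1 l : (2 *: comb [::] + comb [::]) q 0 l = 0.
  by apply: etrans (addformE _ _ _ _ _) _; rewrite scaleformE !O0 mulr0 addr0.
have Z2 l : (comb [::] + 2 *: comb [::]) q 0 l = 0.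
  by apply: etrans (addformE _ _ _ _ _) _; rewrite scaleformE !O0 mulr0 addr0.
have Z3 l : (comb [::] + comb [::]) q 0 l = 0.
  by apply: etrans (addformE _ _ _ _ _) _; rewrite !O0 addr0.
have wz a (b : oneform R) i j (bz : forall l, b q 0 l = 0) : wedge (t a) b q i j = 0.
  by rewrite (w0 _ _ _ _ _ _ _ _ erefl erefl (bz i) (bz j)) mulr0 mul0r subr0.
have ws c a s i j := etrans (scaleformE c (wedge (t a) (comb s)) q i j)
  (f_equal ( *%R c) (wc a s i j)).
have wN c a s i j := etrans (oppformE (c *: wedge (t a) (comb s)) q i j)
  (f_equal -%R (ws c a s i j)).
split; apply/matrixP => i j.
- apply: etrans (dE i0 i j) (esym _).
  apply: etrans (etrans (D3 _ _ _ _ _) (f_equal3 (fun x y z => x + y + z)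
    (wz i0 _ i j Z1) (wc i1 _ i j) (wedgeE (t i2) (t i3) q i j))) _.
  by cbv beta iota delta [vec nth nat_of_ord i0 i1 i2 i3 i4]; field.
- apply: etrans (dE i1 i j) (esym _).
  apply: etrans (etrans (D3 _ _ _ _ _) (f_equal3 (fun x y z => x + y + z)
    (wc i0 _ i j) (wz i1 _ i j Z2) (wedgeE (t i2) (t i4) q i j))) _.
  by cbv beta iota delta [vec nth nat_of_ord i0 i1 i2 i3 i4]; field.
- apply: etrans (dE i2 i j) (esym _).
  apply: etrans (etrans (D4 _ _ _ _ _ _) (f_equal4 (fun x y z u => x + y + z + u)
    (wc i0 _ i j) (wc i1 _ i j) (wz i2 _ i j Z3) (wedgeE (t i3) (t i4) q i j))) _.
  by cbv beta iota delta [vec nth nat_of_ord i0 i1 i2 i3 i4]; field.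
- apply: etrans (dE i3 i j) (esym _).
  apply: etrans (etrans (D4 _ _ _ _ _ _) (f_equal4 (fun x y z u => x + y + z + u)
    (wc i0 _ i j) (ws _ i2 _ i j) (wz i3 _ i j O0) (wc i4 _ i j))) _.
  by cbv beta iota delta [vec nth nat_of_ord i0 i1 i2 i3 i4]; field.
- apply: etrans (dE i4 i j) (esym _).
  apply: etrans (etrans (D4 _ _ _ _ _ _) (f_equal4 (fun x y z u => x + y + z + u)
    (wc i1 _ i j) (wN _ i2 _ i j) (wc i3 _ i j) (wz i4 _ i j O0))) _.
  by cbv beta iota delta [vec nth nat_of_ord i0 i1 i2 i3 i4]; field.
Qed.

End CartanForms.

(** * Regularity of the dual frame and the constant Gram matrix *)

Section CartanMetric.
Context {R : realType}.
Variables (U : set (coords R)) (lower : bool).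
Hypothesis sinU : forall p, U p -> sin (p 0 itheta) != 0.
Implicit Types (p q : coords R) (i j k : 'I_5).

Let io : R[i] := iota lower.

Lemma celementary_sincV : celementary U (fun q => (sinc itheta q)^-1).
Proof.
rewrite (_ : (fun _ => _) = fun q => ((sin (q 0 itheta))^-1)%:C%C).
  apply: celementary_real; apply: elementaryV => [|q Uq]; last exact: sinU.
  by apply: elementary_sin; exact: elementary_coord.
by apply: funext => q; rewrite /sinc fmorphV.
Qed.

Lemma celementary_euler_frame k j :
  celementary U (fun q => euler_frame lower k q 0 j).
Proof.
rewrite (funext (fun q => euler_frameE lower k q j)).
have sE := celementary_sinc U; have cE := celementary_cosc U.
have vE := celementary_sincV; have kE := @celementary_cst R U.
have bE : celementary U (fun q => cosc itheta q / sinc itheta q * (j == ipsi)%:R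
    - (sinc itheta q)^-1 * (j == iphi)%:R).
  apply: celementaryD; first by apply: celementaryM => //; exact: celementaryM.
  by apply: celementaryN; exact: celementaryM.
move: k; apply: ord5P; rewrite /vec /=.
- by apply: celementaryD; exact: celementaryM.
- by apply: celementaryD; [|apply: celementaryN]; exact: celementaryM.
- exact: kE.
- exact: kE.
- by apply: celementaryM => //; exact: celementary_e3xV.
Qed.

Lemma celementary_frame j a : celementary U (fun q => frame lower q j a).
Proof.
rewrite (_ : (fun _ => _) = fun q => \sum_k euler_frame lower k q 0 j * Sm lower k a).
  apply: celementary_sum => k; apply: celementaryM (celementary_euler_frame k j) _.
  exact: celementary_cst.
by apply: funext => q; rewrite mxE; apply: eq_bigr => k _; rewrite [euler_mx _ _ _ _]mxE.
Qed.

Lemma mdiff_frame q : U q -> mdifferentiable (frame lower) q.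
Proof. by move=> Uq j a; exact: celementary_cdifferentiable (celementary_frame j a) Uq. Qed.

Definition Gm : 'M[R[i]]_5 := \matrix_(a, b) Gtab a b.
Definition Gmi : 'M[R[i]]_5 := \matrix_(a, b) Gsharp (fun c => kdelta c b) a.
Definition Pm : 'M[R[i]]_5 := \matrix_(a, b) Ptab a b.

Lemma GmT : Gm^T = Gm.
Proof. by apply/matrixP => a b; rewrite !mxE GtabC. Qed.

Lemma PmT : Pm^T = Pm.
Proof. by apply/matrixP => a b; rewrite !mxE; move: a b; do 2!apply: ord5P. Qed.

Lemma GmV : Gm *m Gmi = 1%:M.
Proof.
apply/matrixP => a b; rewrite !mxE -[RHS](_ : kdelta a b = _).
  by rewrite -[RHS](Gsharp_sum (fun c => kdelta c b)); apply: eq_bigr => m _; rewrite !mxE.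
by rewrite /kdelta; case: (a =P b) => [->|ab]; rewrite ?eqnE ?eqxx //; case: eqP => // /val_inj.
Qed.

Lemma Gm_unit : Gm \in unitmx.
Proof. by have [] := mulmx1_unit GmV. Qed.

Definition th a : oneform R := fun q => row a (coframe lower q).

Lemma thE a q j : th a q 0 j = coframe lower q a j.
Proof. by rewrite mxE. Qed.

Lemma ext_d_th a q i j : ext_d (th a) q i j
  = \sum_b \sum_d coframe lower q b i * coframe lower q d j * (wtab d a b - wtab b a d).
Proof.
apply: etrans (d_coframe lower q i j a); rewrite [LHS]mxE.
have E k l : partial k (fun r => th a r 0 l) q = dmx k (coframe lower) q a l.
  by rewrite [RHS]mxE; congr (partial k _ q); apply: funext => r; rewrite thE.
exact (f_equal2 (fun x y => x - y) (E i j) (E j i)).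
Qed.

End CartanMetric.

(** * The Cartan metric compared with the two given expressions of g *)

Section CartanCurvature.
Context {R : realType}.
Variable lower : bool.
Implicit Types (p q : coords R) (i j k : 'I_5).

Let io : R[i] := iota lower.
Let io2 : io ^+ 2 = -1 := iota2 lower.
Definition gram q : 'M[R[i]]_5 := (coframe lower q)^T *m Gm *m coframe lower q.

Lemma gramE q i j : gram q i j
  = \sum_a \sum_b Gtab a b * coframe lower q a i * coframe lower q b j.
Proof.
rewrite [LHS]mxE [RHS]exchange_big; apply: eq_bigr => b _.
rewrite [X in X * _]mxE mulr_suml; apply: eq_bigr => a _.
by rewrite [_^T _ _]mxE [Gm _ _]mxE; ring.
Qed.

Lemma cartan_gram : cartan_metric (cartan_frame (th lower)) = gram.
Proof.
apply: funext => q; apply/matrixP => i j.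
rewrite gramE frame_metricE; apply: eq_bigr => a _; apply: eq_bigr => b _.
by rewrite !thE.
Qed.

Lemma coframe_eta q a j : coframe lower q a j = vec
  [:: eta lower i0 q 0 j - eta lower i4 q 0 j;
      io * (eta lower i1 q 0 j - eta lower i3 q 0 j);
      io / 2 * eta lower i2 q 0 j - 3 / 2 * eta lower i4 q 0 j;
      io / 2 * (eta lower i1 q 0 j + 3 * eta lower i3 q 0 j);
      1 / 2 * (eta lower i0 q 0 j + 3 * eta lower i4 q 0 j)] a.
Proof.
rewrite -(Tm_sum lower a (fun k => eta lower k q 0 j)) [LHS]mxE.
by apply: eq_bigr => k _; rewrite [eta_mx _ _ _ _]mxE.
Qed.

(** A normal form in the intermediate coframe, to which both given expressions of the metric reduce
    by polynomial identities. *)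
Lemma gram_eta q i j : let h k := eta lower k q 0 i in let h' k := eta lower k q 0 j in
  gram q i j = h i0 * h' i0 + h i1 * h' i1 - 1 / 3 * (h i2 * h' i2)
    - 3 * (h i3 * h' i3) + (h i0 * h' i4 + h i4 * h' i0)
    + (h i1 * h' i3 + h i3 * h' i1) - io * (h i2 * h' i4 + h i4 * h' i2).
Proof.
move=> h h'; rewrite gramE.
transitivity (\sum_a \sum_b Gtab a b * vec
  [:: h i0 - h i4; io * (h i1 - h i3); io / 2 * h i2 - 3 / 2 * h i4;
      io / 2 * (h i1 + 3 * h i3); 1 / 2 * (h i0 + 3 * h i4)] a * vec
  [:: h' i0 - h' i4; io * (h' i1 - h' i3); io / 2 * h' i2 - 3 / 2 * h' i4;
      io / 2 * (h' i1 + 3 * h' i3); 1 / 2 * (h' i0 + 3 * h' i4)] b).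
  by apply: eq_bigr => a _; apply: eq_bigr => b _; rewrite (coframe_eta q a i) (coframe_eta q b j).
under eq_bigr => a _ do rewrite sum5.
rewrite sum5; move: (h i0) (h i1) (h i2) (h i3) (h i4).
move: (h' i0) (h' i1) (h' i2) (h' i3) (h' i4) => v0 v1 v2 v3 v4 u0 u1 u2 u3 u4.
cbv beta iota delta [Gtab table vec nth nat_of_ord i0 i1 i2 i3 i4].
by field: io2.
Qed.

Let ent (v w : cvec R) j : (v + w) 0 j = v 0 j + w 0 j. Proof. by rewrite mxE. Qed.
Let entN (v : cvec R) j : (- v) 0 j = - v 0 j. Proof. by rewrite mxE. Qed.
Let entZ c (v : cvec R) j : (c *: v) 0 j = c * v 0 j. Proof. by rewrite mxE. Qed.

Lemma o1_eta q j : o1 lower q 0 j = eta lower i0 q 0 j - eta lower i4 q 0 j.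
Proof. by rewrite /o1 ent entN. Qed.
Lemma o2_eta q j : o2 q 0 j = eta lower i1 q 0 j - eta lower i3 q 0 j.
Proof. by rewrite /o2 ent entN. Qed.
Lemma o3_eta q j : o3 lower q 0 j
  = eta lower i2 q 0 j + 3 * io * eta lower i4 q 0 j.
Proof.
rewrite /o3 ent entZ; congr (_ + _); apply: esym.
rewrite -[eta lower i4 q 0 j]/(o5 lower q 0 j) /o5 entZ /io /iota; ring.
Qed.
Lemma o4_eta q j : o4 q 0 j = - eta lower i3 q 0 j.
Proof. by rewrite /o4 entN. Qed.
Lemma ot1_eta q j : ot1 lower q 0 j = eta lower i0 q 0 j + eta lower i4 q 0 j.
Proof. by rewrite /ot1 ent. Qed.
Lemma ot2_eta q j : ot2 q 0 j = eta lower i1 q 0 j + eta lower i3 q 0 j.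
Proof. by rewrite /ot2 ent. Qed.

Let sqE (a : oneform R) q i j x y : a q 0 i = x -> a q 0 j = y ->
  sprod a a q i j = x * y.
Proof. by move=> <- <-; rewrite sprodE; field. Qed.
Let addE (w1 w2 : twoform R) q i j x y : w1 q i j = x -> w2 q i j = y ->
  (w1 + w2) q i j = x + y.
Proof. by move=> <- <-; exact: addformE. Qed.
Let oppE (w1 : twoform R) q i j x : w1 q i j = x -> (- w1) q i j = - x.
Proof. by move=> <-; exact: oppformE. Qed.
Let sclE c (w1 : twoform R) q i j x : w1 q i j = x -> (c *: w1) q i j = c * x.
Proof. by move=> <-; exact: scaleformE. Qed.

Let g_metric_id (u v : 'I_5 -> R[i]) :
  - (2 * (- u i3 * - v i3 + u i4 * v i4))
  + 2^-1 * ((u i0 + u i4) * (v i0 + v i4)) + 2^-1 * ((u i1 + u i3) * (v i1 + v i3))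
  - 6^-1 * ((u i2 + 3 * io * u i4) * (v i2 + 3 * io * v i4))
  = 2^-1 * (u i0 * v i0 + u i1 * v i1 - 1 / 3 * (u i2 * v i2)
    - 3 * (u i3 * v i3) + (u i0 * v i4 + u i4 * v i0)
    + (u i1 * v i3 + u i3 * v i1) - io * (u i2 * v i4 + u i4 * v i2)).
Proof.
move: (u i0) (u i1) (u i2) (u i3) (u i4) (v i0) (v i1) (v i2) (v i3) (v i4) => *.
by field: io2.
Qed.

Let g_metric_alt_id (u v : 'I_5 -> R[i]) :
  u i0 * v i0 + u i1 * v i1 - (- u i3 * - v i3) - u i4 * v i4
  - 2^-1 * ((u i0 - u i4) * (v i0 - v i4) + (u i1 - u i3) * (v i1 - v i3))
  - 6^-1 * ((u i2 + 3 * io * u i4) * (v i2 + 3 * io * v i4))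
  = 2^-1 * (u i0 * v i0 + u i1 * v i1 - 1 / 3 * (u i2 * v i2)
    - 3 * (u i3 * v i3) + (u i0 * v i4 + u i4 * v i0)
    + (u i1 * v i3 + u i3 * v i1) - io * (u i2 * v i4 + u i4 * v i2)).
Proof.
move: (u i0) (u i1) (u i2) (u i3) (u i4) (v i0) (v i1) (v i2) (v i3) (v i4) => *.
by field: io2.
Qed.

Lemma g_metric_gram q : g_metric lower q = 2^-1 *: gram q.
Proof.
apply/matrixP => i j; rewrite [RHS]mxE gram_eta /=.
have s4 := sqE (o4_eta q i) (o4_eta q j).
have s5 := @sqE (o5 lower) q i j _ _ erefl erefl.
have s1 := sqE (ot1_eta q i) (ot1_eta q j).
have s2 := sqE (ot2_eta q i) (ot2_eta q j).
have s3 := sqE (o3_eta q i) (o3_eta q j).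
apply: etrans (addE (addE (addE (oppE (sclE 2 (addE s4 s5))) (sclE _ s1)) (sclE _ s2))
  (oppE (sclE _ s3))) _.
exact: (g_metric_id (fun k => eta lower k q 0 i) (fun k => eta lower k q 0 j)).
Qed.

Lemma g_metric_alt_gram q : g_metric_alt lower q = 2^-1 *: gram q.
Proof.
apply/matrixP => i j; rewrite [RHS]mxE gram_eta /=.
have t1 := @sqE sigma1 q i j _ _ erefl erefl.
have t2 := @sqE sigma2 q i j _ _ erefl erefl.
have s4 := sqE (o4_eta q i) (o4_eta q j).
have s5 := @sqE (o5 lower) q i j _ _ erefl erefl.
have s1 := sqE (o1_eta q i) (o1_eta q j).
have s2 := sqE (o2_eta q i) (o2_eta q j).
have s3 := sqE (o3_eta q i) (o3_eta q j).
apply: etrans (addE (addE (addE (addE (addE t1 t2) (oppE s4)) (oppE s5))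
  (oppE (sclE _ (addE s1 s2)))) (oppE (sclE _ s3))) _.
exact: (g_metric_alt_id (fun k => eta lower k q 0 i) (fun k => eta lower k q 0 j)).
Qed.

End CartanCurvature.

(** * Vanishing of the Weyl tensor *)

Section FrameTableLemmas.
Context {F : numFieldType}.
Implicit Types (a b c d : 'I_5) (u v : 'I_5 -> F).

Lemma Gtab_kdelta a b : \sum_m Gtab a m * kdelta m b = Gtab a b :> F.
Proof.
rewrite sum5; move: a b; do 2!apply: ord5P.
all: cbv beta iota delta [Gtab table vec nth nat_of_ord i0 i1 i2 i3 i4 kdelta eqn].
all: by ring.
Qed.

Lemma Gsharp_lin (x y : F) u v a :
  Gsharp (fun c => - (x * u c + y * v c)) a = - (x * Gsharp u a + y * Gsharp v a).
Proof.
rewrite /Gsharp; move: (u i0) (u i1) (u i2) (u i3) (u i4).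
move: (v i0) (v i1) (v i2) (v i3) (v i4) => v0 v1 v2 v3 v4 u0 u1 u2 u3 u4.
move: a; apply: ord5P.
all: cbv beta iota delta [vec nth nat_of_ord i0 i1 i2 i3 i4].
all: by ring.
Qed.

Lemma wconf_lin (x y : F) u v b a d :
  wconf (fun c => - (x * u c + y * v c)) b a d
  = - (x * wconf u b a d + y * wconf v b a d).
Proof. by rewrite /wconf Gsharp_lin; ring. Qed.

(** The rescaled connection is affine in [alpha] and [beta] with constant coefficients, so its
    derivatives need only those of these two functions. *)
Lemma wflat_lin (x y : F) b a d : wflat x y b a d
  = wtab b a d - (x * wconf fe1 b a d + y * wconf fe2 b a d).
Proof. by rewrite -wconf_lin. Qed.

Lemma dwflat_lin (x y : F) b c a d : dwflat x y b c a d
  = - (fdal x y b * wconf fe1 c a d + fdbe x y b * wconf fe2 c a d).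
Proof. by rewrite -wconf_lin. Qed.

Lemma frame_curv_lowered b d a c :
  \sum_m Gtab a m * frame_curv wtab (fun _ _ _ _ => 0) b d m c
  = Gtab a b * Ptab c d - Gtab a d * Ptab c b
    + Ptab a b * Gtab c d - Ptab a d * Gtab c b :> F.
Proof.
under eq_bigr => m _ do rewrite frame_curv_wtab !(mulrDr, mulrN) !mulrA.
rewrite !big_split !sumrN -!mulr_suml /=.
by rewrite !Gtab_kdelta !Gsharp_sum.
Qed.

Lemma frame_curv_mx (w : 'I_5 -> 'I_5 -> 'I_5 -> F)
    (dw : 'I_5 -> 'I_5 -> 'I_5 -> 'I_5 -> F) b d :
  let M a := \matrix_(r, s) w a r s in
  \matrix_(r, s) dw b d r s - \matrix_(r, s) dw d b r s + M b *m M d - M d *m M b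
    + \sum_a (M d a b - M b a d) *: M a = \matrix_(r, s) frame_curv w dw b d r s.
Proof.
move=> M; apply/matrixP => r s; rewrite [RHS]mxE /frame_curv.
rewrite [LHS]mxE [X in X + _]mxE [X in X + _ + _]mxE [X in X + _ + _ + _]mxE.
rewrite summxE; congr (_ + _ + _ + _ + _).
- by rewrite mxE.
- by rewrite !mxE.
- by rewrite mxE; apply: eq_bigr => m _; rewrite !mxE.
- by rewrite mxE; congr (- _); rewrite mxE; apply: eq_bigr => m _; rewrite !mxE.
- by apply: eq_bigr => m _; rewrite !mxE.
Qed.

End FrameTableLemmas.

Section WeylVanishes.
Context {R : realType}.
Variables (U : set (coords R)) (lower : bool).
Hypothesis openU : open U.
Hypothesis sinU : forall p, U p -> sin (p 0 itheta) != 0.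
Implicit Types (p q : coords R) (i j k l : 'I_5).

Let AB1 q : U q -> coframe lower q *m frame lower q = 1%:M.
Proof. by move=> Uq; apply: coframe_frame; exact: sinU. Qed.

Let eA a b : celementary U (fun q => coframe lower q a b) := celementary_coframe lower U a b.

Let w0 a (_ : coords R) : 'M[R[i]]_5 := \matrix_(r, s) wtab a r s.

Let dA0 q (_ : U q) i j a : dmx i (coframe lower) q a j - dmx j (coframe lower) q a i
  = \sum_b \sum_d coframe lower q b i * coframe lower q d j * (w0 d q a b - w0 b q a d).
Proof.
apply: etrans (d_coframe lower q i j a) _.
by apply: eq_bigr => b _; apply: eq_bigr => d _; rewrite !mxE.
Qed.

Lemma weyl_gram : weyl_vanishes (gram lower) U.
Proof.
move=> l k i j p Up.
have dw0 a q : U q -> mdifferentiable (w0 a) q by move=> _; exact: mdifferentiable_cst.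
have gG q : U q -> forall k i j, christoffel (gram lower) k i j q
    = (frame lower q *m (dmx i (coframe lower) q + (\sum_a coframe lower q a i *: w0 a q) *m coframe lower q)) k j.
  move=> Uq k' i' j'.
  (* The trivial factor puts the metric in the form that [frame_christoffel] expects, with zero
     logarithmic derivative. *)
  have -> : gram lower = fun q => 1 *: ((coframe lower q)^T *m Gm *m coframe lower q).
    by apply: funext => r; rewrite scale1r.
  apply: (frame_christoffel (mu := fun _ _ => 0) AB1 eA dA0 k' i' j' Uq _ GmT Gm_unit) => //.
  - move=> b; rewrite scale0r; apply/matrixP => a d; rewrite !mxE.
    rewrite -[RHS](wtab_metric b a d); congr (_ + _).
      by apply: eq_bigr => m _; rewrite !mxE.
    by apply: eq_bigr => m _; rewrite !mxE.
  - move=> i''; rewrite partial_cst big1 ?mulr0 // => b _; exact: mulr0.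
apply: (frame_weyl (AB1 Up) (@GmT R) (@Gm_unit R) (@PmT R) erefl); last first.
  move=> l' k' i' j'; rewrite (frame_riemann openU AB1 eA (mdiff_frame lower sinU) dw0 dA0
    (dwE := fun _ _ => 0) _ _ _ _ Up gG) //.
  by move=> i'' a; rewrite dmx_cst big1 // => b _; rewrite scaler0.
move=> b d /=.
have -> : (0 - 0 + w0 b p *m w0 d p - w0 d p *m w0 b p
    + \sum_a (w0 d p a b - w0 b p a d) *: w0 a p)
    = \matrix_(r, s) frame_curv wtab (fun _ _ _ _ => 0) b d r s.
  have E00 : 0 - 0 = \matrix_(r, s) 0 - \matrix_(r, s) 0 :> 'M[R[i]]_5.
    by apply/matrixP => r s; rewrite !mxE.
  exact: etrans (f_equal (fun X => X + w0 b p *m w0 d p - w0 d p *m w0 b p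
      + \sum_a (w0 d p a b - w0 b p a d) *: w0 a p) E00)
    (frame_curv_mx wtab (fun _ _ _ _ => 0) b d).
have r1 (X Y : 'M[R[i]]_5) b' d' a c :
    (col b' X *m (col d' Y)^T) a c = X a b' * Y c d'.
  by rewrite mxE big_ord1 !mxE.
apply/matrixP => a c; rewrite [LHS]mxE.
transitivity (\sum_m Gtab a m * frame_curv wtab (fun _ _ _ _ => 0) b d m c : R[i]).
  by apply: eq_bigr => m _; rewrite [Gm _ _]mxE [(\matrix_(_, _) _) _ _]mxE.
apply: etrans (frame_curv_lowered b d a c) _; apply: esym.
have e4 (X Y Z T : 'M[R[i]]_5) :
    (X - Y + Z - T) a c = X a c - Y a c + Z a c - T a c by rewrite !mxE.
apply: etrans (e4 _ _ _ _) _.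
have GP b' d' : (col b' Gm *m (col d' Pm)^T) a c = Gtab a b' * Ptab c d' :> R[i].
  by rewrite r1 [X in X * _]mxE [X in _ * X]mxE.
have PG b' d' : (col b' Pm *m (col d' Gm)^T) a c = Ptab a b' * Gtab c d' :> R[i].
  by rewrite r1 [X in X * _]mxE [X in _ * X]mxE.
exact: (f_equal4 (fun x y z t => x - y + z - t) (GP b d) (GP d b) (PG b d) (PG d b)).
Qed.

End WeylVanishes.

(** * The flat conformal representative *)

Section Flat.
Context {R : realType}.
Variables (U : set (coords R)) (lower : bool).
Hypothesis openU : open U.
Hypothesis sinU : forall p, U p -> sin (p 0 itheta) != 0.
Implicit Types (p q : coords R) (i j k l : 'I_5).

Let io : R[i] := iota lower.
Let io2 : io ^+ 2 = -1 := iota2 lower.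
Let iC2' : (iC : R[i]) ^+ 2 = -1 := iC2.

Let s0 q : U q -> sinc itheta q != 0.
Proof. by move=> Uq; rewrite sinc_neq0; exact: sinU. Qed.

Definition alpha q : R[i] :=
  (sinc ipsi q * cosc itheta q - iC * cosc ipsi q) * (sinc itheta q)^-1.
Definition beta q : R[i] :=
  - (iota lower * (cosc ipsi q * cosc itheta q + iC * sinc ipsi q))
  * (sinc itheta q)^-1.

(* [alpha] and [iota beta] are the [E1]- and [E2]-derivatives of [ln s] for
   [s = sin theta e^(i phi)]. *)
Lemma alpha_beta q : U q -> beta q ^+ 2 = alpha q ^+ 2 + 1.
Proof.
move=> /s0; rewrite /beta /alpha -/io; move: (sinc2 ipsi q) (sinc2 itheta q).
move: (sinc ipsi q) (cosc ipsi q) (sinc itheta q) (cosc itheta q) => s c t d s2 t2 t0.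
by field: io2 iC2' s2 t2.
Qed.

Lemma partial_sincV i q : U q ->
  partial i (fun r => (sinc itheta r)^-1) q
  = - ((i == itheta)%:R * cosc itheta q * (sinc itheta q)^-1 ^+ 2).
Proof.
move=> Uq.
have ds : cdifferentiable (sinc itheta) q.
  exact: celementary_cdifferentiable (celementary_sinc U itheta) Uq.
have dv : cdifferentiable (fun r => (sinc itheta r)^-1) q.
  exact: celementary_cdifferentiable (celementary_sincV sinU) Uq.
(* The derivative of the inverse is extracted from that of the product with [sinc itheta], which is
   constant on the open set [U]. *)
have E : partial i (fun r => sinc itheta r * (sinc itheta r)^-1) q = 0.
  rewrite -(partial_cst i 1 q); apply: (partial_near i openU Uq) => r Ur.
  by rewrite mulfV // s0.
have := etrans (esym (partialM i ds dv)) E; rewrite partial_sinc => {}E.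
have := s0 Uq; move: E; move: (partial i _ q) => x E t0.
apply: (mulfI t0); apply/eqP; rewrite -subr_eq0; apply/eqP; rewrite -[RHS]E.
by field.
Qed.

Let d_s k q : cdifferentiable (sinc k) q.
Proof. exact: celementary_cdifferentiable (celementary_sinc setT k) (I : setT q). Qed.
Let d_c k q : cdifferentiable (cosc k) q.
Proof. exact: celementary_cdifferentiable (celementary_cosc setT k) (I : setT q). Qed.
Let d_k (c : R[i]) q : cdifferentiable (fun=> c) q.
Proof. exact: cdifferentiable_cst. Qed.
Let d_v q : U q -> cdifferentiable (fun r => (sinc itheta r)^-1) q.
Proof. by move=> Uq; exact: celementary_cdifferentiable (celementary_sincV sinU) Uq. Qed.

Lemma fe_sum q i (x y z : R[i]) :
  \sum_b coframe lower q b i * (x * fe1 b + y * fe2 b + z * fe3 b)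
  = x * sigma1 q 0 i + y * io * sigma2 q 0 i + z * io * sigma3 q 0 i.
Proof.
transitivity (\sum_b vec
  [:: eta lower i0 q 0 i - eta lower i4 q 0 i;
      io * (eta lower i1 q 0 i - eta lower i3 q 0 i);
      io / 2 * eta lower i2 q 0 i - 3 / 2 * eta lower i4 q 0 i;
      io / 2 * (eta lower i1 q 0 i + 3 * eta lower i3 q 0 i);
      1 / 2 * (eta lower i0 q 0 i + 3 * eta lower i4 q 0 i)] b
    * (x * fe1 b + y * fe2 b + z * fe3 b)).
  by apply: eq_bigr => b _; rewrite (coframe_eta lower q b i).
rewrite sum5.
have id (u : 'I_5 -> R[i]) : let v := vec [:: u i0 - u i4; io * (u i1 - u i3);
      io / 2 * u i2 - 3 / 2 * u i4; io / 2 * (u i1 + 3 * u i3);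
      1 / 2 * (u i0 + 3 * u i4)] in
    let g b := v b * (x * fe1 b + y * fe2 b + z * fe3 b) in
    g i0 + g i1 + g i2 + g i3 + g i4
    = x * u i0 + y * io * u i1 + z * io * u i2.
  move: (u i0) (u i1) (u i2) (u i3) (u i4) => u0 u1 u2 u3 u4.
  by cbv beta iota zeta delta [fe1 fe2 fe3 vec nth nat_of_ord i0 i1 i2 i3 i4]; field.
exact: (id (fun k => eta lower k q 0 i)).
Qed.

Let partial_div i (N : coords R -> R[i]) (dN : R[i]) q : U q ->
  cdifferentiable N q -> partial i N q = dN ->
  partial i (fun r => N r * (sinc itheta r)^-1) q
  = dN * (sinc itheta q)^-1
    - N q * ((i == itheta)%:R * cosc itheta q * (sinc itheta q)^-1 ^+ 2).
Proof.
by move=> Uq dfN <-; rewrite (partialM i dfN (d_v Uq)) (partial_sincV i Uq) mulrN.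
Qed.

(** Since alpha = (E1 s) / s, the relation d(E1 s) = - s sigma1 - (E2 s) sigma3 gives the terms in
    [fe3] and the constant -1 of [fdal]; subtracting alpha ds / s gives the quadratic terms. *)
Lemma partial_alpha i q : U q ->
  partial i alpha q = \sum_b coframe lower q b i * fdal (alpha q) (beta q) b.
Proof.
move=> Uq.
have -> : partial i alpha q = ((i == ipsi)%:R * (cosc ipsi q * cosc itheta q)
    - sinc ipsi q * ((i == itheta)%:R * sinc itheta q)
    + iC * ((i == ipsi)%:R * sinc ipsi q)) * (sinc itheta q)^-1
    - (sinc ipsi q * cosc itheta q - iC * cosc ipsi q)
      * ((i == itheta)%:R * cosc itheta q * (sinc itheta q)^-1 ^+ 2).
  have dm := cdifferentiableM (d_s ipsi q) (d_c itheta q).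
  have dn := cdifferentiableM (d_k iC q) (d_c ipsi q).
  apply: (partial_div Uq (cdifferentiableD dm (cdifferentiableN dn))).
  rewrite (partialD i dm (cdifferentiableN dn)) (partialN i dn).
  rewrite (partialM i (d_s ipsi q) (d_c itheta q)) (partialM i (d_k iC q) (d_c ipsi q)).
  by rewrite partial_cst partial_sinc !partial_cosc; ring.
transitivity (\sum_b coframe lower q b i
    * ((-1 - alpha q ^+ 2) * fe1 b + - (alpha q * beta q) * fe2 b + - beta q * fe3 b)).
  rewrite fe_sum sigma1E sigma2E sigma3E /alpha /beta -/io.
  have := s0 Uq; move: (sinc2 ipsi q) (sinc2 itheta q).
  move: (sinc ipsi q) (cosc ipsi q) (sinc itheta q) (cosc itheta q) => s c t d s2 t2 t0.
  by field: io2 iC2' s2 t2.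
by apply: eq_bigr => b _; rewrite /fdal; congr (_ * _); ring.
Qed.

(** As for [alpha], now with iota beta = (E2 s) / s and d(E2 s) = - s sigma2 + (E1 s) sigma3. *)
Lemma partial_beta i q : U q ->
  partial i beta q = \sum_b coframe lower q b i * fdbe (alpha q) (beta q) b.
Proof.
move=> Uq.
have -> : partial i beta q = - (io * (- ((i == ipsi)%:R * sinc ipsi q) * cosc itheta q
    - cosc ipsi q * ((i == itheta)%:R * sinc itheta q)
    + iC * ((i == ipsi)%:R * cosc ipsi q))) * (sinc itheta q)^-1
    - (- (io * (cosc ipsi q * cosc itheta q + iC * sinc ipsi q)))
      * ((i == itheta)%:R * cosc itheta q * (sinc itheta q)^-1 ^+ 2).
  have dm := cdifferentiableM (d_c ipsi q) (d_c itheta q).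
  have dn := cdifferentiableM (d_k iC q) (d_s ipsi q).
  have dmn := cdifferentiableD dm dn.
  have dio := cdifferentiableM (d_k io q) dmn.
  apply: (partial_div Uq (cdifferentiableN dio)).
  rewrite (partialN i dio) (partialM i (d_k io q) dmn) (partialD i dm dn).
  rewrite (partialM i (d_c ipsi q) (d_c itheta q)) (partialM i (d_k iC q) (d_s ipsi q)).
  by rewrite !partial_cst partial_sinc !partial_cosc; ring.
transitivity (\sum_b coframe lower q b i
    * (- (alpha q * beta q) * fe1 b + (1 - beta q ^+ 2) * fe2 b + - alpha q * fe3 b)).
  rewrite fe_sum sigma1E sigma2E sigma3E /alpha /beta -/io.
  have := s0 Uq; move: (sinc2 ipsi q) (sinc2 itheta q).
  move: (sinc ipsi q) (cosc ipsi q) (sinc itheta q) (cosc itheta q) => s c t d s2 t2 t0.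
  by field: io2 iC2' s2 t2.
by apply: eq_bigr => b _; rewrite /fdbe; congr (_ * _); ring.
Qed.

End Flat.

Section ConformallyFlat.
Context {R : realType}.
Variables (U : set (coords R)) (lower : bool).
Hypothesis openU : open U.
Hypothesis sinU : forall p, U p -> sin (p 0 itheta) != 0.
Implicit Types (p q : coords R) (i j k l : 'I_5).

Let io : R[i] := iota lower.
Let io2 : io ^+ 2 = -1 := iota2 lower.
Let iC2' : (iC : R[i]) ^+ 2 = -1 := iC2.

Let AB1 q : U q -> coframe lower q *m frame lower q = 1%:M.
Proof. by move=> Uq; apply: coframe_frame; exact: sinU. Qed.
Let eA a b : celementary U (fun q => coframe lower q a b) := celementary_coframe lower U a b.
Let s0 q : U q -> sinc itheta q != 0.
Proof. by move=> Uq; rewrite sinc_neq0; exact: sinU. Qed.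

(** This is s^-2, with e^(-i phi) written out. It involves [iC] and not iota, so one factor serves
    both signs. *)
Definition flat_factor q : R[i] :=
  (cosc iphi q - iC * sinc iphi q) * (sinc itheta q)^-1
  * ((cosc iphi q - iC * sinc iphi q) * (sinc itheta q)^-1).

Let eN : celementary U (fun q => cosc iphi q - iC * sinc iphi q).
Proof.
apply: celementaryD; first exact: celementary_cosc.
apply: celementaryN; apply: celementaryM; first exact: celementary_cst.
exact: celementary_sinc.
Qed.

Let eNV : celementary U (fun q => (cosc iphi q - iC * sinc iphi q) * (sinc itheta q)^-1).
Proof. by apply: celementaryM eN _; exact: celementary_sincV. Qed.

Lemma celementary_flat_factor : celementary U flat_factor.
Proof. exact: celementaryM. Qed.

Lemma flat_factor_neq0 q : U q -> flat_factor q != 0.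
Proof.
move=> Uq; have N0 : cosc iphi q - iC * sinc iphi q != 0.
  apply/eqP => N0.
  have : (cosc iphi q - iC * sinc iphi q) * (cosc iphi q + iC * sinc iphi q) = 1.
    have := sinc2 iphi q; move: (cosc iphi q) (sinc iphi q) => c s s2.
    by ring: iC2' s2.
  by rewrite N0 mul0r => /esym/eqP; rewrite oner_eq0.
have t0 := s0 Uq.
by rewrite /flat_factor mulf_neq0 // mulf_neq0 // invr_neq0.
Qed.

Lemma partial_flat_factor i q : U q -> partial i flat_factor q
  = flat_factor q * \sum_b coframe lower q b i * (2 * fu (alpha q) (beta lower q) b).
Proof.
move=> Uq.
have dN := celementary_cdifferentiable eN Uq.
have dV := celementary_cdifferentiable (celementary_sincV sinU) Uq.
have dc := celementary_cdifferentiable (celementary_cosc U iphi) Uq.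
have ds := celementary_cdifferentiable (celementary_sinc U iphi) Uq.
have dk := cdifferentiable_cst (iC : R[i]) q.
have dNV := celementary_cdifferentiable eNV Uq.
have NE : partial i (fun q => cosc iphi q - iC * sinc iphi q) q
    = - iC * (i == iphi)%:R * (cosc iphi q - iC * sinc iphi q).
  rewrite (partialD i dc (cdifferentiableN (cdifferentiableM dk ds))).
  rewrite (partialN i (cdifferentiableM dk ds)) (partialM i dk ds).
  by rewrite partial_cst partial_sinc partial_cosc; ring: iC2'.
have NVE := etrans (partialM i dN dV) (f_equal2 (fun x y => x * _ + _ * y) NE
  (partial_sincV openU sinU i Uq)).
have := etrans (partialM i dNV dNV) (f_equal (fun x => x * _ + _ * x) NVE) => {NVE}.
rewrite -[partial i _ q]/(partial i flat_factor q) => ->.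
transitivity (flat_factor q * \sum_b coframe lower q b i
    * (- (2 * alpha q) * fe1 b + - (2 * beta lower q) * fe2 b + 0 * fe3 b)).
  rewrite fe_sum sigma1E sigma2E /flat_factor /alpha /beta -/io.
  have := s0 Uq; move: (sinc2 ipsi q).
  move: (sinc iphi q) (cosc iphi q) (sinc ipsi q) (cosc ipsi q).
  move: (sinc itheta q) (cosc itheta q) => t d s' c' s c s2 t0.
  by field: io2 iC2' s2.
congr (_ * _); apply: eq_bigr => b _; congr (_ * _).
by rewrite mul0r addr0 /fu; ring.
Qed.

Let wf a q : 'M[R[i]]_5 := \matrix_(r, s) wflat (alpha q) (beta lower q) a r s.

(** The conformal correction [wconf] is symmetric in its lower indices, so [wf] has the same
    structure functions as [wtab]. *)
Let dAf q (_ : U q) i j a : dmx i (coframe lower) q a j - dmx j (coframe lower) q a i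
  = \sum_b \sum_d coframe lower q b i * coframe lower q d j * (wf d q a b - wf b q a d).
Proof.
apply: etrans (d_coframe lower q i j a) _.
apply: eq_bigr => b _; apply: eq_bigr => d _; congr (_ * _).
by rewrite !mxE /wflat (wconf_torsion _ b a d); ring.
Qed.

Let ealpha : celementary U alpha.
Proof.
apply: celementaryM; last exact: celementary_sincV.
have s := celementary_sinc U; have c := celementary_cosc U.
apply: celementaryD; first exact: celementaryM.
by apply: celementaryN; apply: celementaryM => //; exact: celementary_cst.
Qed.

Let ebeta : celementary U (beta lower).
Proof.
apply: celementaryM; last exact: celementary_sincV.
have s := celementary_sinc U; have c := celementary_cosc U.
have k := @celementary_cst R U.
by apply: celementaryN; apply: celementaryM => //; apply: celementaryD; exact: celementaryM.
Qed.

Let wfE a r s : (fun q => wf a q r s) = fun q => wtab a r s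
  - (alpha q * wconf fe1 a r s + beta lower q * wconf fe2 a r s).
Proof. by apply: funext => q; rewrite mxE wflat_lin. Qed.

Let dwf a q : U q -> mdifferentiable (wf a) q.
Proof.
move=> Uq r s; rewrite wfE.
have k := @cdifferentiable_cst R.
have dal := celementary_cdifferentiable ealpha Uq.
have dbe := celementary_cdifferentiable ebeta Uq.
by apply: cdifferentiableD => //; apply: cdifferentiableN; apply: cdifferentiableD;
   exact: cdifferentiableM.
Qed.

Let partial_affine (f g : coords R -> R[i]) (c0 c1 c2 : R[i]) i q :
  cdifferentiable f q -> cdifferentiable g q ->
  partial i (fun r => c0 - (f r * c1 + g r * c2)) q
  = - (partial i f q * c1 + partial i g q * c2).
Proof.
move=> df dg; have k c := @cdifferentiable_cst R c q.
have d1 := cdifferentiableM df (k c1); have d2 := cdifferentiableM dg (k c2).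
have d12 := cdifferentiableD d1 d2.
rewrite (partialD i (k c0) (cdifferentiableN d12)) (partialN i d12) (partialD i d1 d2).
by rewrite (partialM i df (k c1)) (partialM i dg (k c2)) !partial_cst; ring.
Qed.

Let dwfE q i a : U q -> dmx i (wf a) q
  = \sum_b coframe lower q b i *: \matrix_(r, s) dwflat (alpha q) (beta lower q) b a r s.
Proof.
move=> Uq; apply/matrixP => r s; rewrite summxE [LHS]mxE wfE.
apply: etrans (partial_affine _ _ _ _ (celementary_cdifferentiable ealpha Uq)
  (celementary_cdifferentiable ebeta Uq)) _.
apply: etrans (f_equal2 (fun x y => - (x * _ + y * _))
  (partial_alpha lower openU sinU i Uq) (partial_beta lower openU sinU i Uq)) _.
rewrite !mulr_suml -big_split -sumrN; apply: eq_bigr => b _ /=.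
apply: esym; rewrite [LHS]mxE; apply: etrans (f_equal ( *%R _) (mxE _ _ _ _)) _.
apply: etrans (f_equal ( *%R _) (dwflat_lin _ _ _ _ _ _)) _.
by rewrite mulrN mulrDr 2!mulrA.
Qed.

(** The method of [weyl_gram] with a non-constant connection: [wflat] as table, [dwflat] as its
    frame derivatives, and [2 * fu] as the logarithmic derivative of the factor, which the extra
    constant 1/2 does not affect. *)
Lemma g_metric_flat : is_flat (fun q => flat_factor q *: g_metric lower q) U.
Proof.
move=> l k i j p Up.
have gG q : U q -> forall k i j,
    christoffel (fun q => flat_factor q *: g_metric lower q) k i j q
    = (frame lower q *m (dmx i (coframe lower) q + (\sum_a coframe lower q a i *: wf a q) *m coframe lower q)) k j.
  move=> Uq k' i' j'.
  have -> : (fun q => flat_factor q *: g_metric lower q)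
      = fun q => (flat_factor q * 2^-1) *: ((coframe lower q)^T *m Gm *m coframe lower q).
    by apply: funext => r; rewrite g_metric_gram scalerA.
  have df := celementary_cdifferentiable celementary_flat_factor.
  have k2 := @cdifferentiable_cst R (2^-1).
  apply: (frame_christoffel (f := fun q => flat_factor q * 2^-1)
    (mu := fun b q => 2 * fu (alpha q) (beta lower q) b) AB1 eA dAf k' i' j' Uq _ GmT Gm_unit).
  - move=> r Ur; split; first by apply: cdifferentiableM; [exact: df|exact: k2].
    by rewrite mulf_neq0 ?flat_factor_neq0 // invr_neq0 // pnatr_eq0.
  - move=> b; apply/matrixP => a d; rewrite [LHS]mxE [RHS]mxE [X in _ = _ * X]mxE.
    (* The part [wtab] preserves the Gram matrix, and [wconf] rescales it by twice [fu]. *)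
    transitivity ((\sum_m Gtab a m * wtab b m d + \sum_m wtab b m a * Gtab m d)
        + (\sum_m Gtab a m * wconf (fu (alpha q) (beta lower q)) b m d
           + \sum_m wconf (fu (alpha q) (beta lower q)) b m a * Gtab m d)); last first.
      by rewrite wtab_metric add0r wconf_metric.
    rewrite addrACA; congr (_ + _); rewrite -big_split /=.
      rewrite [LHS]mxE; apply: eq_bigr => m _.
      by rewrite [Gm _ _]mxE [wf _ _ _ _]mxE /wflat mulrDr.
    rewrite [LHS]mxE; apply: eq_bigr => m _.
    by rewrite [_^T _ _]mxE [Gm _ _]mxE [wf _ _ _ _]mxE /wflat mulrDl.
  - move=> i''; rewrite (partialM i'' (df _ Uq) (k2 q)) partial_cst mulr0 addr0.
    by rewrite (partial_flat_factor i'' Uq) mulrAC.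
rewrite (frame_riemann openU AB1 eA (mdiff_frame lower sinU) dwf dAf
  (dwE := fun b a => \matrix_(r, s) dwflat (alpha p) (beta lower p) b a r s) _ _ _ _ Up gG);
  last by move=> i' a; exact: dwfE.
rewrite (_ : \sum_b _ = 0) ?mulmx0 ?mul0mx ?mxE //.
apply: big1 => b _; apply: big1 => d _.
apply: (etrans (f_equal ( *:%R _) (frame_curv_mx (wflat (alpha p) (beta lower p))
  (dwflat (alpha p) (beta lower p)) b d))).
rewrite (_ : \matrix_(_, _) _ = 0) ?scaler0 //.
by apply/matrixP => r s; rewrite !mxE; apply: frame_curv_flat; exact: alpha_beta Up.
Qed.

End ConformallyFlat.

(** * The distribution and its brackets *)

Section Pairing.
Context {R : realType}.
Implicit Types (a v : cvec R) (p q : coords R).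

Definition ev a v : R[i] := \sum_j a 0 j * v 0 j.

Lemma evD a v w : ev a (v + w) = ev a v + ev a w.
Proof. by rewrite -big_split; apply: eq_bigr => j _; rewrite mxE mulrDr. Qed.
Lemma evZ c a v : ev a (c *: v) = c * ev a v.
Proof. by rewrite mulr_sumr; apply: eq_bigr => j _; rewrite mxE mulrCA. Qed.
Lemma evZl c a v : ev (c *: a) v = c * ev a v.
Proof. by rewrite mulr_sumr; apply: eq_bigr => j _; rewrite mxE mulrA. Qed.
Lemma evDl a b v : ev (a + b) v = ev a v + ev b v.
Proof. by rewrite -big_split; apply: eq_bigr => j _; rewrite mxE mulrDl. Qed.
Lemma ev_sum a (I : Type) (r : seq I) (F : I -> cvec R) :
  ev a (\sum_(k <- r) F k) = \sum_(k <- r) ev a (F k).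
Proof.
rewrite exchange_big; apply: eq_bigr => j _.
by rewrite summxE mulr_sumr.
Qed.

Lemma mulmx_ev a v : a *m v^T = (ev a v)%:M.
Proof. by apply/rowP => j; rewrite !ord1 !mxE mulr1n; apply: eq_bigr => k _; rewrite mxE. Qed.

Lemma mulmx_ev0 a v : (a *m v^T == 0) = (ev a v == 0).
Proof.
rewrite mulmx_ev; apply/eqP/eqP => [/matrixP/(_ 0 0)|->]; first by rewrite !mxE mulr1n.
by apply/matrixP => i j; rewrite !mxE mul0rn.
Qed.

Lemma evC a v : ev a v = ev v a.
Proof. by apply: eq_bigr => j _; rewrite mulrC. Qed.

Lemma mem_ker_ev s v : (v \in ker_forms s) = all (fun a => ev a v == 0) s.
Proof.
by rewrite mem_ker_forms; apply: eq_all => a; rewrite mulmx_ev0 evC.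
Qed.

Lemma mem_annihilator_ev (W : {vspace cvec R}) a :
  a \in annihilator W <-> forall v, v \in W -> ev a v = 0.
Proof.
rewrite mem_annihilator; split=> aW v /aW; first by move/eqP; rewrite mulmx_ev0 => /eqP.
by move=> av; apply/eqP; rewrite mulmx_ev0 av.
Qed.

(** Subtracting from [v] its components along [f1], [f2], [f3] lands in the common kernel, where [a]
    vanishes; hence [a] is the combination of the [s] forms with coefficients [ev a f1], [ev a f2],
    [ev a f3]. *)
Lemma annihilator_ker3 (s1 s2 s3 f1 f2 f3 : cvec R) :
  ev s1 f1 = 1 -> ev s1 f2 = 0 -> ev s1 f3 = 0 ->
  ev s2 f1 = 0 -> ev s2 f2 = 1 -> ev s2 f3 = 0 ->
  ev s3 f1 = 0 -> ev s3 f2 = 0 -> ev s3 f3 = 1 ->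
  annihilator (ker_forms [:: s1; s2; s3]) = <<[:: s1; s2; s3]>>%VS.
Proof.
move=> s11 s12 s13 s21 s22 s23 s31 s32 s33.
apply/eqP; rewrite eqEsubv; apply/andP; split; last first.
  apply/span_subvP => a sa; apply/mem_annihilator_ev => v.
  by rewrite mem_ker_ev => /allP/(_ a sa)/eqP.
apply/subvP => a /mem_annihilator_ev ka.
have aE v : ev a v = ev s1 v * ev a f1 + ev s2 v * ev a f2 + ev s3 v * ev a f3.
  pose w := v + (- ev s1 v *: f1 + - ev s2 v *: f2 + - ev s3 v *: f3).
  have : ev a w = 0.
    apply: ka; rewrite mem_ker_ev /= !evD !evZ s11 s12 s13 s21 s22 s23 s31 s32 s33.
    rewrite !mulr0 !mulr1 !addr0 !add0r ?addr0.
    by rewrite !subrr eqxx.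
  rewrite !evD !evZ => /eqP; rewrite addr_eq0 => /eqP ->; ring.
have -> : a = ev a f1 *: s1 + (ev a f2 *: s2 + ev a f3 *: s3).
  apply/rowP => j.
  have dE b : ev b (delta_mx 0 j) = b 0 j.
    rewrite /ev (bigD1 j) //= mxE !eqxx mulr1 big1 ?addr0 // => k /negPf kj.
    by rewrite mxE eqxx kj mulr0.
  have := aE (delta_mx 0 j); rewrite !dE => ->; rewrite !mxE; ring.
by rewrite !memvD // memvZ // memv_span // !inE eqxx ?orbT.
Qed.

Lemma free_dual n (X : n.-tuple (cvec R)) (a : 'I_n -> cvec R) :
  (forall i j : 'I_n, ev (a i) X`_j = (i == j)%:R) -> free X.
Proof.
move=> aX; apply/freeP => k k0 i.
have : ev (a i) (\sum_(j < n) k j *: X`_j) = k i.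
  rewrite ev_sum (bigD1 i) //= evZ aX eqxx mulr1 big1 ?addr0 // => j /negPf ji.
  by rewrite evZ aX eq_sym ji mulr0.
by rewrite k0 => <-; rewrite /ev big1 // => j _; rewrite mxE mulr0.
Qed.

(** Cartan's formula for the exterior derivative of a 1-form, solved for the bracket. *)
Lemma ev_lie (t X Y : vfield R) p :
  mdifferentiable t p -> mdifferentiable X p -> mdifferentiable Y p ->
  ev (t p) (lie X Y p)
  = \sum_i (X p 0 i * partial i (fun q => ev (t q) (Y q)) p
            - Y p 0 i * partial i (fun q => ev (t q) (X q)) p)
    - \sum_i \sum_j ext_d t p i j * (X p 0 i * Y p 0 j).
Proof.
move=> dt dX dY.
have dev (Z : vfield R) i : mdifferentiable Z p ->
    partial i (fun q => ev (t q) (Z q)) p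
    = \sum_j (partial i (fun q => t q 0 j) p * Z p 0 j
              + t p 0 j * partial i (fun q => Z q 0 j) p).
  move=> dZ; rewrite partial_sum; last by move=> j; exact: cdifferentiableM.
  by apply: eq_bigr => j _; exact: (partialM i (dt 0 j) (dZ 0 j)).
have extE i j : ext_d t p i j = partial i (fun q => t q 0 j) p
   - partial j (fun q => t q 0 i) p by rewrite mxE.
have dev2 i : X p 0 i * partial i (fun q => ev (t q) (Y q)) p
            - Y p 0 i * partial i (fun q => ev (t q) (X q)) p
   = \sum_j (X p 0 i * (partial i (fun q => t q 0 j) p * Y p 0 j
              + t p 0 j * partial i (fun q => Y q 0 j) p)
       - Y p 0 i * (partial i (fun q => t q 0 j) p * X p 0 j
              + t p 0 j * partial i (fun q => X q 0 j) p)).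
  by rewrite (dev Y i dY) (dev X i dX) !mulr_sumr -sumrB.
under [X in _ = X - _]eq_bigr => i _ do rewrite dev2.
under [X in _ = _ - X]eq_bigr => i _ do under eq_bigr => j _ do rewrite extE mulrBl.
have -> : \sum_i \sum_j (partial i (fun q => t q 0 j) p * (X p 0 i * Y p 0 j)
     - partial j (fun q => t q 0 i) p * (X p 0 i * Y p 0 j))
  = \sum_i \sum_j (partial i (fun q => t q 0 j) p * (X p 0 i * Y p 0 j)
     - partial i (fun q => t q 0 j) p * (X p 0 j * Y p 0 i)).
  rewrite (eq_bigr _ (fun i _ => sumrB _ _ _ _)) sumrB.
  rewrite [RHS](eq_bigr _ (fun i _ => sumrB _ _ _ _)) sumrB; congr (_ - _).
  by rewrite exchange_big.
rewrite -sumrB; under [RHS]eq_bigr => i _ do rewrite -sumrB.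
rewrite exchange_big /=; apply: eq_bigr => k _.
rewrite [X in _ * X]mxE mulr_sumr; apply: eq_bigr => i _.
move: (partial _ _ _) (partial _ _ _) (partial _ _ _) => *.
ring.
Qed.

Lemma lieZ (h : coords R -> R[i]) (X Y : vfield R) p :
  cdifferentiable h p -> mdifferentiable Y p ->
  lie X (fun q => h q *: Y q) p
  = h p *: lie X Y p + (\sum_i X p 0 i * partial i h p) *: Y p.
Proof.
move=> dh dY; apply/rowP => k.
have lieE (Z : vfield R) : lie X Z p 0 k
    = \sum_i (X p 0 i * partial i (fun q => Z q 0 k) p
              - Z p 0 i * partial i (fun q => X q 0 k) p) by rewrite mxE.
have entE (c d : R[i]) (v w : cvec R) : (c *: v + d *: w) 0 k = c * v 0 k + d * w 0 k.
  by rewrite !mxE.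
have hYE r j : (h r *: Y r) 0 j = h r * Y r 0 j by rewrite mxE.
rewrite lieE entE lieE mulr_sumr mulr_suml -big_split; apply: eq_bigr => i _ /=.
rewrite (funext (fun q => hYE q k)) (partialM i dh (dY 0 k)) hYE.
move: (partial _ _ _) (partial _ _ _) (partial _ _ _) => *.
ring.
Qed.

End Pairing.

(** * The distribution in the dual frame, and the annihilators *)

Section Distribution.
Context {R : realType}.
Variables (U : set (coords R)) (lower : bool).
Hypothesis openU : open U.
Hypothesis sinU : forall p, U p -> sin (p 0 itheta) != 0.
Implicit Types (p q : coords R) (v w : cvec R) (s : seq 'I_5).

Let io : R[i] := iota lower.
Let io2 : io ^+ 2 = -1 := iota2 lower.

Definition ev_th q b v : R[i] := ev (th lower b q) v.
Definition frame_vf b : vfield R := fun q => (col b (frame lower q))^T.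

Lemma frame_vfE b q j : frame_vf b q 0 j = frame lower q j b.
Proof. by rewrite /frame_vf mxE mxE. Qed.

Lemma th_frame_vf q a b : U q -> ev_th q a (frame_vf b q) = (a == b)%:R.
Proof.
move=> Uq; have := congr1 (fun M : 'M[R[i]]_5 => M a b) (coframe_frame lower (sinU Uq)).
rewrite /= [X in X = _]mxE [X in _ = X]mxE => <-.
by apply: eq_bigr => j _; rewrite thE frame_vfE.
Qed.

Lemma frame_decomp q v : U q -> v = \sum_b ev_th q b v *: frame_vf b q.
Proof.
move=> Uq; apply/rowP => j.
have BA := mulmx1C (coframe_frame lower (sinU Uq)).
have := congr1 (fun M : 'cV[R[i]]_5 => M j 0) (mul1mx v^T).
rewrite -BA -mulmxA [v^T j 0]mxE => <-.
rewrite mxE summxE; apply: eq_bigr => b _.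
rewrite [RHS]mxE frame_vfE mulrC; congr (_ * _).
by rewrite mxE; apply: eq_bigr => k _; rewrite thE [v^T _ _]mxE.
Qed.

Definition frame_span s : distrib R := fun q => <<[seq frame_vf b q | b <- s]>>%VS.

Lemma mem_frame_span s q v : U q ->
  (v \in frame_span s q) <-> (forall b, b \notin s -> ev_th q b v = 0).
Proof.
move=> Uq; split=> [|sv].
  rewrite /frame_span; elim: s v => [|b s IH] v.
    by rewrite span_nil memv0 => /eqP -> b _; rewrite /ev_th /ev big1 // => j _; rewrite [X in _ * X]mxE mulr0.
  rewrite /= span_cons => /memv_addP[_ /vlineP[c ->] [w /IH ws ->]] d.
  rewrite inE negb_or => /andP[db ds].
  have -> : ev_th q d (c *: frame_vf b q + w) = c * ev_th q d (frame_vf b q) + ev_th q d w.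
    by rewrite /ev_th evD evZ.
  by rewrite th_frame_vf // (negPf db) (ws d ds) mulr0 addr0.
rewrite (frame_decomp v Uq); apply: memv_suml => b _.
have [bs|/sv ->] := boolP (b \in s); last by rewrite scale0r mem0v.
by apply/memvZ/memv_span/map_f.
Qed.

Lemma smooth_frame_vf b (V : set (coords R)) : open V -> V `<=` U -> smooth_rV V (frame_vf b).
Proof.
move=> oV VU j; rewrite (funext (fun q => frame_vfE b q j)).
apply: smooth_celementary => //.
by apply: celementary_frame => q /VU; exact: sinU.
Qed.

Lemma frame_vf_section s b (V : set (coords R)) : open V -> V `<=` U -> b \in s ->
  is_section V (frame_span s) (frame_vf b).
Proof.
move=> oV VU bs; split; first exact: smooth_frame_vf.
by move=> q Vq; apply/memv_span/map_f.
Qed.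

Lemma frame_span_distribution r s : uniq s -> size s = r ->
  is_distribution U r (frame_span s).
Proof.
move=> us sr p Up; exists U, (fun k : 'I_r => frame_vf (nth i0 s k)); split.
- by split.
- by move=> k; exact: smooth_frame_vf.
move=> q Uq.
have sE : [tuple frame_vf (nth i0 s k) q | k < r] = [seq frame_vf b q | b <- s] :> seq _.
  apply: (@eq_from_nth _ 0) => [|k]; first by rewrite size_tuple size_map.
  rewrite size_tuple => kr.
  rewrite -[k]/(val (Ordinal kr)) -tnth_nth tnth_mktuple (nth_map i0) //=.
  by rewrite sr.
apply/andP; split; first by rewrite sE.
apply: (@free_dual _ _ _ (fun k => th lower (nth i0 s k) q)) => i j.
rewrite -tnth_nth tnth_mktuple; apply: etrans (th_frame_vf _ _ Uq) _.
by rewrite nth_uniq ?sr.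
Qed.

Let eta_X q k l : U q -> ev (eta lower k q) (euler_frame lower l q) = (k == l)%:R.
Proof.
move=> Uq; have := congr1 (fun M : 'M[R[i]]_5 => M k l) (eta_euler lower (sinU Uq)).
rewrite /= [X in X = _]mxE [X in _ = X]mxE => <-.
by apply: eq_bigr => j _; rewrite [eta_mx _ _ _ _]mxE [euler_mx _ _ _ _]mxE.
Qed.

Lemma frame_vf_euler b q : frame_vf b q = \sum_k Sm lower k b *: euler_frame lower k q.
Proof.
apply/rowP => j; rewrite frame_vfE summxE mxE; apply: eq_bigr => k _.
by rewrite [RHS]mxE [euler_mx _ _ _ _]mxE mulrC.
Qed.

(** The coframe is adapted: its first three forms are multiples of o1, o2, o3, so the last two dual
    vectors span the distribution. They are in fact multiples of [X1] and [X2]. *)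
Lemma frame_vf3E q : frame_vf i3 q = (- (io / 2)) *: X1 q.
Proof.
rewrite frame_vf_euler sum5 !mxE.
cbv beta iota delta [table euler_frame nth nat_of_ord i0 i1 i2 i3 i4].
by rewrite !scale0r add0r !addr0 addrC -scalerDr mulNr.
Qed.

Lemma frame_vf4E q : frame_vf i4 q = (2^-1 * e3xV lower q) *: X2 lower q.
Proof.
have -> : X2 lower q = ddc iq q + e3x lower q *: E1 q - (3 * io * e3x lower q) *: E3 q.
  by rewrite /X2; congr (_ - _ *: _); rewrite /io /iota; ring.
rewrite frame_vf_euler sum5 !mxE.
cbv beta iota delta [table euler_frame nth nat_of_ord i0 i1 i2 i3 i4].
have := e3xVK lower q; rewrite -[iota lower]/io.
move: (ddc iq q) (E1 q) (E2 q) (E3 q) (ddc ix q) (e3x lower q) (e3xV lower q).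
move=> v0 v1 v2 v3 v4 x y xy; apply/rowP => j; rewrite !mxE.
by field: xy.
Qed.

Lemma Dist_frame q : Dist lower q = frame_span [:: i3; i4] q.
Proof.
have e := e3xVK lower q.
have x0 : e3xV lower q != 0.
  by apply/eqP => v0; move: e; rewrite v0 mulr0 => /esym/eqP; rewrite oner_eq0.
have io0 : io != 0.
  by apply/eqP => v0; move: io2; rewrite v0 expr0n /= => /esym/eqP; rewrite oppr_eq0 oner_eq0.
have h0 : 2^-1 != 0 :> R[i] by rewrite invr_neq0 // pnatr_eq0.
rewrite /Dist /frame_span /= frame_vf3E frame_vf4E !span_cons !span_nil !addv0.
have vl (c : R[i]) (v : cvec R) : c != 0 -> <[c *: v]>%VS = <[v]>%VS.
  move=> c0; apply/eqP; rewrite eqEsubv -!memvE memvZ ?memv_line //=.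
  by rewrite -[v in v \in _](scale1r v) -(mulVf c0) -scalerA memvZ // memv_line.
rewrite (vl (- (io / 2))); last by rewrite oppr_eq0 mulf_neq0.
by rewrite vl // mulf_neq0.
Qed.

Let th_o (a : 'I_5) (c : R[i]) (o : oneform R) q v :
  (forall j, coframe lower q a j = c * o q 0 j) -> ev_th q a v = c * ev (o q) v.
Proof. by move=> ao; rewrite -evZl; apply: eq_bigr => j _; rewrite thE ao mxE. Qed.

Lemma coframe0_o1 q j : coframe lower q i0 j = 1 * o1 lower q 0 j.
Proof.
exact: etrans (coframe_eta lower q i0 j) (etrans (esym (o1_eta lower q j)) (esym (mul1r _))).
Qed.
Lemma coframe1_o2 q j : coframe lower q i1 j = io * o2 q 0 j.
Proof. by rewrite coframe_eta (o2_eta lower). Qed.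
Lemma coframe2_o3 q j : coframe lower q i2 j = io / 2 * o3 lower q 0 j.
Proof.
rewrite coframe_eta o3_eta /vec /= -[iota lower]/io.
move: (eta lower _ q 0 j) (eta lower _ q 0 j) => x y.
by field: io2.
Qed.

Lemma Dist_ker q : U q -> Dist lower q = ker_forms [:: o1 lower q; o2 q; o3 lower q].
Proof.
move=> Uq; have io0 : io != 0.
  by apply/eqP => v0; move: io2; rewrite v0 expr0n /= => /esym/eqP; rewrite oppr_eq0 oner_eq0.
apply/vspaceP => v; apply/idP/idP; rewrite Dist_frame mem_ker_ev.
  move=> /(mem_frame_span _ _ Uq) h /=.
  have nz (c x : R[i]) : c != 0 -> c * x = 0 -> x == 0.
    by move=> /negPf c0 /eqP; rewrite mulf_eq0 c0.
  have io2n : io / 2 != 0 by rewrite mulf_neq0 // invr_neq0 // pnatr_eq0.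
  apply/and4P; split=> //.
  - by apply: (nz 1); rewrite ?oner_neq0 // -(th_o v (coframe0_o1 q)) h.
  - by apply: (nz io) => //; rewrite -(th_o v (coframe1_o2 q)) h.
  - by apply: (nz (io / 2)) => //; rewrite -(th_o v (coframe2_o3 q)) h.
move=> /and4P[/eqP h0 /eqP h1 /eqP h2 _]; apply/(mem_frame_span _ _ Uq).
apply: ord5P => //= _.
- by rewrite (th_o v (coframe0_o1 q)) h0 mulr0.
- by rewrite (th_o v (coframe1_o2 q)) h1 mulr0.
- by rewrite (th_o v (coframe2_o3 q)) h2 mulr0.
Qed.

Lemma annihilator_Dist q : U q ->
  annihilator (Dist lower q) = <<[:: o1 lower q; o2 q; o3 lower q]>>%VS /\
  annihilator (Dist_rev lower q) = <<[:: ot1 lower q; ot2 q; ot3 lower q]>>%VS.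
Proof.
move=> Uq; have eX k l : ev (eta lower k q) (euler_frame lower l q) = (k == l)%:R.
  exact: eta_X.
have cmb (c : R[i]) (u v : cvec R) j : (u + c *: v) 0 j = u 0 j + c * v 0 j.
  by rewrite !mxE.
have o1v : o1 lower q = eta lower i0 q + (-1) *: eta lower i4 q.
  apply/rowP => j.
  exact: etrans (o1_eta lower q j) (esym (etrans (cmb _ _ _ _) (f_equal ( +%R _) (mulN1r _)))).
have o2v : o2 q = eta lower i1 q + (-1) *: eta lower i3 q.
  apply/rowP => j.
  exact: etrans (o2_eta lower q j) (esym (etrans (cmb _ _ _ _) (f_equal ( +%R _) (mulN1r _)))).
have o3v : o3 lower q = eta lower i2 q + (3 * io) *: eta lower i4 q.
  by apply/rowP => j; exact: etrans (o3_eta lower q j) (esym (cmb _ _ _ _)).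
have ot1v : ot1 lower q = eta lower i0 q + 1 *: eta lower i4 q.
  apply/rowP => j.
  exact: etrans (ot1_eta lower q j) (esym (etrans (cmb _ _ _ _) (f_equal ( +%R _) (mul1r _)))).
have ot2v : ot2 q = eta lower i1 q + 1 *: eta lower i3 q.
  apply/rowP => j.
  exact: etrans (ot2_eta lower q j) (esym (etrans (cmb _ _ _ _) (f_equal ( +%R _) (mul1r _)))).
split.
  rewrite (Dist_ker Uq) o1v o2v o3v.
  apply: (annihilator_ker3 (f1 := euler_frame lower i0 q)
    (f2 := euler_frame lower i1 q) (f3 := euler_frame lower i2 q));
    by rewrite evDl evZl !eX /= ?mulr0 ?addr0.
rewrite /Dist_rev /ot3 ot1v ot2v o3v.
apply: (annihilator_ker3 (f1 := euler_frame lower i0 q)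
  (f2 := euler_frame lower i1 q) (f3 := euler_frame lower i2 q));
  by rewrite evDl evZl !eX /= ?mulr0 ?addr0.
Qed.

End Distribution.

(** * The (2,3,5) condition and the final assembly *)

Section Brackets.
Context {R : realType}.
Variables (U : set (coords R)) (lower : bool).
Hypothesis openU : open U.
Hypothesis sinU : forall p, U p -> sin (p 0 itheta) != 0.
Implicit Types (p q : coords R) (v w : cvec R) (s : seq 'I_5).

Let io : R[i] := iota lower.
Let io2 : io ^+ 2 = -1 := iota2 lower.

(** When the [a]-th form is constant on both fields, the derivative terms of Cartan's formula
    vanish, and the [a]-th component of the bracket depends only on the values of the fields at [p].
    Constancy is asked of this one form, so it applies to arbitrary sections of the distribution,
    which the first three forms annihilate. *)
Lemma th_lie (X Y : vfield R) p (V : set (coords R)) a cX cY :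
  open V -> V p -> mdifferentiable X p -> mdifferentiable Y p ->
  (forall q, V q -> ev_th lower q a (X q) = cX) ->
  (forall q, V q -> ev_th lower q a (Y q) = cY) ->
  ev_th lower p a (lie X Y p)
  = - \sum_b \sum_d ev_th lower p b (X p) * ev_th lower p d (Y p)
      * (wtab d a b - wtab b a d).
Proof.
move=> oV Vp dX dY hX hY.
have dt : mdifferentiable (th lower a) p.
  move=> r j; rewrite (ord1 r) (funext (fun q => thE lower a q j)).
  exact: celementary_cdifferentiable (celementary_coframe lower setT a j) (I : setT p).
have d0 (Z : vfield R) c i : (forall q, V q -> ev_th lower q a (Z q) = c) ->
    partial i (fun q => ev (th lower a q) (Z q)) p = 0.
  by move=> hZ; rewrite (partial_near i oV Vp hZ) partial_cst.
rewrite /ev_th (ev_lie dt dX dY) big1 ?add0r => [|i _]; last first.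
  by rewrite (d0 Y cY i hY) (d0 X cX i hX) !mulr0 subrr.
congr (- _).
transitivity (\sum_i \sum_j \sum_b \sum_d (coframe lower p b i * X p 0 i)
    * (coframe lower p d j * Y p 0 j) * (wtab d a b - wtab b a d)).
  apply: eq_bigr => i _; apply: eq_bigr => j _.
  rewrite ext_d_th mulr_suml; apply: eq_bigr => b _.
  by rewrite mulr_suml; apply: eq_bigr => d _; ring.
under eq_bigr => i _ do rewrite exchange_big /=.
rewrite exchange_big /=; apply: eq_bigr => b _.
under eq_bigr => i _ do rewrite exchange_big /=.
rewrite exchange_big /=; apply: eq_bigr => d _.
rewrite /ev big_distrlr /= mulr_suml; apply: eq_bigr => i _.
by rewrite mulr_suml; apply: eq_bigr => j _; rewrite !thE.
Qed.

Lemma th_lie_vec (X Y : vfield R) p (V : set (coords R)) a cX cY :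
  open V -> V p -> mdifferentiable X p -> mdifferentiable Y p ->
  (forall q, V q -> ev_th lower q a (X q) = cX) ->
  (forall q, V q -> ev_th lower q a (Y q) = cY) ->
  let m b d := ev_th lower p b (X p) * ev_th lower p d (Y p)
    - ev_th lower p d (X p) * ev_th lower p b (Y p) in
  ev_th lower p a (lie X Y p) = - vec
  [:: - 3 / 4 * m i0 i1 - 3 / 2 * m i1 i2 - 3 / 2 * m i1 i4 + m i2 i3;
      - 3 / 2 * m i0 i2 - 3 / 2 * m i0 i4 + m i2 i4;
      3 / 4 * m i0 i3 - 3 / 4 * m i1 i4 + m i3 i4;
      - 3 / 4 * m i0 i2 - 3 / 4 * m i0 i4 + 1 / 2 * m i2 i4;
      - 3 / 4 * m i0 i3 - 3 / 4 * m i1 i2 + 1 / 2 * m i2 i3 - 3 / 2 * m i3 i4] a.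
Proof.
move=> oV Vp dX dY hX hY m.
rewrite (th_lie oV Vp dX dY hX hY); congr (- _).
exact: (wtab_structure (fun b => ev_th lower p b (X p)) (fun b => ev_th lower p b (Y p)) a).
Qed.

Let mdiff_smooth (X : vfield R) (V : set (coords R)) p :
  smooth_rV V X -> V p -> mdifferentiable X p.
Proof. by move=> sX Vp r j; rewrite (ord1 r); exact: smooth_cdifferentiable (sX j) Vp. Qed.

Let kdeltaE (a b : 'I_5) : kdelta a b = (a == b)%:R :> R[i].
Proof.
by rewrite /kdelta; case: (a =P b) => [->|ab]; rewrite ?eqnE ?eqxx //; case: eqP => // /val_inj.
Qed.

Lemma lie_frame_vf p b d a : U p -> let m b' d' : R[i] :=
    kdelta b' b * kdelta d' d - kdelta d' b * kdelta b' d in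
  ev_th lower p a (lie (frame_vf lower b) (frame_vf lower d) p) = - vec
  [:: - 3 / 4 * m i0 i1 - 3 / 2 * m i1 i2 - 3 / 2 * m i1 i4 + m i2 i3;
      - 3 / 2 * m i0 i2 - 3 / 2 * m i0 i4 + m i2 i4;
      3 / 4 * m i0 i3 - 3 / 4 * m i1 i4 + m i3 i4;
      - 3 / 4 * m i0 i2 - 3 / 4 * m i0 i4 + 1 / 2 * m i2 i4;
      - 3 / 4 * m i0 i3 - 3 / 4 * m i1 i2 + 1 / 2 * m i2 i3 - 3 / 2 * m i3 i4] a.
Proof.
move=> Up m.
have df c : mdifferentiable (frame_vf lower c) p.
  by apply: (mdiff_smooth (V := U)) => //; exact: (smooth_frame_vf lower sinU c openU).
rewrite (th_lie_vec openU Up (df b) (df d) (fun q Uq => th_frame_vf lower sinU a b Uq)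
  (fun q Uq => th_frame_vf lower sinU a d Uq)).
by rewrite !(th_frame_vf lower sinU _ _ Up) -!kdeltaE.
Qed.

(* [D] and [D1 = [D, D]] in the frame dual to the Cartan coframe. *)
Let D : distrib R := frame_span lower [:: i3; i4].
Let D1 : distrib R := frame_span lower [:: i2; i3; i4].

Let section_mdiff s (V : set (coords R)) X p : is_section V (frame_span lower s) X ->
  V p -> mdifferentiable X p.
Proof. by move=> [sX _]; exact: mdiff_smooth. Qed.

Let lie_DD (V : set (coords R)) (X Y : vfield R) p : nbhd_in U p V ->
  is_section V D X -> is_section V D Y -> lie X Y p \in D1 p.
Proof.
move=> [oV Vp VU] sX sY; apply/(mem_frame_span lower sinU _ _ (VU _ Vp)).
have zX Z : is_section V D Z -> forall b, b \notin [:: i3; i4] ->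
    forall q, V q -> ev_th lower q b (Z q) = 0.
  move=> [_ dZ] b bs q Vq.
  by have /(mem_frame_span lower sinU _ _ (VU _ Vq)) := dZ q Vq; apply.
have x0 b bs := zX X sX b bs p Vp; have y0 b bs := zX Y sY b bs p Vp.
have dX := section_mdiff sX Vp; have dY := section_mdiff sY Vp.
(* Every wedge product in the exterior derivatives of the first two forms has a factor among the
   first three forms, all zero on sections of [D]. *)
apply: ord5P => // _.
- rewrite (th_lie_vec oV Vp dX dY (zX X sX i0 isT) (zX Y sY i0 isT)) /vec /=.
  by rewrite !(x0 i0 isT, x0 i1 isT, x0 i2 isT, y0 i0 isT, y0 i1 isT, y0 i2 isT); ring.
- rewrite (th_lie_vec oV Vp dX dY (zX X sX i1 isT) (zX Y sY i1 isT)) /vec /=.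
  by rewrite !(x0 i0 isT, x0 i1 isT, x0 i2 isT, y0 i0 isT, y0 i1 isT, y0 i2 isT); ring.
Qed.

Let coordC k : coords R -> R[i] := fun q => (q 0 k)%:C%C.

Let celementary_coordC (V : set (coords R)) k : celementary V (coordC k).
Proof. by apply: celementary_real; exact: elementary_coord. Qed.

Let dir_coordC (X : vfield R) k p : \sum_i X p 0 i * partial i (coordC k) p = X p 0 k.
Proof.
have pk i : partial i (coordC k) p = (i == k)%:R.
  by rewrite /coordC partial_real partialR_coord rmorph_nat.
rewrite (bigD1 k) //= pk eqxx mulr1 big1 ?addr0 // => i /negPf ik.
by rewrite pk ik mulr0.
Qed.

(* If a subspace contains the brackets of sections of [D], it contains [D]:
   bracket with [x e] for a coordinate function [x]. *)
Let bracket_frame s p (W : {vspace cvec R}) b d k :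
  U p -> b \in s -> d \in [:: i3; i4] -> frame_vf lower b p 0 k != 0 ->
  (forall V X Y, nbhd_in U p V -> is_section V (frame_span lower s) X ->
    is_section V D Y -> lie X Y p \in W) ->
  (lie (frame_vf lower b) (frame_vf lower d) p \in W) && (frame_vf lower d p \in W).
Proof.
move=> Up bs dD k0 hW.
have UU : nbhd_in U p U by split.
have sb := frame_vf_section lower sinU openU (fun _ => id) bs.
have sd := frame_vf_section lower sinU openU (fun _ => id) dD.
have lW := hW U _ _ UU sb sd; rewrite lW /=.
have sd' : is_section U D (fun q => coordC k q *: frame_vf lower d q).
  split=> [j|q Uq]; last by apply: memvZ; exact: (proj2 sd).
  rewrite (_ : (fun _ => _) = fun q => coordC k q * frame lower q j d).
    apply: smooth_celementary => //; apply: celementaryM; first exact: celementary_coordC.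
    exact: celementary_frame.
  by apply: funext => q; rewrite mxE frame_vfE.
have := hW U _ _ UU sb sd'.
rewrite lieZ; last 2 first.
- exact: celementary_cdifferentiable (celementary_coordC U k) Up.
- exact: section_mdiff sd Up.
rewrite dir_coordC => h.
rewrite -[frame_vf lower d p]scale1r -(mulVf k0) -scalerA; apply: memvZ.
rewrite (_ : _ *: _ = coordC k p *: lie (frame_vf lower b) (frame_vf lower d) p
  + frame_vf lower b p 0 k *: frame_vf lower d p - coordC k p *: lie (frame_vf lower b) (frame_vf lower d) p).
  by apply: memvB h _; exact: memvZ.
by rewrite addrAC subrr add0r.
Qed.

Let lie_comb p b d (c : seq R[i]) : U p ->
  (forall a, ev_th lower p a (lie (frame_vf lower b) (frame_vf lower d) p) = vec c a) ->
  lie (frame_vf lower b) (frame_vf lower d) p = vec c i0 *: frame_vf lower i0 p + vec c i1 *: frame_vf lower i1 p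
    + vec c i2 *: frame_vf lower i2 p + vec c i3 *: frame_vf lower i3 p + vec c i4 *: frame_vf lower i4 p.
Proof.
move=> Up ca; rewrite {1}(frame_decomp lower sinU (lie _ _ _) Up).
by under eq_bigr => a _ do rewrite ca; rewrite sum5.
Qed.

(** The three brackets below show the growth of the distribution: modulo its own directions, the
    bracket of frame vectors 3 and 4 gives direction 2, and the brackets of 2 with 3 and 4 give
    directions 0 and 1. *)
Let lie34 p : U p -> lie (frame_vf lower i3) (frame_vf lower i4) p
  = - frame_vf lower i2 p + (3 / 2) *: frame_vf lower i4 p.
Proof.
move=> Up; rewrite (lie_comb (c := [:: 0; 0; -1; 0; 3 / 2]) Up) => [|a].
  by rewrite /vec /= !scale0r !add0r addr0 scaleN1r.
rewrite (lie_frame_vf _ _ _ Up); move: a; apply: ord5P;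
  by cbv beta iota zeta delta [vec nth kdelta eqn nat_of_ord i0 i1 i2 i3 i4]; field.
Qed.

Let lie23 p : U p -> lie (frame_vf lower i2) (frame_vf lower i3) p
  = - frame_vf lower i0 p - 2^-1 *: frame_vf lower i4 p.
Proof.
move=> Up; rewrite (lie_comb (c := [:: -1; 0; 0; 0; - 2^-1]) Up) => [|a].
  by rewrite /vec /= !scale0r !addr0 scaleN1r scaleNr.
rewrite (lie_frame_vf _ _ _ Up); move: a; apply: ord5P;
  by cbv beta iota zeta delta [vec nth kdelta eqn nat_of_ord i0 i1 i2 i3 i4]; field.
Qed.

Let lie24 p : U p -> lie (frame_vf lower i2) (frame_vf lower i4) p
  = - frame_vf lower i1 p - 2^-1 *: frame_vf lower i3 p.
Proof.
move=> Up; rewrite (lie_comb (c := [:: 0; -1; 0; - 2^-1; 0]) Up) => [|a].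
  by rewrite /vec /= !scale0r !addr0 add0r scaleN1r scaleNr.
rewrite (lie_frame_vf _ _ _ Up); move: a; apply: ord5P;
  by cbv beta iota zeta delta [vec nth kdelta eqn nat_of_ord i0 i1 i2 i3 i4]; field.
Qed.

(** Together with [fr4_q], supplies the nonzero component by which [bracket_frame] divides: [X1] has
    a unit component along x, [X2] along q. *)
Let fr3_x p : frame_vf lower i3 p 0 ix != 0.
Proof.
have io0 : io != 0.
  by apply/eqP => v0; move: io2; rewrite v0 expr0n /= => /esym/eqP; rewrite oppr_eq0 oner_eq0.
rewrite frame_vf3E mxE mulf_neq0 ?oppr_eq0 //.
  by rewrite mulf_neq0 // invr_neq0 // pnatr_eq0.
have -> : X1 p 0 ix = ddc ix p 0 ix + E2 p 0 ix :> R[i] by rewrite mxE.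
have -> : E2 p 0 ix = 0 :> R[i] by rewrite E2E !eqE /=; ring.
by rewrite ddcE eqxx addr0 oner_eq0.
Qed.

Let fr4_q p : frame_vf lower i4 p 0 iq != 0.
Proof.
have x0 : e3xV lower p != 0.
  by apply/eqP => v0; have := e3xVK lower p; rewrite v0 mulr0 => /esym/eqP; rewrite oner_eq0.
rewrite frame_vf4E mxE mulf_neq0 //; first by rewrite mulf_neq0 // invr_neq0 // pnatr_eq0.
have -> : X2 lower p 0 iq = ddc iq p 0 iq + e3x lower p * E1 p 0 iq
    - (pm lower * 3 * iC * e3x lower p) * E3 p 0 iq :> R[i] by rewrite !mxE.
have -> : E1 p 0 iq = 0 :> R[i] by rewrite E1E !eqE /=; ring.
have -> : E3 p 0 iq = 0 :> R[i] by rewrite E3E !eqE /=; ring.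
by rewrite ddcE eqxx !mulr0 subr0 addr0 oner_eq0.
Qed.

(** The first argument of the bracket ranges over sections of a larger span, so that both [D, D] and
    [D1, D] are covered. *)
Let bracket_mem s p (W : {vspace cvec R}) : U p -> {subset [:: i3; i4] <= s} ->
  (forall V X Y, nbhd_in U p V -> is_section V (frame_span lower s) X ->
    is_section V D Y -> lie X Y p \in W) ->
  [/\ frame_vf lower i2 p \in W, frame_vf lower i3 p \in W & frame_vf lower i4 p \in W].
Proof.
move=> Up ss hW.
have /andP[l34 f4] := bracket_frame Up (ss i3 isT) (isT : i4 \in [:: i3; i4]) (fr3_x p) hW.
have /andP[_ f3] := bracket_frame Up (ss i4 isT) (isT : i3 \in [:: i3; i4]) (fr4_q p) hW.
split=> //; rewrite -[frame_vf lower i2 p]opprK memvN.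
rewrite (_ : - _ = lie (frame_vf lower i3) (frame_vf lower i4) p - (3 / 2) *: frame_vf lower i4 p).
  by apply: memvB => //; exact: memvZ.
by rewrite lie34 // addrK.
Qed.

Lemma Dist_235 : is_235 U (Dist lower).
Proof.
have -> : Dist lower = D by apply: funext => q; exact: Dist_frame.
exists D1, (fun=> fullv); split.
- exact: frame_span_distribution.
- split; last exact: frame_span_distribution.
  move=> p Up; split=> [V X Y|W hW]; first exact: lie_DD.
  have [f2 f3 f4] := bracket_mem Up (fun _ => id) hW.
  by rewrite /D1 /frame_span /= !span_cons span_nil addv0 !subv_add -!memvE f2 f3 f4.
- split=> [cb p Up|//]; split=> [V X Y _ _ _|W hW]; first exact: memvf.
  have ss : {subset [:: i3; i4] <= [:: i2; i3; i4]} by move=> b bs; rewrite inE bs orbT.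
  have [f2 f3 f4] := bracket_mem Up ss hW.
  have sec b : b \in [:: i2; i3; i4] -> is_section U D1 (frame_vf lower b).
    by move=> bs; exact: (frame_vf_section lower sinU openU (fun _ => id) bs).
  have secD b : b \in [:: i3; i4] -> is_section U D (frame_vf lower b).
    by move=> bs; exact: (frame_vf_section lower sinU openU (fun _ => id) bs).
  have UU : nbhd_in U p U by split.
  have f0 : frame_vf lower i0 p \in W.
    rewrite -[frame_vf lower i0 p]opprK memvN.
    rewrite (_ : - _ = lie (frame_vf lower i2) (frame_vf lower i3) p + 2^-1 *: frame_vf lower i4 p).
      apply: memvD; last exact: memvZ.
      exact: hW UU (sec i2 isT) (secD i3 isT).
    by rewrite lie23 // subrK.
  have f1 : frame_vf lower i1 p \in W.
    rewrite -[frame_vf lower i1 p]opprK memvN.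
    rewrite (_ : - _ = lie (frame_vf lower i2) (frame_vf lower i4) p + 2^-1 *: frame_vf lower i3 p).
      apply: memvD; last exact: memvZ.
      exact: hW UU (sec i2 isT) (secD i4 isT).
    by rewrite lie24 // subrK.
  apply/subvP => v _; rewrite (frame_decomp lower sinU v Up); apply: memv_suml => b _.
  by apply: memvZ; move: b; apply: ord5P.
Qed.

Lemma cartan_coframe_Dist : cartan_coframe U (Dist lower) (cartan_frame (th lower)).
Proof.
have sth b : smooth_rV U (th lower b).
  move=> j; rewrite (funext (fun q => thE lower b q j)).
  by apply: smooth_celementary => //; exact: celementary_coframe.
have scomb c : smooth_rV U (comb (th lower) c).
  move=> j; rewrite (funext (fun q => combE (th lower) c q j)).
  apply: smooth_celementary => //; apply: celementary_sum => b.
  apply: celementaryM; first exact: celementary_cst.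
  by rewrite (funext (fun q => thE lower b q j)); exact: celementary_coframe.
split.
- move=> a; do 12 (rewrite in_cons => /predU1P[->|]; first by [exact: sth|exact: scomb]).
  by rewrite in_nil.
- move=> q Uq; rewrite basisEdim; apply/andP; split; last by rewrite dimvf.
  apply/subvP => a _.
  have -> : a = \sum_b ev a (frame_vf lower b q) *: th lower b q.
    apply/rowP => j.
    have dE c : ev c (delta_mx 0 j) = c 0 j.
      rewrite /ev (bigD1 j) //= mxE !eqxx mulr1 big1 ?addr0 // => k /negPf kj.
      by rewrite mxE eqxx kj mulr0.
    rewrite -[LHS]dE (frame_decomp lower sinU (delta_mx 0 j) Uq) ev_sum summxE.
    apply: eq_bigr => b _; rewrite evZ mulrC [RHS]mxE; congr (_ * _).
    exact: dE.
  apply: memv_suml => b _; apply/memvZ/memv_span; move: b; apply: ord5P;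
    by rewrite !inE eqxx ?orbT.
- move=> q Uq; apply/vspaceP => v; apply/idP/idP; rewrite Dist_frame mem_ker_ev.
    move=> /(mem_frame_span lower sinU _ _ Uq) h /=.
    by apply/and4P; split=> //; apply/eqP; exact: h.
  move=> /and4P[/eqP h0 /eqP h1 /eqP h2 _].
  by apply/(mem_frame_span lower sinU _ _ Uq); apply: ord5P => //= _.
- by apply: cartan_structure => q a i j; rewrite ext_d_th;
    apply: eq_bigr => b _; apply: eq_bigr => d _; rewrite !thE.
Qed.

Lemma g_metric_is_metric : is_metric (g_metric lower) U.
Proof.
split=> [i j|p Up].
  rewrite (_ : (fun _ => _) = fun q => 2^-1 * \sum_a \sum_b
      Gtab a b * coframe lower q a i * coframe lower q b j); last first.
    by apply: funext => q; rewrite g_metric_gram mxE gramE.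
  apply: smooth_celementary => //; apply: celementaryM; first exact: celementary_cst.
  apply: celementary_sum => a; apply: celementary_sum => b.
  apply: celementaryM; last exact: celementary_coframe.
  apply: celementaryM; last exact: celementary_coframe.
  exact: celementary_cst.
have [AU _] := mulmx1_unit (coframe_frame lower (sinU Up)).
rewrite g_metric_gram /gram; split.
  rewrite linearZ /= (trmx_mul ((coframe lower p)^T *m Gm) (coframe lower p)).
  by rewrite (trmx_mul (coframe lower p)^T Gm) trmxK GmT mulmxA.
rewrite unitmxZ ?unitfE ?invr_neq0 ?pnatr_eq0 //.
by rewrite (unitmx_mul (_ *m Gm)) (unitmx_mul _ Gm) unitmx_tr AU Gm_unit.
Qed.

End Brackets.

Theorem theorem5p3 (R : realType) (U : set 'rV[R]_5) (lower : bool)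
    (openU : open U) (sinU : forall p, U p -> sin (p 0 itheta) != 0) :
  [/\ is_distribution U 2 (Dist lower),
      forall p, U p ->
        annihilator (Dist lower p) = <<[:: o1 lower p; o2 p; o3 lower p]>>%VS /\
        annihilator (Dist_rev lower p)
          = <<[:: ot1 lower p; ot2 p; ot3 lower p]>>%VS,
      maximally_symmetric U (Dist lower),
      nurowski_representative U (Dist lower) (g_metric lower) /\
        (forall p, U p -> g_metric lower p = g_metric_alt lower p)
    & conformally_flat U (g_metric lower)].
Proof.
have D235 := Dist_235 lower openU sinU.
have coframe := cartan_coframe_Dist lower openU sinU.
(* The coframe and both conformal factors exist on all of [U], so [U] itself serves as the
   neighbourhood of every point. *)
have UU p : U p -> nbhd_in U p U by split.
split.
- by case: D235 => [D1 [D2 []]].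
- by move=> p Up; exact: (annihilator_Dist lower sinU Up).
- split=> // p Up; exists U, (cartan_frame (th lower)); split=> //; first exact: UU.
  by rewrite cartan_gram; exact: (weyl_gram lower openU sinU).
- split; last by move=> p _; rewrite g_metric_gram g_metric_alt_gram.
  split=> //; first exact: (g_metric_is_metric lower openU sinU).
  move=> p Up; exists U, (cartan_frame (th lower)), (fun=> 2^-1); split=> //.
  + exact: UU.
  + split=> [|q _]; last by rewrite invr_neq0 // pnatr_eq0.
    by apply: smooth_celementary => //; exact: celementary_cst.
  + by move=> q _; rewrite g_metric_gram cartan_gram.
- move=> p Up; exists U, flat_factor; split; first exact: UU.
    split; first exact: (smooth_celementary openU (celementary_flat_factor sinU)).
    by move=> q Uq; exact: (flat_factor_neq0 sinU Uq).
  exact: (g_metric_flat lower openU sinU).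
Qed.
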